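(* Let $r\ge 0$ be an integer and let $z,\omega_1,\dots,\omega_r\in\mathfrak{H}=\{w\in\mathbf{C}: \operatorname{Im} w>0\}$. Write $\boldsymbol{\omega}=(\omega_1,\dots,\omega_r)$. Then for all $s\in\mathbf{C}$, $$\xi_{r+1}(s,z\mid -1;\boldsymbol{\omega})=\frac{e^{-\frac{\pi}{2}is}(2\pi)^s}{\Gamma(s)}\sum_{n=1}^{\infty}\frac{n^{s-1}e^{2\pi i n z}}{(1-e^{2\pi i n\omega_1})\cdots(1-e^{2\pi i n\omega_r})}.$$
   Context: Conventions: for $w\in\mathbf{C}\setminus\{0\}$, $\arg w\in(-\pi,\pi]$ and $w^{-s}=\exp(-s(\log|w|+i\arg w))$. Barnes zeta function: for nonzero $z,\omega_1,\dots,\omega_r$ whose arguments (including that of $z$) have maximum minus minimum $<\pi$, $\zeta_r(s,z\mid\omega_1,\dots,\omega_r)=\sum_{m_1,\dots,m_r\ge0}(z+m_1\omega_1+\cdots+m_r\omega_r)^{-s}$ for $\operatorname{Re}(s)>r$, continued meromorphically to $s\in\mathbf{C}$. Bilateral zeta function: let $r\ge0$, $0<\arg\omega_0\le\pi$, $\arg\omega_0-\pi\le\arg z\le\arg\omega_0$, and $\arg\omega_0-\pi<\arg\omega_j<\arg\omega_0$ for $1\le j\le r$. Then $$\xi_{r+1}(s,z\mid\omega_0;\boldsymbol{\omega})=\zeta_{r+1}(s,z+\omega_0\mid\omega_0,\boldsymbol{\omega})+\zeta_{r+1}(s,z\mid-\omega_0,\boldsymbol{\omega}),$$ i.e. $\sum_{n\in\mathbf{Z}}\sum_{m_1,\dots,m_r\ge0}(z+n\omega_0+m_1\omega_1+\cdots+m_r\omega_r)^{-s}$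 for $\operatorname{Re}(s)>r+1$; for other $s$ it is defined by analytic continuation in $s$. Here it is used with $\omega_0=-1=e^{\pi i}$ (so $\arg\omega_0=\pi$). $1/\Gamma(s)$ is the entire reciprocal Gamma function. *)

(* Defs.v *)
(* Stdlib world: classical reals with Coquelicot's complex numbers. *)
From Stdlib Require Import Reals Factorial List ClassicalEpsilon.
From Coquelicot Require Import Coquelicot.
Import ListNotations.

Open Scope C_scope.

Definition Cexp (w : C) : C := RtoC (exp (Re w)) * (cos (Im w), sin (Im w)).

(* Principal argument, with values in (-PI, PI]; in particular Carg (-1) = PI.
   Carg 0 is irrelevant. *)
Definition Carg (w : C) : R :=
  if Rle_dec 0 (Im w) then acos (Re w / Cmod w) else (- acos (Re w / Cmod w))%R.

(* The principal power w^s. *)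
Definition Cpower (w s : C) : C := Cexp (s * (ln (Cmod w), Carg w)).

Definition Csum (l : list C) : C := fold_right Cplus 0 l.
Definition Cprod (l : list C) : C := fold_right Cmult 1 l.

(* Unordered (absolutely convergent) summation of f over the indices
   satisfying P: convergence of the net of finite partial sums. *)
Definition is_usum {I : Type} (P : I -> Prop) (f : I -> C) (l : C) : Prop :=
  forall eps : posreal, exists S0 : list I,
    List.Forall P S0 /\
    forall S : list I, NoDup S -> List.Forall P S -> incl S0 S ->
      (Cmod (Csum (map f S) - l) < eps)%R.

Definition usum {I : Type} (P : I -> Prop) (f : I -> C) : C :=
  epsilon (inhabits (RtoC 0)) (is_usum P f).

Definition analytic_at (F : C -> C) (s0 : C) : Prop :=
  exists (a : nat -> C) (rho : posreal),
    forall s : C, (Cmod (s - s0) < rho)%R -> is_pseries a (s - s0) (F s).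

(* The value of F at the pole itself is fixed to be 0 by convention, so that a
   meromorphic function is determined by its values off a discrete set. *)
Definition pole_at (F : C -> C) (s0 : C) : Prop :=
  F s0 = 0 /\
  exists (N : nat) (G : C -> C) (rho : posreal),
    (0 < N)%nat /\ analytic_at G s0 /\ G s0 <> 0 /\
    forall s : C, s <> s0 -> (Cmod (s - s0) < rho)%R ->
      F s = G s / (s - s0) ^ N.

Definition meromorphic (F : C -> C) : Prop :=
  forall s0 : C, analytic_at F s0 \/ pole_at F s0.

(* The meromorphic continuation to C of a function f given on the half-plane
   Re s > a; it is unique when it exists. *)
Definition continuation (a : R) (f : C -> C) (s : C) : C :=
  if Rlt_dec a (Re s) then f s
  else epsilon (inhabits (fun _ : C => RtoC 0))
         (fun F : C -> C =>
            meromorphic F /\ forall t : C, (a < Re t)%R -> F t = f t) s.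

(* m_1 omega_1 + ... + m_r omega_r, for lists m and omega of length r. *)
Definition lattice_point (m : list nat) (omega : list C) : C :=
  Csum (map (fun p : nat * C => RtoC (INR (fst p)) * snd p) (combine m omega)).

(* In the next two definitions r is length omega. They are meaningful under the
   usual conditions on the arguments of z and the omega_j only. *)
Definition barnes_zeta (s z : C) (omega : list C) : C :=
  continuation (INR (length omega))
    (fun t : C =>
       usum (fun m : list nat => length m = length omega)
            (fun m : list nat => Cpower (z + lattice_point m omega) (- t)))
    s.

(* xi_{r+1}(s, z | omega0; omega). The poles of the two Barnes zeta functions
   may cancel, hence the continuation of the sum, rather than the pointwise sum
   of the continuations. *)
Definition bilateral_zeta (s z omega0 : C) (omega : list C) : C :=
  continuation (INR (length omega) + 1)
    (fun t : C =>
       barnes_zeta t (z + omega0) (omega0 :: omega)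
       + barnes_zeta t z (- omega0 :: omega))
    s.

(* s (s + 1) ... (s + n) / (n! n^s), whose limit as n -> oo is 1 / Gamma(s)
   for every complex s (Euler, Gauss). *)
Definition rGamma_approx (s : C) (n : nat) : C :=
  Cprod (map (fun k : nat => s + RtoC (INR k)) (seq 0 (S n)))
  / (RtoC (INR (fact n)) * Cpower (RtoC (INR n)) s).

(* The entire function 1 / Gamma. *)
Definition rGamma (s : C) : C :=
  epsilon (inhabits (RtoC 0))
    (fun l : C => filterlim (rGamma_approx s) eventually (locally l)).

(* Main.v *)
(** Lipschitz's formula, by a discretization. For N = 2M, averaging the binomial series
    (1 - q)^(-s) = sum_n (s)_n / n! q^n over the points q = e^{2 pi i (tau + j) / N}, -M <= j < M,
    keeps only the exponents divisible by N:
      sum_j (1 - e^{2 pi i (tau + j) / N})^(-s) = N sum_k (s)_{N k} / (N k)! e^{2 pi i k tau}.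
    Multiply by N^(-s) and let M -> oo, by dominated convergence. On the left
    N (1 - e^{2 pi i (tau + j) / N}) -> -2 pi i (tau + j); on the right Gauss's limit
    (s)_n / n! ~ n^(s - 1) / Gamma(s) gives sum_{k >= 1} k^(s - 1) e^{2 pi i k tau} / Gamma(s).
    Taking tau = z + m . omega and summing over m, which is a product of geometric series on the
    right, proves the theorem for Re s > r + 1. The right-hand side is entire in s (1 / Gamma being
    an absolutely convergent infinite product), hence it is the continuation of the left-hand
    side, by the identity theorem. *)

Require Import Defs.
From Stdlib Require Import Reals Factorial Lra Lia Permutation Classical ClassicalEpsilon.
From Coquelicot Require Import Coquelicot.
From Stdlib Require Import List.

Open Scope C_scope.

(** * Unordered sums *)

(** Two obstacles shape the estimates. The number 1 - e^{2 pi i w / N} is small whenever w is near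
    any multiple of N, so the window -M <= j < M is centred: with x = Re w, the half-angles pi x / N
    stay within 3 pi / 4 for large M, and N |1 - e^{2 pi i w / N}| >= c (1 + |x|) holds uniformly in
    M. This dominates the left side by a multiple of n^(-Re s). On the right, the term k = 0 is N^(1
    - s), and it disappears in the limit because Re s > 1. Branches are kept in one half-plane: 1 -
    q has positive real part for |q| < 1, and so has -i w for Im w > 0, so one logarithm built on
    the arctangent serves on both sides. Writing w^(-s) through -2 pi i w produces the factor e^{-pi
    i s / 2} (2 pi)^s. The two halves of the window, j >= 0 and j < 0, become the two Barnes zeta
    functions. For the continuation, entire functions are power series measured by the sums of the
    moduli of their terms, and the identity theorem moves leftward along horizontal lines, from the
    half-plane of convergence. *)

Definition rsum {I : Type} (g : I -> R) (S : list I) : R := fold_right Rplus 0%R (map g S).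
Definition csum {I : Type} (f : I -> C) (S : list I) : C := Csum (map f S).
Definition mods {I : Type} (f : I -> C) (i : I) : R := Cmod (f i).

(** Absolute convergence in quantitative form. [is_usum] gives only a value; domination, Tonelli
    and, later, the norms of entire functions need the bound [B] itself. *)
Definition abs_bdd {I : Type} (P : I -> Prop) (f : I -> C) (B : R) : Prop :=
  forall S : list I, NoDup S -> Forall P S -> (rsum (mods f) S <= B)%R.

Definition tends (u : nat -> C) (l : C) : Prop :=
  forall eps : R, (0 < eps)%R ->
    exists N0 : nat, forall N, (N0 <= N)%nat -> (Cmod (u N - l) < eps)%R.

(** A classical equality test lets lists over any index type be handled as finite sets, with union
    and difference. *)
Definition eq_dec_cl {I : Type} (x y : I) : {x = y} + {x <> y} :=
  excluded_middle_informative (x = y).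

Section FiniteSums.
Context {I : Type}.
Implicit Types (S T : list I) (f : I -> C) (g : I -> R) (P : I -> Prop).

Lemma csum_nil f : csum f nil = 0.
Proof. reflexivity. Qed.
Lemma csum_cons f i S : csum f (i :: S) = f i + csum f S.
Proof. reflexivity. Qed.
Lemma rsum_cons g i S : rsum g (i :: S) = (g i + rsum g S)%R.
Proof. reflexivity. Qed.
Lemma csum_app f S T : csum f (S ++ T) = csum f S + csum f T.
Proof.
  induction S as [|i S IH]; simpl app; [rewrite csum_nil | rewrite !csum_cons, IH]; ring.
Qed.
Lemma rsum_app g S T : rsum g (S ++ T) = (rsum g S + rsum g T)%R.
Proof.
  induction S as [|i S IH]; simpl app; [unfold rsum; simpl | rewrite !rsum_cons, IH]; ring.
Qed.
Lemma csum_perm f S T : Permutation S T -> csum f S = csum f T.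
Proof.
  induction 1 as [ | | | S T U _ IH1 _ IH2]; rewrite ?csum_cons;
    [easy | now rewrite IHPermutation | ring | congruence].
Qed.
Lemma rsum_perm g S T : Permutation S T -> rsum g S = rsum g T.
Proof.
  induction 1 as [ | | | S T U _ IH1 _ IH2]; rewrite ?rsum_cons;
    [easy | now rewrite IHPermutation | ring | congruence].
Qed.
Lemma rsum_le g1 g2 S : (forall i, In i S -> g1 i <= g2 i)%R -> (rsum g1 S <= rsum g2 S)%R.
Proof.
  induction S as [|i S IH]; intros H; [apply Rle_refl|]. rewrite !rsum_cons.
  apply Rplus_le_compat; [apply H; now left | apply IH; intros; apply H; now right].
Qed.
Lemma rsum_nonneg g S : (forall i, In i S -> 0 <= g i)%R -> (0 <= rsum g S)%R.
Proof.
  induction S as [|i S IH]; intros H; [apply Rle_refl|]. rewrite rsum_cons.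
  apply Rplus_le_le_0_compat; [apply H; now left | apply IH; intros; apply H; now right].
Qed.
Lemma mods_ge0 f i : (0 <= mods f i)%R.
Proof. apply Cmod_ge_0. Qed.
Lemma csum_ext f1 f2 S : (forall i, In i S -> f1 i = f2 i) -> csum f1 S = csum f2 S.
Proof.
  induction S as [|i S IH]; intros H; [easy|]. rewrite !csum_cons, IH, H; [easy|now left|].
  intros; apply H; now right.
Qed.
Lemma csum_plus f1 f2 S : csum (fun i => f1 i + f2 i) S = csum f1 S + csum f2 S.
Proof. induction S as [|i S IH]; [unfold csum; simpl | rewrite !csum_cons, IH]; ring. Qed.
Lemma csum_scal c f S : csum (fun i => c * f i) S = c * csum f S.
Proof. induction S as [|i S IH]; [unfold csum; simpl | rewrite !csum_cons, IH]; ring. Qed.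
Lemma rsum_scal c g S : rsum (fun i => c * g i)%R S = (c * rsum g S)%R.
Proof. induction S as [|i S IH]; [unfold rsum; simpl | rewrite !rsum_cons, IH]; ring. Qed.
Lemma csum_RtoC g S : csum (fun i => RtoC (g i)) S = RtoC (rsum g S).
Proof.
  induction S as [|i S IH]; [easy|]. now rewrite csum_cons, rsum_cons, IH, RtoC_plus.
Qed.
Lemma csum_mods_le f S : (Cmod (csum f S) <= rsum (mods f) S)%R.
Proof.
  induction S as [|i S IH]; [unfold csum, rsum; simpl; rewrite Cmod_0; lra|].
  rewrite csum_cons, rsum_cons. eapply Rle_trans; [apply Cmod_triangle|].
  apply Rplus_le_compat_l, IH.
Qed.
Lemma csum_zero f S : (forall i, In i S -> f i = 0) -> csum f S = 0.
Proof.
  induction S as [|i S IH]; intros H; [easy|]. rewrite csum_cons, IH, H; [ring|now left|].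
  intros; apply H; now right.
Qed.

Lemma split_incl S0 S : NoDup S0 -> NoDup S -> incl S0 S ->
  exists T, Permutation S (S0 ++ T) /\ NoDup T /\ incl T S /\ (forall i, In i T -> ~ In i S0).
Proof.
  intros H0 H1 Hi.
  set (T := filter (fun i => if in_dec eq_dec_cl i S0 then false else true) S).
  assert (HT : forall i, In i T <-> In i S /\ ~ In i S0).
  { intros i. unfold T. rewrite filter_In. destruct (in_dec eq_dec_cl i S0); intuition congruence. }
  assert (NT : NoDup T) by now apply NoDup_filter.
  exists T. repeat split; try easy.
  - apply NoDup_Permutation; try easy.
    + apply NoDup_app; try easy. intros i Hi0 HiT. now apply HT in HiT.
    + intros i. rewrite in_app_iff, HT.
      destruct (classic (In i S0)); intuition auto.
  - intros i HiT. now apply HT in HiT.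
  - intros i HiT. now apply HT in HiT.
Qed.

Lemma rsum_incl g S T : NoDup S -> NoDup T -> incl S T ->
  (forall i, In i T -> 0 <= g i)%R -> (rsum g S <= rsum g T)%R.
Proof.
  intros HS HT Hi Hg. destruct (split_incl S T HS HT Hi) as [U [HU [_ [HUT _]]]].
  rewrite (rsum_perm _ _ _ HU), rsum_app.
  assert (0 <= rsum g U)%R by (apply rsum_nonneg; auto). lra.
Qed.

Definition lunion S T := nodup eq_dec_cl (S ++ T).
Lemma lunion_NoDup S T : NoDup (lunion S T).
Proof. apply NoDup_nodup. Qed.
Lemma lunion_In S T i : In i (lunion S T) <-> In i S \/ In i T.
Proof. unfold lunion. now rewrite nodup_In, in_app_iff. Qed.
Lemma lunion_Forall P S T : Forall P S -> Forall P T -> Forall P (lunion S T).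
Proof.
  rewrite !Forall_forall. intros H1 H2 i Hi. apply lunion_In in Hi. destruct Hi; auto.
Qed.
Lemma lunion_l S T : incl S (lunion S T).
Proof. intros i Hi. apply lunion_In. now left. Qed.
Lemma lunion_r S T : incl T (lunion S T).
Proof. intros i Hi. apply lunion_In. now right. Qed.

End FiniteSums.

Section Usums.
Context {I : Type}.
Implicit Types (S T : list I) (f : I -> C) (P : I -> Prop) (B : R) (l : C).

Lemma is_usum_intro P f l :
  (forall eps : R, (0 < eps)%R -> exists S0, Forall P S0 /\
     forall S, NoDup S -> Forall P S -> incl S0 S -> (Cmod (csum f S - l) < eps)%R) ->
  is_usum P f l.
Proof. intros H [eps He]. exact (H eps He). Qed.

Lemma is_usum_elim P f l : is_usum P f l -> forall eps : R, (0 < eps)%R ->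
  exists S0, NoDup S0 /\ Forall P S0 /\
     forall S, NoDup S -> Forall P S -> incl S0 S -> (Cmod (csum f S - l) < eps)%R.
Proof.
  intros H eps He. destruct (H (mkposreal eps He)) as [S0 [H0 H1]].
  exists (nodup eq_dec_cl S0). split; [apply NoDup_nodup|]. split.
  - rewrite Forall_forall in *. intros i Hi. apply H0. now apply nodup_In in Hi.
  - intros S HS HP Hi. apply H1; auto. intros i Hin. apply Hi. now apply nodup_In.
Qed.

Lemma is_usum_unique P f l l' : is_usum P f l -> is_usum P f l' -> l = l'.
Proof.
  intros H H'. apply NNPP. intros Hn.
  assert (Hd : (0 < Cmod (l' - l))%R).
  { apply Cmod_gt_0. intros E. apply Hn. replace l' with (l' - l + l) by ring. rewrite E. ring. }
  assert (Hd2 : (0 < Cmod (l' - l) / 2)%R) by lra.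
  destruct (is_usum_elim _ _ _ H _ Hd2) as [S0 [_ [P0 K0]]].
  destruct (is_usum_elim _ _ _ H' _ Hd2) as [S1 [_ [P1 K1]]].
  specialize (K0 (lunion S0 S1) (lunion_NoDup _ _) (lunion_Forall _ _ _ P0 P1) (lunion_l _ _)).
  specialize (K1 (lunion S0 S1) (lunion_NoDup _ _) (lunion_Forall _ _ _ P0 P1) (lunion_r _ _)).
  set (c := csum f (lunion S0 S1)) in *.
  assert (Cmod (l' - l) <= Cmod (c - l) + Cmod (c - l'))%R; [|lra].
  replace (l' - l) with ((c - l) + - (c - l')) by ring.
  eapply Rle_trans; [apply Cmod_triangle|]. rewrite Cmod_opp. lra.
Qed.

Lemma usum_eq P f l : is_usum P f l -> usum P f = l.
Proof.
  intros H. apply (is_usum_unique P f); [|easy].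
  unfold usum. apply epsilon_spec. now exists l.
Qed.

Lemma is_usum_ext P f1 f2 l : (forall i, P i -> f1 i = f2 i) -> is_usum P f1 l -> is_usum P f2 l.
Proof.
  intros E H. apply is_usum_intro. intros eps He.
  destruct (is_usum_elim _ _ _ H _ He) as [S0 [_ [P0 K0]]].
  exists S0. split; [easy|]. intros S HS HP Hi.
  rewrite <- (csum_ext f1); [now apply K0|]. intros i Hin. apply E.
  rewrite Forall_forall in HP; auto.
Qed.

Lemma is_usum_plus P f1 f2 l1 l2 : is_usum P f1 l1 -> is_usum P f2 l2 ->
  is_usum P (fun i => f1 i + f2 i) (l1 + l2).
Proof.
  intros H1 H2. apply is_usum_intro. intros eps He.
  assert (He2 : (0 < eps / 2)%R) by lra.
  destruct (is_usum_elim _ _ _ H1 _ He2) as [S0 [_ [P0 K0]]].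
  destruct (is_usum_elim _ _ _ H2 _ He2) as [S1 [_ [P1 K1]]].
  exists (lunion S0 S1). split; [now apply lunion_Forall|]. intros S HS HP Hi.
  specialize (K0 S HS HP (incl_tran (lunion_l _ _) Hi)).
  specialize (K1 S HS HP (incl_tran (lunion_r _ _) Hi)).
  rewrite csum_plus.
  replace (csum f1 S + csum f2 S - (l1 + l2)) with ((csum f1 S - l1) + (csum f2 S - l2)) by ring.
  eapply Rle_lt_trans; [apply Cmod_triangle|]. lra.
Qed.

Lemma is_usum_scal P c f l : is_usum P f l -> is_usum P (fun i => c * f i) (c * l).
Proof.
  intros H. apply is_usum_intro. intros eps He.
  assert (Hc : (0 < Cmod c + 1)%R) by (pose proof (Cmod_ge_0 c); lra).
  destruct (is_usum_elim _ _ _ H _ (Rdiv_lt_0_compat _ _ He Hc)) as [S0 [_ [P0 K0]]].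
  exists S0. split; [easy|]. intros S HS HP Hi. specialize (K0 S HS HP Hi).
  rewrite csum_scal. replace (c * csum f S - c * l) with (c * (csum f S - l)) by ring.
  rewrite Cmod_mult. pose proof (Cmod_ge_0 c). pose proof (Cmod_ge_0 (csum f S - l)).
  apply Rle_lt_trans with ((Cmod c + 1) * Cmod (csum f S - l))%R; [nra|].
  apply (Rmult_lt_compat_l _ _ _ Hc) in K0.
  replace ((Cmod c + 1) * (eps / (Cmod c + 1)))%R with eps in K0 by (field; lra). easy.
Qed.

(** The sum is the supremum of the finite partial sums: by monotonicity, every list that contains a
    nearly optimal one is nearly optimal. *)
Lemma is_usum_ge0_ex P (g : I -> R) B :
  (forall i, P i -> 0 <= g i)%R ->
  (forall S, NoDup S -> Forall P S -> rsum g S <= B)%R ->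
  exists l, is_usum P (fun i => RtoC (g i)) l.
Proof.
  intros Hg HB.
  set (E := fun x => exists S, NoDup S /\ Forall P S /\ x = rsum g S).
  destruct (completeness E) as [m [Hub Hlub]].
  - exists B. intros x [S [HS [HP ->]]]. auto.
  - exists 0%R, nil. repeat split; constructor.
  - exists (RtoC m). apply is_usum_intro. intros eps He.
    destruct (classic (exists S0, NoDup S0 /\ Forall P S0 /\ (m - eps < rsum g S0)%R))
      as [[S0 [N0 [P0 K0]]]|Hn].
    + exists S0. split; [easy|]. intros S HS HP Hi.
      rewrite csum_RtoC, <- RtoC_minus, Cmod_R.
      assert (rsum g S <= m)%R by (apply Hub; now exists S).
      assert (rsum g S0 <= rsum g S)%R.
      { apply rsum_incl; auto. rewrite Forall_forall in HP. auto. }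
      rewrite Rabs_left1; lra.
    + exfalso. assert (m <= m - eps)%R; [|lra]. apply Hlub.
      intros x [S [HS [HP ->]]]. apply Rnot_lt_le. intros Hlt. apply Hn. now exists S.
Qed.

Lemma abs_bdd_mono P f1 f2 B : (forall i, P i -> Cmod (f1 i) <= Cmod (f2 i))%R ->
  abs_bdd P f2 B -> abs_bdd P f1 B.
Proof.
  intros H HB S HS HP. eapply Rle_trans; [|exact (HB S HS HP)].
  apply rsum_le. rewrite Forall_forall in HP. intros; apply H; auto.
Qed.

Lemma abs_bdd_ge0 P f B : abs_bdd P f B -> (0 <= B)%R.
Proof. intros H. apply (H nil); constructor. Qed.

(** Real and imaginary parts are split into positive and negative parts. Each of the four families
    is nonnegative and at most the modulus, so the nonnegative case applies. *)
Lemma abs_bdd_ex P f B : abs_bdd P f B -> exists l, is_usum P f l.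
Proof.
  intros HB.
  assert (K : forall g : I -> R, (forall i, P i -> 0 <= g i <= Cmod (f i))%R ->
     exists l, is_usum P (fun i => RtoC (g i)) l).
  { intros g Hg. apply (is_usum_ge0_ex P g B); [intros i Hi; now apply Hg|].
    intros S HS HP. eapply Rle_trans; [|exact (HB S HS HP)].
    apply rsum_le. rewrite Forall_forall in HP. intros; apply Hg; auto. }
  assert (Hre : forall i, (Rabs (fst (f i)) <= Cmod (f i) /\ Rabs (snd (f i)) <= Cmod (f i))%R).
  { intros i. pose proof (Rmax_Cmod (f i)).
    pose proof (Rmax_l (Rabs (fst (f i))) (Rabs (snd (f i)))).
    pose proof (Rmax_r (Rabs (fst (f i))) (Rabs (snd (f i)))). lra. }
  assert (Hm : forall x : R, (0 <= Rmax x 0 <= Rabs x /\ 0 <= Rmax (-x) 0 <= Rabs x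
                /\ x = Rmax x 0 - Rmax (-x) 0)%R).
  { intros x. unfold Rmax, Rabs.
    destruct (Rcase_abs x), (Rle_dec x 0), (Rle_dec (-x) 0); lra. }
  destruct (K (fun i => Rmax (fst (f i)) 0)) as [l1 H1].
  { intros i _. destruct (Hm (fst (f i))), (Hre i). lra. }
  destruct (K (fun i => Rmax (- fst (f i)) 0)) as [l2 H2].
  { intros i _. destruct (Hm (fst (f i))), (Hre i). lra. }
  destruct (K (fun i => Rmax (snd (f i)) 0)) as [l3 H3].
  { intros i _. destruct (Hm (snd (f i))), (Hre i). lra. }
  destruct (K (fun i => Rmax (- snd (f i)) 0)) as [l4 H4].
  { intros i _. destruct (Hm (snd (f i))), (Hre i). lra. }
  exists ((l1 + (- (1)) * l2) + Ci * (l3 + (- (1)) * l4)).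
  eapply is_usum_ext; [|apply is_usum_plus; [apply is_usum_plus; [exact H1|apply is_usum_scal; exact H2]|
     apply is_usum_scal; apply is_usum_plus; [exact H3|apply is_usum_scal; exact H4]]].
  intros i _. destruct (Hm (fst (f i))) as [_ [_ E1]], (Hm (snd (f i))) as [_ [_ E2]].
  apply injective_projections; simpl; lra.
Qed.

(** Enlarging [S0] until it is close to [l] adds a list disjoint from [S0], whose contribution is at
    most [e]. *)
Lemma is_usum_tail P f l S0 e :
  is_usum P f l -> NoDup S0 -> Forall P S0 ->
  (forall T, NoDup T -> Forall P T -> (forall i, In i T -> ~ In i S0) -> rsum (mods f) T <= e)%R ->
  (Cmod (csum f S0 - l) <= e)%R.
Proof.
  intros H N0 P0 HT. apply Rnot_lt_le. intros Hlt.
  set (d := (Cmod (csum f S0 - l) - e)%R) in *.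
  assert (Hd : (0 < d)%R) by (unfold d; lra).
  destruct (is_usum_elim _ _ _ H _ Hd) as [S1 [_ [P1 K1]]].
  pose proof (lunion_Forall _ _ _ P0 P1) as PU.
  specialize (K1 _ (lunion_NoDup S0 S1) PU (lunion_r _ _)).
  destruct (split_incl S0 _ N0 (lunion_NoDup S0 S1) (lunion_l _ _)) as [T [HT1 [HT2 [HT3 HT4]]]].
  rewrite (csum_perm _ _ _ HT1), csum_app in K1.
  assert (HTe : (rsum (mods f) T <= e)%R).
  { apply HT; auto. rewrite Forall_forall in *; auto. }
  pose proof (csum_mods_le f T).
  assert (Cmod (csum f S0 - l) <= Cmod (csum f S0 + csum f T - l) + Cmod (csum f T))%R; [|unfold d in *; lra].
  replace (csum f S0 - l) with ((csum f S0 + csum f T - l) + - csum f T) by ring.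
  eapply Rle_trans; [apply Cmod_triangle|]. rewrite Cmod_opp. lra.
Qed.

Lemma is_usum_Cmod_le P f l B : abs_bdd P f B -> is_usum P f l -> (Cmod l <= B)%R.
Proof.
  intros HB H. replace (Cmod l) with (Cmod (csum f nil - l)).
  - apply (is_usum_tail P); auto; constructor.
  - rewrite csum_nil. replace (0 - l) with (- l) by ring. apply Cmod_opp.
Qed.

(** Cauchy criterion: the sums of moduli over [S0] and over [S0 ++ T] both lie within [e / 2] of the
    total. *)
Lemma abs_bdd_tail P f B e : abs_bdd P f B -> (0 < e)%R ->
  exists S0, NoDup S0 /\ Forall P S0 /\
   forall T, NoDup T -> Forall P T -> (forall i, In i T -> ~ In i S0) -> (rsum (mods f) T <= e)%R.
Proof.
  intros HB He.
  destruct (is_usum_ge0_ex P (mods f) B) as [l Hl]; [intros; apply mods_ge0|exact HB|].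
  assert (He2 : (0 < e / 2)%R) by lra.
  destruct (is_usum_elim _ _ _ Hl _ He2) as [S0 [N0 [P0 K0]]].
  exists S0. repeat split; auto. intros T NT PT HT.
  pose proof (K0 S0 N0 P0 (incl_refl _)) as K1.
  assert (K2 : (Cmod (csum (fun i => RtoC (mods f i)) (S0 ++ T) - l) < e / 2)%R).
  { apply K0; [apply NoDup_app; auto; intros i H1 H2; apply (HT i); auto
              |apply Forall_app; auto|apply incl_appl, incl_refl]. }
  rewrite csum_app in K2. rewrite (csum_RtoC _ T) in K2.
  assert (0 <= rsum (mods f) T)%R by (apply rsum_nonneg; intros; apply mods_ge0).
  replace (rsum (mods f) T) with (Cmod (rsum (mods f) T)) by (rewrite Cmod_R; apply Rabs_pos_eq; auto).
  set (a := csum _ S0) in *. set (b := RtoC _) in *.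
  replace b with ((a + b - l) + - (a - l)) by ring.
  eapply Rle_trans; [apply Cmod_triangle|]. rewrite Cmod_opp. lra.
Qed.

Lemma abs_bdd_scal P c f B : abs_bdd P f B -> abs_bdd P (fun i => c * f i) (Cmod c * B)%R.
Proof.
  intros H S HS HP.
  eapply Rle_trans; [|apply Rmult_le_compat_l; [apply Cmod_ge_0|exact (H S HS HP)]].
  rewrite <- rsum_scal. apply rsum_le. intros i _. unfold mods. rewrite Cmod_mult. lra.
Qed.

Lemma abs_bdd_plus P f1 f2 B1 B2 : abs_bdd P f1 B1 -> abs_bdd P f2 B2 ->
  abs_bdd P (fun i => f1 i + f2 i) (B1 + B2)%R.
Proof.
  intros H1 H2 S HS HP. specialize (H1 S HS HP). specialize (H2 S HS HP).
  assert (rsum (mods (fun i => (f1 i + f2 i)%C)) S <= rsum (mods f1) S + rsum (mods f2) S)%R; [|lra].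
  clear. induction S as [|i S IH]; [unfold rsum; simpl; lra|]. rewrite !rsum_cons.
  unfold mods at 1 3 5. pose proof (Cmod_triangle (f1 i) (f2 i)). lra.
Qed.

Lemma is_usum_finite P f S0 : NoDup S0 -> Forall P S0 ->
  (forall i, P i -> ~ In i S0 -> f i = 0) -> is_usum P f (csum f S0).
Proof.
  intros N0 P0 H. apply is_usum_intro. intros eps He. exists S0. split; [easy|].
  intros S HS HP Hi. destruct (split_incl S0 S N0 HS Hi) as [T [HT1 [HT2 [HT3 HT4]]]].
  rewrite (csum_perm _ _ _ HT1), csum_app, (csum_zero f T).
  - replace (_ - _) with (RtoC 0) by ring. now rewrite Cmod_0.
  - intros i HiT. rewrite Forall_forall in HP. apply H; auto.
Qed.

End Usums.

Lemma tends_csum {I : Type} (f : nat -> I -> C) (f0 : I -> C) (S : list I) :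
  (forall i, In i S -> tends (fun N => f N i) (f0 i)) ->
  tends (fun N => csum (f N) S) (csum f0 S).
Proof.
  induction S as [|i S IH]; intros H eps He.
  - exists O. intros N _. rewrite !csum_nil. replace (0 - 0) with (RtoC 0) by ring. now rewrite Cmod_0.
  - assert (He2 : (0 < eps / 2)%R) by lra.
    destruct (H i (or_introl eq_refl) _ He2) as [N1 K1].
    destruct (IH (fun j Hj => H j (or_intror Hj)) _ He2) as [N2 K2].
    exists (max N1 N2). intros N HN. specialize (K1 N ltac:(lia)). specialize (K2 N ltac:(lia)).
    cbv beta in K1, K2. rewrite !csum_cons.
    replace (_ - _) with ((f N i - f0 i) + (csum (f N) S - csum f0 S)) by ring.
    eapply Rle_lt_trans; [apply Cmod_triangle|]. lra.
Qed.

Lemma tends_Cmod_le u l B N0 : tends u l -> (forall N, (N0 <= N)%nat -> Cmod (u N) <= B)%R ->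
  (Cmod l <= B)%R.
Proof.
  intros H HB. apply Rnot_lt_le. intros Hlt.
  destruct (H (Cmod l - B)%R ltac:(lra)) as [N1 K].
  specialize (K (max N0 N1) ltac:(lia)). specialize (HB (max N0 N1) ltac:(lia)).
  assert (Cmod l <= Cmod (u (max N0 N1)) + Cmod (u (max N0 N1) - l))%R; [|lra].
  replace l with (u (max N0 N1) + - (u (max N0 N1) - l)) at 1 by ring.
  eapply Rle_trans; [apply Cmod_triangle|]. rewrite Cmod_opp. lra.
Qed.

(** Dominated convergence. Outside a finite [S0] chosen for the majorant [h], the tails of [f N] and
    of [f0] are at most [eps / 4], since [f0] inherits the domination in the limit; on [S0] the sum
    is finite. [N0] is there because the applications have domination only from some index on. *)
Lemma tannery {I : Type} (P : I -> Prop) (f : nat -> I -> C) (f0 h : I -> C) (B : R)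
    (N0 : nat) (l : nat -> C) (l0 : C) :
  abs_bdd P h B ->
  (forall N i, (N0 <= N)%nat -> P i -> Cmod (f N i) <= Cmod (h i))%R ->
  (forall i, P i -> tends (fun N => f N i) (f0 i)) ->
  (forall N, (N0 <= N)%nat -> is_usum P (f N) (l N)) -> is_usum P f0 l0 -> tends l l0.
Proof.
  intros HB Hdom Hlim Hl Hl0 eps He.
  assert (He4 : (0 < eps / 4)%R) by lra.
  destruct (abs_bdd_tail P h B _ HB He4) as [S0 [NS [PS HT]]].
  pose proof PS as PS'. rewrite Forall_forall in PS'.
  destruct (tends_csum f f0 S0 (fun i Hi => Hlim i (PS' i Hi)) _ He4) as [N1 K1].
  exists (max N0 N1). intros N HN. specialize (K1 N ltac:(lia)). cbv beta in K1.
  assert (A1 : (Cmod (csum (f N) S0 - l N) <= eps / 4)%R).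
  { apply (is_usum_tail P); auto; [apply Hl; lia|]. intros T NT PT DT.
    eapply Rle_trans; [|exact (HT T NT PT DT)]. apply rsum_le. intros i Hi.
    rewrite Forall_forall in PT. apply Hdom; [lia|auto]. }
  assert (A2 : (Cmod (csum f0 S0 - l0) <= eps / 4)%R).
  { apply (is_usum_tail P); auto. intros T NT PT DT.
    eapply Rle_trans; [|exact (HT T NT PT DT)]. apply rsum_le. intros i Hi.
    rewrite Forall_forall in PT. apply (tends_Cmod_le _ _ _ N0 (Hlim i (PT i Hi))).
    intros M HM. apply Hdom; auto. }
  replace (l N - l0) with (- (csum (f N) S0 - l N) + (csum (f N) S0 - csum f0 S0) + (csum f0 S0 - l0)) by ring.
  eapply Rle_lt_trans; [apply Cmod_triangle|].
  eapply Rle_lt_trans; [apply Rplus_le_compat_r, Cmod_triangle|]. rewrite Cmod_opp. lra.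
Qed.

(** * Summation by fibres, reindexing, and Fubini *)

Section Fibers.
Context {I J : Type} (P : I -> Prop) (Q : J -> Prop) (p : I -> J).

(** One finite list [S] approximates all fibre sums over [T] at once, half of the error being spent
    on each new fibre. Keeping the points of [S0] above [T] lets [S] serve where a list must contain
    [S0]; the last inequality carries absolute bounds from [f] to its fibre sums. *)
Lemma fiber_approx (f : I -> C) (g : J -> C) :
  (forall j, Q j -> is_usum (fun i => P i /\ p i = j) f (g j)) ->
  forall T, NoDup T -> Forall Q T ->
  forall S0, NoDup S0 -> Forall P S0 -> forall eta : R, (0 < eta)%R ->
  exists S, NoDup S /\ Forall P S /\ (forall i, In i S -> In (p i) T) /\
    (forall i, In i S0 -> In (p i) T -> In i S) /\
    (Cmod (csum f S - csum g T) < eta)%R /\ (rsum (mods g) T <= rsum (mods f) S + eta)%R.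
Proof.
  intros Hg T. induction T as [|j T IH]; intros NT QT S0 N0 P0 eta He.
  { exists nil. repeat split; try constructor; try easy.
    - rewrite !csum_nil. replace (0 - 0) with (RtoC 0) by ring. now rewrite Cmod_0.
    - unfold rsum; simpl; lra. }
  assert (He2 : (0 < eta / 2)%R) by lra.
  inversion NT as [|? ? Hj NT']; subst. inversion QT as [|? ? Qj QT']; subst.
  destruct (IH NT' QT' S0 N0 P0 _ He2) as [S [NS [PS [pS [iS [K1 K2]]]]]].
  destruct (is_usum_elim _ _ _ (Hg j Qj) _ He2) as [R0 [_ [PR0 KR]]].
  set (U := lunion R0 (filter (fun i => if eq_dec_cl (p i) j then true else false) S0)).
  assert (HU : forall i, In i U <-> In i R0 \/ (In i S0 /\ p i = j)).
  { intros i. unfold U. rewrite lunion_In, filter_In.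
    destruct (eq_dec_cl (p i) j); intuition congruence. }
  assert (PU : Forall (fun i => P i /\ p i = j) U).
  { rewrite Forall_forall in *. intros i Hi. apply HU in Hi. destruct Hi as [Hi|[Hi Hi']]; auto. }
  assert (NU : NoDup U) by apply lunion_NoDup.
  specialize (KR U NU PU (fun i Hi => proj2 (HU i) (or_introl Hi))).
  exists (U ++ S). rewrite Forall_forall in PU.
  split; [|split; [|split; [|split; [|split]]]].
  - apply NoDup_app; auto. intros i H1 H2. apply pS in H2. apply PU in H1.
    destruct H1 as [_ <-]. easy.
  - apply Forall_app. split; auto. rewrite Forall_forall. intros i Hi. now apply PU.
  - intros i Hi. apply in_app_iff in Hi. destruct Hi as [Hi|Hi]; [left; symmetry; now apply PU|right; auto].
  - intros i Hi [Hp|Hp]; apply in_app_iff; [left; apply HU; auto|right; auto].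
  - rewrite csum_app, csum_cons.
    replace (_ - _) with ((csum f U - g j) + (csum f S - csum g T)) by ring.
    eapply Rle_lt_trans; [apply Cmod_triangle|]. lra.
  - rewrite rsum_app, rsum_cons. unfold mods at 1. pose proof (csum_mods_le f U).
    assert (Cmod (g j) <= Cmod (csum f U) + Cmod (csum f U - g j))%R; [|lra].
    replace (g j) with (csum f U + - (csum f U - g j)) at 1 by ring.
    eapply Rle_trans; [apply Cmod_triangle|]. rewrite Cmod_opp. lra.
Qed.

Lemma is_usum_fiber (f : I -> C) (g : J -> C) (l : C) :
  (forall i, P i -> Q (p i)) ->
  (forall j, Q j -> is_usum (fun i => P i /\ p i = j) f (g j)) ->
  is_usum P f l -> is_usum Q g l.
Proof.
  intros HPQ Hg H. apply is_usum_intro. intros eps He.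
  assert (He2 : (0 < eps / 2)%R) by lra.
  destruct (is_usum_elim _ _ _ H _ He2) as [S0 [N0 [P0 K0]]].
  exists (map p S0). split.
  { rewrite Forall_forall in *. intros j Hj. apply in_map_iff in Hj.
    destruct Hj as [i [<- Hi]]. auto. }
  intros T NT QT Hi.
  destruct (fiber_approx f g Hg T NT QT S0 N0 P0 _ He2) as [S [NS [PS [_ [iS [K1 _]]]]]].
  (* As [T] contains the image of every point of [S0], the list [S] contains all of [S0]. *)
  specialize (K0 S NS PS (fun i Hin => iS i Hin (Hi _ (in_map p _ _ Hin)))).
  replace (csum g T - l) with (- (csum f S - csum g T) + (csum f S - l)) by ring.
  eapply Rle_lt_trans; [apply Cmod_triangle|]. rewrite Cmod_opp. lra.
Qed.

Lemma abs_bdd_fiber (f : I -> C) (g : J -> C) (B : R) :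
  (forall j, Q j -> is_usum (fun i => P i /\ p i = j) f (g j)) ->
  abs_bdd P f B -> abs_bdd Q g B.
Proof.
  intros Hg HB T NT QT. apply Rle_plus_epsilon. intros eta He.
  destruct (fiber_approx f g Hg T NT QT nil (NoDup_nil _) (Forall_nil _) _ He)
    as [S [NS [PS [_ [_ [_ K]]]]]].
  specialize (HB S NS PS). lra.
Qed.

End Fibers.

Section Reindex.
Context {I J : Type} (P : I -> Prop) (Q : J -> Prop) (phi : J -> I).
Context (phi_inj : forall j j', Q j -> Q j' -> phi j = phi j' -> j = j').

Lemma abs_bdd_comp (f : I -> C) (B : R) :
  (forall j, Q j -> P (phi j)) -> abs_bdd P f B -> abs_bdd Q (fun j => f (phi j)) B.
Proof.
  intros HQP HB T NT QT. rewrite Forall_forall in QT.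
  replace (rsum (mods (fun j => f (phi j))) T) with (rsum (mods f) (map phi T)).
  - apply HB.
    + clear - NT QT phi_inj. induction T as [|j T IH]; simpl; [constructor|].
      inversion NT; subst. constructor; [|apply IH; auto; intros; apply QT; now right].
      intros Hin. apply in_map_iff in Hin. destruct Hin as [j' [E Hj']].
      apply phi_inj in E; [congruence| |]; apply QT; [now right|now left].
    + rewrite Forall_forall. intros i Hi. apply in_map_iff in Hi. destruct Hi as [j [<- Hj]]. auto.
  - unfold rsum. now rewrite map_map.
Qed.

(** Indices outside the image of [phi] contribute zero, so a list over [I] may be replaced by its
    preimages. This is what later discards the exponents not divisible by 2M. *)
Lemma preimage_list (f : I -> C) (S : list I) :
  (forall i, P i -> (exists j, Q j /\ phi j = i) \/ f i = 0) ->
  NoDup S -> Forall P S ->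
  exists T, NoDup T /\ Forall Q T /\ (forall j, Q j -> (In j T <-> In (phi j) S)) /\
    csum f S = csum (fun j => f (phi j)) T /\
    rsum (mods f) S = rsum (mods (fun j => f (phi j))) T.
Proof.
  intros Hsurj. induction S as [|i S IH]; intros NS PS.
  { exists nil. repeat split; try constructor; easy. }
  inversion NS as [|? ? Hi NS']; subst. inversion PS as [|? ? Pi PS']; subst.
  destruct (IH NS' PS') as [T [NT [QT [HT [E1 E2]]]]].
  destruct (classic (exists j, Q j /\ phi j = i)) as [[j [Qj <-]]|Hn].
  - exists (j :: T). repeat split.
    + constructor; auto. intros Hj. now apply HT in Hj.
    + now constructor.
    + intros [->|Hin]; [now left|right; now apply HT].
    + intros [E|Hin]; [left; now apply phi_inj|right; now apply HT].
    + now rewrite !csum_cons, E1.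
    + now rewrite !rsum_cons, E2.
  - exists T. repeat split; auto.
    + intros Hin; right; now apply HT.
    + intros [E|Hin]; [|now apply HT]. exfalso; apply Hn; now exists j.
    + destruct (Hsurj i Pi) as [?|E0]; [easy|]. rewrite csum_cons, E0, E1. ring.
    + destruct (Hsurj i Pi) as [?|E0]; [easy|]. rewrite rsum_cons, E2. unfold mods at 1.
      rewrite E0, Cmod_0. ring.
Qed.

Lemma is_usum_reindex (f : I -> C) (l : C) :
  (forall j, Q j -> P (phi j)) ->
  (forall i, P i -> (exists j, Q j /\ phi j = i) \/ f i = 0) ->
  is_usum Q (fun j => f (phi j)) l -> is_usum P f l.
Proof.
  intros HQP Hsurj H. apply is_usum_intro. intros eps He.
  destruct (is_usum_elim _ _ _ H _ He) as [T0 [_ [Q0 K0]]]. rewrite Forall_forall in Q0.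
  exists (map phi T0). split.
  { rewrite Forall_forall. intros i Hi. apply in_map_iff in Hi. destruct Hi as [j [<- Hj]]. auto. }
  intros S NS PS Hi. destruct (preimage_list f S Hsurj NS PS) as [T [NT [QT [HT [E _]]]]].
  rewrite E. apply K0; auto. intros j Hj. apply HT; auto. apply Hi. now apply in_map.
Qed.

Lemma abs_bdd_reindex (f : I -> C) (B : R) :
  (forall i, P i -> (exists j, Q j /\ phi j = i) \/ f i = 0) ->
  abs_bdd Q (fun j => f (phi j)) B -> abs_bdd P f B.
Proof.
  intros Hsurj H S NS PS. destruct (preimage_list f S Hsurj NS PS) as [T [NT [QT [_ [_ E]]]]].
  rewrite E. now apply H.
Qed.

End Reindex.

Definition prodP {I J : Type} (P : I -> Prop) (Q : J -> Prop) (x : I * J) : Prop :=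
  P (fst x) /\ Q (snd x).

(** A finite list meets finitely many fibres; taken off one at a time, each contributes at most its
    [M j]. *)
Lemma abs_bdd_tonelli {I J : Type} (P : I -> Prop) (Q : J -> Prop) (p : I -> J)
    (f : I -> C) (M : J -> R) (B : R) :
  (forall i, P i -> Q (p i)) ->
  (forall j, Q j -> abs_bdd (fun i => P i /\ p i = j) f (M j)) ->
  (forall T, NoDup T -> Forall Q T -> rsum M T <= B)%R ->
  abs_bdd P f B.
Proof.
  intros HPQ HM HB S NS PS.
  assert (K : forall T, NoDup T -> Forall Q T -> forall S, NoDup S -> Forall P S ->
    (forall i, In i S -> In (p i) T) -> (rsum (mods f) S <= rsum M T)%R).
  { clear S NS PS. induction T as [|j T IH]; intros NT QT S NS PS HS.
    - destruct S as [|i S]; [apply Rle_refl|]. destruct (HS i). now left.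
    - inversion NT as [|? ? Hj NT']; subst. inversion QT as [|? ? Qj QT']; subst.
      set (S1 := filter (fun i => if eq_dec_cl (p i) j then true else false) S).
      set (S2 := filter (fun i => negb (if eq_dec_cl (p i) j then true else false)) S).
      rewrite Forall_forall in PS.
      assert (E : rsum (mods f) S = (rsum (mods f) S1 + rsum (mods f) S2)%R).
      { unfold S1, S2. clear. induction S as [|i S IH]; [unfold rsum; simpl; ring|].
        simpl filter. destruct (eq_dec_cl (p i) j); simpl negb; cbv iota;
        rewrite !rsum_cons, IH; ring. }
      rewrite E, rsum_cons. apply Rplus_le_compat.
      + apply (HM j Qj); [now apply NoDup_filter|]. rewrite Forall_forall. intros i Hi.
        apply filter_In in Hi. destruct Hi as [Hi Hb]. split; [auto|].
        destruct (eq_dec_cl (p i) j); easy.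
      + apply IH; auto; [now apply NoDup_filter| |].
        * rewrite Forall_forall. intros i Hi. apply filter_In in Hi. apply PS. tauto.
        * intros i Hi. apply filter_In in Hi. destruct Hi as [Hi Hb].
          destruct (HS i Hi) as [E'|]; auto. destruct (eq_dec_cl (p i) j); simpl in Hb; congruence. }
  rewrite Forall_forall in PS.
  set (T := nodup eq_dec_cl (map p S)).
  assert (QT : Forall Q T).
  { rewrite Forall_forall. intros j Hj. apply nodup_In, in_map_iff in Hj.
    destruct Hj as [i [<- Hi]]; auto. }
  eapply Rle_trans; [|apply (HB T); auto; apply NoDup_nodup].
  apply K; auto; [apply NoDup_nodup|now apply Forall_forall|].
  intros i Hi. apply nodup_In. now apply in_map.
Qed.

Section Pairs.
Context {I J : Type} (P : I -> Prop) (Q : J -> Prop).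

Lemma fiber_fst (f : I * J -> C) (a : I) (l : C) : P a ->
  is_usum Q (fun b => f (a, b)) l -> is_usum (fun x => prodP P Q x /\ fst x = a) f l.
Proof.
  intros Pa. apply (is_usum_reindex _ _ (fun b => (a, b))).
  - congruence.
  - intros b Qb. now repeat split.
  - intros [a' b] [[_ Qb] E]. simpl in *. subst. left. now exists b.
Qed.

Lemma fiber_snd (f : I * J -> C) (b : J) (l : C) : Q b ->
  is_usum P (fun a => f (a, b)) l -> is_usum (fun x => prodP P Q x /\ snd x = b) f l.
Proof.
  intros Qb. apply (is_usum_reindex _ _ (fun a => (a, b))).
  - congruence.
  - intros a Pa. now repeat split.
  - intros [a b'] [[Pa _] E]. simpl in *. subst. left. now exists a.
Qed.

Lemma fubini_fst (f : I * J -> C) (g : I -> C) (l : C) :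
  (forall a, P a -> is_usum Q (fun b => f (a, b)) (g a)) ->
  is_usum (prodP P Q) f l -> is_usum P g l.
Proof.
  intros Hg. apply (is_usum_fiber _ _ fst); [now intros x [H _]|].
  intros a Pa. apply fiber_fst; auto.
Qed.

Lemma fubini_snd (f : I * J -> C) (g : J -> C) (l : C) :
  (forall b, Q b -> is_usum P (fun a => f (a, b)) (g b)) ->
  is_usum (prodP P Q) f l -> is_usum Q g l.
Proof.
  intros Hg. apply (is_usum_fiber _ _ snd); [now intros x [_ H]|].
  intros b Qb. apply fiber_snd; auto.
Qed.

Lemma abs_bdd_tonelli_fst (f : I * J -> C) (M : I -> R) (B : R) :
  (forall a, P a -> abs_bdd Q (fun b => f (a, b)) (M a)) ->
  (forall T, NoDup T -> Forall P T -> rsum M T <= B)%R ->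
  abs_bdd (prodP P Q) f B.
Proof.
  intros HM. apply (abs_bdd_tonelli _ _ fst); [now intros x [H _]|].
  intros a Pa. apply (abs_bdd_reindex _ Q (fun b => (a, b))); auto; [congruence|].
  intros [a' b] [[_ Qb] E]. simpl in *. subst. left. now exists b.
Qed.

Lemma abs_bdd_prod (f : I -> C) (g : J -> C) (A B : R) :
  abs_bdd P f A -> abs_bdd Q g B ->
  abs_bdd (prodP P Q) (fun x => f (fst x) * g (snd x)) (A * B)%R.
Proof.
  intros HA HB. apply (abs_bdd_tonelli_fst _ (fun a => mods f a * B)%R).
  - intros a Pa. simpl. now apply abs_bdd_scal.
  - intros T NT PT. specialize (HA T NT PT). pose proof (abs_bdd_ge0 _ _ _ HB).
    replace (rsum _ T) with (rsum (mods f) T * B)%R; [nra|].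
    rewrite Rmult_comm, <- rsum_scal. unfold rsum. f_equal. apply map_ext. intros; ring.
Qed.

(** The product family has some sum by absolute convergence; summed along the second coordinate it
    becomes [l' * f a], and uniqueness gives the value. *)
Lemma is_usum_prod (f : I -> C) (g : J -> C) (A B : R) (l l' : C) :
  abs_bdd P f A -> abs_bdd Q g B -> is_usum P f l -> is_usum Q g l' ->
  is_usum (prodP P Q) (fun x => f (fst x) * g (snd x)) (l * l').
Proof.
  intros HA HB H H'. destruct (abs_bdd_ex _ _ _ (abs_bdd_prod _ _ _ _ HA HB)) as [L HL].
  replace (l * l') with L; [easy|]. apply (is_usum_unique P (fun a => l' * f a)).
  - refine (fubini_fst _ _ _ _ HL). intros a _. simpl. rewrite Cmult_comm. now apply is_usum_scal.
  - rewrite Cmult_comm. now apply is_usum_scal.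
Qed.

End Pairs.

Definition allP {I : Type} (_ : I) : Prop := True.

Lemma Forall_allP {I : Type} (S : list I) : Forall allP S.
Proof. rewrite Forall_forall. easy. Qed.

Lemma sum_n_csum (f : nat -> C) (n : nat) : sum_n f n = csum f (seq 0 (S n)).
Proof.
  induction n as [|n IH].
  - rewrite sum_O. unfold csum; simpl. ring.
  - rewrite sum_Sn, IH, (seq_S (S n) 0), csum_app. unfold csum at 3. simpl.
    change (plus ?a ?b) with (Cplus a b). ring.
Qed.

Lemma is_usum_is_series (f : nat -> C) (l : C) : is_usum allP f l -> is_series f l.
Proof.
  intros H. apply filterlim_locally_ball_norm. intros eps.
  destruct (is_usum_elim _ _ _ H eps (cond_pos eps)) as [S0 [_ [_ K]]].
  exists (list_max S0). intros n Hn. unfold ball_norm.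
  change (Cmod (sum_n f n - l) < eps)%R. rewrite sum_n_csum.
  apply K; [apply seq_NoDup|apply Forall_allP|].
  intros i Hi. apply in_seq.
  pose proof (proj1 (list_max_le S0 (list_max S0)) (le_n _)) as HF.
  rewrite Forall_forall in HF. specialize (HF i Hi). lia.
Qed.

Lemma abs_bdd_nat (f : nat -> C) (B : R) :
  (forall n, rsum (mods f) (seq 0 n) <= B)%R -> abs_bdd allP f B.
Proof.
  intros H S NS _. eapply Rle_trans; [|exact (H (Datatypes.S (list_max S)))].
  apply rsum_incl; auto; [apply seq_NoDup| |intros; apply mods_ge0].
  intros i Hi. apply in_seq.
  pose proof (proj1 (list_max_le S (list_max S)) (le_n _)) as HF.
  rewrite Forall_forall in HF. specialize (HF i Hi). lia.
Qed.

Lemma is_usum_S (f : nat -> C) (l : C) :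
  is_usum allP (fun n => f (S n)) l -> is_usum allP f (f O + l).
Proof.
  intros H.
  assert (H1 : is_usum allP (fun n => match n with O => f O | S _ => 0 end) (f O)).
  { set (g := fun n => match n with O => f O | S _ => 0 end).
    assert (E : csum g (O :: nil) = f O) by (unfold csum; simpl; ring).
    rewrite <- E. apply is_usum_finite; [repeat constructor; easy|apply Forall_allP|].
    intros [|n] _ Hn; [destruct Hn; now left|easy]. }
  assert (H2 : is_usum allP (fun n => match n with O => 0 | S m => f (S m) end) l).
  { apply (is_usum_reindex allP allP S); [intros; lia|easy| |exact H].
    intros [|n] _; [now right|left; now exists n]. }
  eapply is_usum_ext; [|exact (is_usum_plus _ _ _ _ _ H1 H2)].
  intros [|n] _; simpl; ring.
Qed.

Lemma abs_bdd_S (f : nat -> C) (B : R) :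
  abs_bdd allP (fun n => f (S n)) B -> abs_bdd allP f (Cmod (f O) + B)%R.
Proof.
  intros H. apply abs_bdd_nat. intros [|n].
  - unfold rsum; simpl. pose proof (Cmod_ge_0 (f O)). pose proof (abs_bdd_ge0 _ _ _ H). lra.
  - simpl seq. rewrite rsum_cons. apply Rplus_le_compat_l.
    rewrite <- seq_shift. specialize (H (seq 0 n) (seq_NoDup _ _) (Forall_allP _)).
    unfold rsum in *. now rewrite map_map.
Qed.

Lemma abs_bdd_geom (q : C) : (Cmod q < 1)%R ->
  abs_bdd allP (fun n => q ^ n) (/ (1 - Cmod q)).
Proof.
  intros Hq. apply abs_bdd_nat. intros n. pose proof (Cmod_ge_0 q).
  assert (E : (rsum (mods (fun n => q ^ n)%C) (seq 0 n) * (1 - Cmod q) = 1 - Cmod q ^ n)%R).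
  { induction n as [|n IH]; [unfold rsum; simpl; ring|].
    rewrite seq_S, rsum_app, Rmult_plus_distr_r, IH. unfold rsum, mods; simpl.
    rewrite Cmod_pow. simpl. ring. }
  apply (Rmult_le_reg_r (1 - Cmod q)); [lra|]. rewrite E, Rinv_l by lra.
  pose proof (pow_le (Cmod q) n H). lra.
Qed.

Lemma C1_minus_neq0 (q : C) : (Cmod q < 1)%R -> 1 - q <> 0.
Proof.
  intros Hq E. assert (q = 1) by (replace q with (1 - (1 - q)) by ring; rewrite E; ring).
  subst. rewrite Cmod_1 in Hq. lra.
Qed.

(** The sum exists by absolute convergence, and splitting off its first term gives
    [l = 1 + q * l]. *)
Lemma is_usum_geom (q : C) : (Cmod q < 1)%R ->
  is_usum allP (fun n => q ^ n) (/ (1 - q)).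
Proof.
  intros Hq. destruct (abs_bdd_ex _ _ _ (abs_bdd_geom q Hq)) as [l Hl].
  assert (E : l = 1 + q * l).
  { apply (is_usum_unique _ _ _ _ Hl). apply (is_usum_S (fun n => q ^ n)).
    exact (is_usum_scal _ q _ _ Hl). }
  replace (/ (1 - q)) with l; [easy|].
  assert (E' : l * (1 - q) = 1) by (transitivity (l - q * l); [ring|]; rewrite E at 1; ring).
  pose proof (C1_minus_neq0 q Hq).
  replace l with (l * (1 - q) * / (1 - q)) by (field; easy). rewrite E'. ring.
Qed.

Lemma length_cons_reindex (r : nat) (f : list nat -> C) (l : C) :
  is_usum (prodP allP (fun m => length m = r)) (fun x => f (fst x :: snd x)) l ->
  is_usum (fun m => length m = S r) f l.
Proof.
  apply (is_usum_reindex _ _ (fun x : nat * list nat => fst x :: snd x)).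
  - intros [a b] [a' b'] _ _ E. simpl in E. congruence.
  - intros [a b] [_ E]. simpl in *. congruence.
  - intros [|a b] E; [easy|]. left. exists (a, b). repeat split. simpl in *. congruence.
Qed.

Lemma length_cons_abs_bdd (r : nat) (f : list nat -> C) (B : R) :
  abs_bdd (prodP allP (fun m => length m = r)) (fun x => f (fst x :: snd x)) B ->
  abs_bdd (fun m => length m = S r) f B.
Proof.
  apply (abs_bdd_reindex _ _ (fun x : nat * list nat => fst x :: snd x)).
  - intros [a b] [a' b'] _ _ E. simpl in E. congruence.
  - intros [|a b] E; [easy|]. left. exists (a, b). repeat split. simpl in *. congruence.
Qed.

Lemma is_usum_list0 (f : list nat -> C) : is_usum (fun m => length m = O) f (f nil).
Proof.
  replace (f nil) with (csum f (nil :: nil)) by (unfold csum; simpl; ring).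
  apply is_usum_finite; [repeat constructor; easy|now repeat constructor|].
  intros [|a m] E Hn; [destruct Hn; now left|easy].
Qed.

Lemma abs_bdd_list0 (f : list nat -> C) : abs_bdd (fun m => length m = O) f (Cmod (f nil)).
Proof.
  intros S NS PS. rewrite Forall_forall in PS.
  replace (Cmod (f nil)) with (rsum (mods f) (nil :: nil)) by (unfold rsum, mods; simpl; ring).
  apply rsum_incl; [easy|repeat constructor; easy| |intros; apply mods_ge0].
  intros m Hm. left. specialize (PS m Hm). now destruct m.
Qed.

(** * Real bounds *)

Lemma exp_le (x y : R) : (x <= y -> exp x <= exp y)%R.
Proof. intros [H| ->]; [apply Rlt_le, exp_increasing, H|apply Rle_refl]. Qed.

Lemma ln_ge_inv (x : R) : (0 < x -> 1 - / x <= ln x)%R.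
Proof.
  intros Hx. pose proof (Rinv_0_lt_compat _ Hx) as Hi.
  pose proof (exp_ineq1_le (ln (/ x))). rewrite exp_ln, ln_Rinv in H by easy. lra.
Qed.

Lemma ln_le_sub1 (x : R) : (0 < x -> ln x <= x - 1)%R.
Proof. intros Hx. pose proof (exp_ineq1_le (ln x)). rewrite exp_ln in H by easy. lra. Qed.

Lemma INR_S_pos (n : nat) : (0 < INR (S n))%R.
Proof. apply lt_0_INR. lia. Qed.

Lemma INR_S_ge1 (n : nat) : (1 <= INR (S n))%R.
Proof. rewrite S_INR. pose proof (pos_INR n). lra. Qed.

Lemma abs_bdd_pseries (p : R) : (1 < p)%R ->
  abs_bdd allP (fun n => RtoC (Rpower (INR (S n)) (- p))) (1 + / (p - 1))%R.
Proof.
  intros Hp.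
  assert (E : forall n, mods (fun n => RtoC (Rpower (INR (S n)) (- p))) n
                        = Rpower (INR (S n)) (- p)).
  { intros n. unfold mods. rewrite Cmod_R. apply Rabs_pos_eq, Rlt_le, exp_pos. }
  (* telescoping against n ^ -(p - 1) *)
  assert (T : forall n, (Rpower (INR (S (S n))) (- p) <=
     / (p - 1) * (Rpower (INR (S n)) (- (p - 1)) - Rpower (INR (S (S n))) (- (p - 1))))%R).
  { intros n. set (x := INR (S n)). set (y := INR (S (S n))).
    assert (Hx : (0 < x)%R) by apply INR_S_pos. assert (Hy : (0 < y)%R) by apply INR_S_pos.
    assert (Exy : (y = x + 1)%R) by (unfold y; now rewrite S_INR).
    apply (Rmult_le_reg_l (p - 1)); [lra|].
    rewrite <- Rmult_assoc, Rinv_r, Rmult_1_l by lra.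
    set (A := Rpower y (- (p - 1))). assert (HA : (0 < A)%R) by apply exp_pos.
    replace (Rpower y (- p)) with (A * / y)%R.
    2:{ unfold A. rewrite <- (Rpower_1 y) at 2 by easy. rewrite <- Rpower_Ropp, <- Rpower_plus.
        f_equal. ring. }
    replace (Rpower x (- (p - 1))) with (A * exp ((p - 1) * (ln y - ln x)))%R.
    2:{ unfold A, Rpower. rewrite <- exp_plus. f_equal. ring. }
    (* [ln (y / x) >= 1 - x / y], and [y = x + 1] makes the right side exactly [/ y]. *)
    assert (Hl : (/ y <= ln y - ln x)%R).
    { rewrite <- ln_div by easy. eapply Rle_trans; [|apply ln_ge_inv].
      - right. rewrite Exy. field. lra.
      - now apply Rdiv_lt_0_compat. }
    pose proof (exp_ineq1_le ((p - 1) * (ln y - ln x))).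
    pose proof (Rinv_0_lt_compat _ Hy).
    assert ((p - 1) * / y <= (p - 1) * (ln y - ln x))%R by (apply Rmult_le_compat_l; lra).
    assert (A * (1 + (p - 1) * / y) <= A * exp ((p - 1) * (ln y - ln x)))%R
      by (apply Rmult_le_compat_l; lra). lra. }
  assert (Hi : (0 < / (p - 1))%R) by (apply Rinv_0_lt_compat; lra).
  assert (K : forall n, (rsum (mods (fun n => RtoC (Rpower (INR (S n)) (- p)))) (seq 0 (S n))
     <= 1 + / (p - 1) * (1 - Rpower (INR (S n)) (- (p - 1))))%R).
  { induction n as [|n IH].
    - simpl seq. rewrite rsum_cons, E. unfold rsum, Rpower. simpl. rewrite ln_1, !Rmult_0_r, exp_0. lra.
    - rewrite seq_S, rsum_app. rewrite rsum_cons, E. unfold rsum at 2; simpl fold_right.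
      change (0 + S n)%nat with (S n). specialize (T n). lra. }
  apply abs_bdd_nat. intros [|n]; [unfold rsum; simpl; lra|].
  eapply Rle_trans; [apply K|].
  assert (0 < Rpower (INR (S n)) (- (p - 1)))%R by apply exp_pos. nra.
Qed.

(** The exponential absorbs [rho + 2] powers, which leaves the summable majorant K / (n + 1)^2. *)
Lemma abs_bdd_pow_exp (rho c : R) : (0 < c)%R -> exists B,
  abs_bdd allP (fun n => RtoC (Rpower (INR (S n)) rho * exp (- c * INR (S n)))) B.
Proof.
  (* The maximum with 1 keeps [p / c] positive, whatever the sign of [rho]. *)
  intros Hc. set (p := Rmax (rho + 2) 1).
  assert (Hp : (rho + 2 <= p /\ 1 <= p)%R) by (split; [apply Rmax_l|apply Rmax_r]).
  set (K := exp (p * ln (p / c))).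
  exists (Cmod K * (1 + / (2 - 1)))%R.
  refine (abs_bdd_mono _ _ (fun n => RtoC K * RtoC (Rpower (INR (S n)) (- (2)))) _ _ _).
  2:{ apply abs_bdd_scal, abs_bdd_pseries. lra. }
  intros n _. rewrite <- RtoC_mult, !Cmod_R.
  rewrite !Rabs_pos_eq; try (apply Rmult_le_pos; apply Rlt_le, exp_pos).
  unfold K, Rpower. rewrite <- !exp_plus. set (x := INR (S n)).
  assert (Hx : (1 <= x)%R) by apply INR_S_ge1.
  assert (Hl : (0 <= ln x)%R) by (rewrite <- ln_1; apply ln_le; lra).
  assert (Ha : (0 < p / c)%R) by (apply Rdiv_lt_0_compat; lra).
  (* The tangent to [ln] at [p / c], the point where x^p e^{-c x} is largest. *)
  assert (H : (ln x <= x / (p / c) - 1 + ln (p / c))%R).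
  { replace x with (x / (p / c) * (p / c))%R at 1 by (field; lra).
    assert (0 < x / (p / c))%R by (apply Rdiv_lt_0_compat; lra).
    rewrite ln_mult by easy. pose proof (ln_le_sub1 (x / (p / c)) H). lra. }
  assert (H2 : (p * ln x <= c * x - p + p * ln (p / c))%R).
  { replace (c * x - p + p * ln (p / c))%R with (p * (x / (p / c) - 1 + ln (p / c)))%R by (field; lra).
    apply Rmult_le_compat_l; lra. }
  assert (H3 : ((rho + 2) * ln x <= p * ln x)%R) by (apply Rmult_le_compat_r; lra).
  apply exp_le. lra.
Qed.

(** * Limits of complex sequences *)

Lemma tends_const (c : C) : tends (fun _ => c) c.
Proof.
  intros eps He. exists O. intros N _. replace (c - c) with (RtoC 0) by ring. now rewrite Cmod_0.
Qed.

Lemma tends_ext_ev (u v : nat -> C) (l : C) (N0 : nat) :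
  (forall N, (N0 <= N)%nat -> u N = v N) -> tends u l -> tends v l.
Proof.
  intros E H eps He. destruct (H eps He) as [N1 K]. exists (max N0 N1). intros N HN.
  rewrite <- E by lia. apply K. lia.
Qed.

Lemma tends_subseq (u : nat -> C) (l : C) (k : nat -> nat) :
  (forall N, (N <= k N)%nat) -> tends u l -> tends (fun N => u (k N)) l.
Proof.
  intros Hk H eps He. destruct (H eps He) as [N1 K]. exists N1. intros N HN.
  apply K. specialize (Hk N). lia.
Qed.

Lemma tends_plus (u v : nat -> C) (l m : C) : tends u l -> tends v m ->
  tends (fun N => u N + v N) (l + m).
Proof.
  intros Hu Hv eps He. assert (He2 : (0 < eps / 2)%R) by lra.
  destruct (Hu _ He2) as [N1 K1]. destruct (Hv _ He2) as [N2 K2].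
  exists (max N1 N2). intros N HN. specialize (K1 N ltac:(lia)). specialize (K2 N ltac:(lia)).
  replace (_ - _) with ((u N - l) + (v N - m)) by ring.
  eapply Rle_lt_trans; [apply Cmod_triangle|]. lra.
Qed.

Lemma tends_scal (c : C) (u : nat -> C) (l : C) : tends u l -> tends (fun N => c * u N) (c * l).
Proof.
  intros Hu eps He. assert (Hc : (0 < Cmod c + 1)%R) by (pose proof (Cmod_ge_0 c); lra).
  destruct (Hu _ (Rdiv_lt_0_compat _ _ He Hc)) as [N1 K]. exists N1. intros N HN.
  specialize (K N HN). replace (_ - _) with (c * (u N - l)) by ring. rewrite Cmod_mult.
  pose proof (Cmod_ge_0 c). pose proof (Cmod_ge_0 (u N - l)).
  apply Rle_lt_trans with ((Cmod c + 1) * Cmod (u N - l))%R; [nra|].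
  apply (Rmult_lt_compat_l _ _ _ Hc) in K.
  replace ((Cmod c + 1) * (eps / (Cmod c + 1)))%R with eps in K by (field; lra). easy.
Qed.

Lemma tends_bounded (u : nat -> C) (l : C) : tends u l ->
  exists B, forall N, (Cmod (u N) <= B)%R.
Proof.
  intros H. destruct (H 1%R Rlt_0_1) as [N0 K].
  assert (HB : exists B, forall N, (N < N0)%nat -> (Cmod (u N) <= B)%R).
  { clear. induction N0 as [|N0 [B IH]]; [exists 0%R; intros; lia|].
    exists (Rmax B (Cmod (u N0))). intros N HN.
    destruct (Nat.eq_dec N N0) as [->|]; [apply Rmax_r|].
    eapply Rle_trans; [apply IH; lia|apply Rmax_l]. }
  destruct HB as [B HB]. exists (Rmax B (Cmod l + 1)). intros N.
  destruct (Nat.lt_ge_cases N N0) as [HN|HN].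
  - eapply Rle_trans; [now apply HB|apply Rmax_l].
  - eapply Rle_trans; [|apply Rmax_r]. specialize (K N HN).
    replace (u N) with (l + (u N - l)) by ring.
    eapply Rle_trans; [apply Cmod_triangle|]. lra.
Qed.

Lemma tends_mult (u v : nat -> C) (l m : C) : tends u l -> tends v m ->
  tends (fun N => u N * v N) (l * m).
Proof.
  intros Hu Hv.
  apply (tends_ext_ev (fun N => m * u N + u N * (v N - m)) _ _ O); [intros; ring|].
  replace (l * m) with (m * l + 0) by ring. apply tends_plus; [now apply tends_scal|].
  destruct (tends_bounded u l Hu) as [B HB]. intros eps He.
  assert (HB0 : (0 <= B)%R) by (eapply Rle_trans; [apply Cmod_ge_0|apply (HB O)]).
  destruct (Hv (eps / (B + 1))%R) as [N0 K]; [apply Rdiv_lt_0_compat; lra|].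
  exists N0. intros N HN. specialize (K N HN). specialize (HB N).
  replace (_ - 0) with (u N * (v N - m)) by ring. rewrite Cmod_mult.
  pose proof (Cmod_ge_0 (v N - m)).
  apply Rle_lt_trans with ((B + 1) * Cmod (v N - m))%R; [nra|].
  apply (Rmult_lt_compat_l (B + 1)) in K; [|lra].
  replace ((B + 1) * (eps / (B + 1)))%R with eps in K by (field; lra). easy.
Qed.

Lemma tends_unique (u : nat -> C) (l m : C) : tends u l -> tends u m -> l = m.
Proof.
  intros Hl Hm. assert (H : tends (fun _ : nat => RtoC 0) (l + - (1) * m)).
  { apply (tends_ext_ev (fun N => u N + - (1) * u N) _ _ O); [intros; ring|].
    apply tends_plus; [easy|now apply tends_scal]. }
  assert (E : (Cmod (l + - (1) * m) <= 0)%R).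
  { apply (tends_Cmod_le _ _ _ O H). intros. rewrite Cmod_0. lra. }
  assert (E0 : l + - (1) * m = 0) by (apply Cmod_eq_0, Rle_antisym; [easy|apply Cmod_ge_0]).
  replace l with ((l + - (1) * m) + m) by ring. rewrite E0. ring.
Qed.

Lemma tends_filterlim (u : nat -> C) (l : C) :
  tends u l <-> filterlim u eventually (locally l).
Proof.
  pose proof (@filterlim_locally_ball_norm C_AbsRing nat C_NormedModule eventually _ u l) as E.
  split.
  - intros H. apply E. intros eps. exact (H eps (cond_pos eps)).
  - intros H eps He. exact (proj1 E H (mkposreal eps He)).
Qed.

Lemma is_usum_tends (f : nat -> C) (l : C) : is_usum allP f l ->
  tends (fun n => csum f (seq 0 (S n))) l.
Proof.
  intros H. apply tends_filterlim. eapply filterlim_ext; [|exact (is_usum_is_series f l H)].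
  intros n. apply sum_n_csum.
Qed.

(** * The complex exponential *)

Lemma Cexp_pair (w : C) : Cexp w = (exp (fst w) * cos (snd w), exp (fst w) * sin (snd w))%R.
Proof. unfold Cexp, Re, Im. apply injective_projections; simpl; ring. Qed.

Lemma Cexp_plus (a b : C) : Cexp (a + b) = Cexp a * Cexp b.
Proof.
  rewrite !Cexp_pair. apply injective_projections; simpl;
  rewrite exp_plus, ?cos_plus, ?sin_plus; ring.
Qed.

Lemma Cexp_0 : Cexp 0 = 1.
Proof.
  rewrite Cexp_pair. simpl. rewrite exp_0, cos_0, sin_0.
  apply injective_projections; simpl; ring.
Qed.

Lemma Cexp_opp_l (w : C) : Cexp (- w) * Cexp w = 1.
Proof. rewrite <- Cexp_plus. replace (- w + w) with (RtoC 0) by ring. apply Cexp_0. Qed.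

Lemma Cexp_neq0 (w : C) : Cexp w <> 0.
Proof. intros E. pose proof (Cexp_opp_l w) as H. rewrite E, Cmult_0_r in H. now apply C1_nz. Qed.

Lemma Cexp_opp (w : C) : Cexp (- w) = / Cexp w.
Proof.
  pose proof (Cexp_neq0 w). rewrite <- (Cmult_1_l (/ Cexp w)), <- (Cexp_opp_l w). field. easy.
Qed.

Lemma Cmod_Cexp (w : C) : Cmod (Cexp w) = exp (Re w).
Proof.
  unfold Cexp. rewrite Cmod_mult, Cmod_R, Rabs_pos_eq by (apply Rlt_le, exp_pos).
  replace (Cmod (cos (Im w), sin (Im w))) with 1%R; [ring|].
  unfold Cmod. simpl. rewrite !Rmult_1_r. pose proof (sin2_cos2 (Im w)) as H.
  unfold Rsqr in H. rewrite Rplus_comm, H. now rewrite sqrt_1.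
Qed.

Lemma Cexp_mult_nat (n : nat) (w : C) : Cexp (RtoC (INR n) * w) = Cexp w ^ n.
Proof.
  induction n as [|n IH].
  - simpl. rewrite Cmult_0_l. apply Cexp_0.
  - rewrite S_INR, Cpow_S, <- IH, <- Cexp_plus. f_equal. rewrite RtoC_plus. ring.
Qed.

Lemma Cexp_2PI : Cexp (2 * RtoC PI * Ci) = 1.
Proof.
  rewrite Cexp_pair. simpl.
  replace ((2 * PI - 0 * 0) * 0 - (2 * 0 + 0 * PI) * 1)%R with 0%R by ring.
  replace ((2 * PI - 0 * 0) * 1 + (2 * 0 + 0 * PI) * 0)%R with (2 * PI)%R by ring.
  rewrite exp_0, cos_2PI, sin_2PI. apply injective_projections; simpl; ring.
Qed.

(** * Complex-valued functions of a real variable *)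

(** Componentwise differentiation in a real variable: the differential equations below are
    integrated only along the segment [0, 1]. *)
Definition Cderiv (f : R -> C) (x : R) (l : C) : Prop :=
  is_derive (fun t => fst (f t)) x (fst l) /\ is_derive (fun t => snd (f t)) x (snd l).

Lemma is_derive_ext_val (f g : R -> R) (x l m : R) :
  (forall t, f t = g t) -> l = m -> is_derive f x l -> is_derive g x m.
Proof. intros E <-. now apply is_derive_ext. Qed.

Lemma Cderiv_mult (f g : R -> C) (x : R) (l m : C) :
  Cderiv f x l -> Cderiv g x m -> Cderiv (fun t => f t * g t) x (l * g x + f x * m).
Proof.
  intros [F1 F2] [G1 G2]. split.
  - eapply is_derive_ext_val; cycle 2.
    + apply (is_derive_minus _ _ _ _ _ (is_derive_mult _ _ _ _ _ F1 G1 Rmult_comm)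
                                       (is_derive_mult _ _ _ _ _ F2 G2 Rmult_comm)).
    + intros t. unfold minus, plus, mult, opp; simpl. reflexivity.
    + unfold minus, plus, mult, opp; simpl. ring.
  - eapply is_derive_ext_val; cycle 2.
    + apply (is_derive_plus _ _ _ _ _ (is_derive_mult _ _ _ _ _ F1 G2 Rmult_comm)
                                       (is_derive_mult _ _ _ _ _ F2 G1 Rmult_comm)).
    + intros t. unfold minus, plus, mult, opp; simpl. reflexivity.
    + unfold minus, plus, mult, opp; simpl. ring.
Qed.

Lemma Cderiv_const (c : C) (x : R) : Cderiv (fun _ => c) x 0.
Proof. split; apply @is_derive_const. Qed.

Lemma Cderiv_val (f : R -> C) (x : R) (l m : C) : l = m -> Cderiv f x l -> Cderiv f x m.
Proof. now intros <-. Qed.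

Lemma Cderiv_scal (c : C) (f : R -> C) (x : R) (l : C) :
  Cderiv f x l -> Cderiv (fun t => c * f t) x (c * l).
Proof.
  intros H. eapply Cderiv_val; [|apply (Cderiv_mult _ _ _ _ _ (Cderiv_const c x) H)]. ring.
Qed.

Lemma Cderiv_Cexp (f : R -> C) (x : R) (l : C) :
  Cderiv f x l -> Cderiv (fun t => Cexp (f t)) x (l * Cexp (f x)).
Proof.
  intros [F1 F2].
  assert (E : is_derive (fun t => exp (fst (f t))) x (fst l * exp (fst (f x)))%R)
    by apply (is_derive_comp exp _ _ _ _ (is_derive_exp _) F1).
  assert (Ec : is_derive (fun t => cos (snd (f t))) x (snd l * - sin (snd (f x)))%R)
    by apply (is_derive_comp cos _ _ _ _ (is_derive_cos _) F2).
  assert (Es : is_derive (fun t => sin (snd (f t))) x (snd l * cos (snd (f x)))%R)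
    by apply (is_derive_comp sin _ _ _ _ (is_derive_sin _) F2).
  split.
  - eapply is_derive_ext_val; cycle 2.
    + apply (is_derive_mult _ _ _ _ _ E Ec Rmult_comm).
    + intros t. rewrite Cexp_pair. reflexivity.
    + rewrite Cexp_pair. unfold plus, mult; simpl. ring.
  - eapply is_derive_ext_val; cycle 2.
    + apply (is_derive_mult _ _ _ _ _ E Es Rmult_comm).
    + intros t. rewrite Cexp_pair. reflexivity.
    + rewrite Cexp_pair. unfold plus, mult; simpl. ring.
Qed.

Lemma Cderiv_zero_const (f : R -> C) (a b : R) :
  (forall t, a <= t <= b -> Cderiv f t 0)%R -> (a < b)%R -> f a = f b.
Proof.
  intros H Hab. apply injective_projections.
  - refine (eq_is_derive (fun t => fst (f t)) a b _ Hab). intros t Ht. now apply H.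
  - refine (eq_is_derive (fun t => snd (f t)) a b _ Hab). intros t Ht. now apply H.
Qed.

Lemma filter_le_fst (F : (C -> Prop) -> Prop) (l : C) :
  filter_le F (locally l) -> filter_le (filtermap fst F) (locally (fst l)).
Proof.
  intros H P [eps HP]. apply H. exists eps. intros y [Hy _]. now apply HP.
Qed.
Lemma filter_le_snd (F : (C -> Prop) -> Prop) (l : C) :
  filter_le F (locally l) -> filter_le (filtermap snd F) (locally (snd l)).
Proof.
  intros H P [eps HP]. apply H. exists eps. intros y [_ Hy]. now apply HP.
Qed.

Lemma sum_n_fst (f : nat -> C) (n : nat) : fst (sum_n f n) = sum_n (fun k => fst (f k)) n.
Proof. induction n as [|n IH]; [now rewrite !sum_O|]. now rewrite !sum_Sn, <- IH. Qed.
Lemma sum_n_snd (f : nat -> C) (n : nat) : snd (sum_n f n) = sum_n (fun k => snd (f k)) n.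
Proof. induction n as [|n IH]; [now rewrite !sum_O|]. now rewrite !sum_Sn, <- IH. Qed.

Lemma is_series_fst (f : nat -> C) (l : C) :
  is_series f l -> is_series (fun n => fst (f n)) (fst l).
Proof.
  intros H. unfold is_series in *. apply (filterlim_ext (fun n => fst (sum_n f n))).
  - apply sum_n_fst.
  - exact (filter_le_fst _ _ H).
Qed.
Lemma is_series_snd (f : nat -> C) (l : C) :
  is_series f l -> is_series (fun n => snd (f n)) (snd l).
Proof.
  intros H. unfold is_series in *. apply (filterlim_ext (fun n => snd (sum_n f n))).
  - apply sum_n_snd.
  - exact (filter_le_snd _ _ H).
Qed.

Lemma CV_radius_ge (a : nat -> R) (B r : R) :
  (forall n, Rabs (a n * r ^ n) <= B)%R -> Rbar_le r (CV_radius a).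
Proof. intros H. apply (proj1 (CV_radius_bounded a)). now exists B. Qed.

Lemma is_series_PSeries (a : nat -> R) (x : R) : Rbar_lt (Rabs x) (CV_radius a) ->
  is_series (fun n => a n * x ^ n)%R (PSeries a x).
Proof.
  intros H. apply is_pseries_R. apply PSeries_correct. now apply CV_radius_inside.
Qed.

(** The operator x d/dx multiplies the n-th coefficient by n; this is how the recurrence of the
    coefficients becomes a differential equation. *)
Lemma is_series_PS_shift (a : nat -> R) (x : R) : Rbar_lt (Rabs x) (CV_radius a) ->
  is_series (fun n => INR n * a n * x ^ n)%R (x * PSeries (PS_derive a) x)%R.
Proof.
  intros H.
  assert (H' : Rbar_lt (Rabs x) (CV_radius (PS_incr_1 (PS_derive a))))
    by now rewrite CV_radius_incr_1, CV_radius_derive.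
  rewrite <- PSeries_incr_1. eapply is_series_ext; [|exact (is_series_PSeries _ _ H')].
  intros n. match goal with |- ?u = ?v => change (@eq R u v) end.
  destruct n as [|n]; simpl PS_incr_1; [simpl; unfold zero; simpl; ring|unfold PS_derive; ring].
Qed.

(** Four terms, because the real part (and likewise the imaginary part) of alpha phi + beta x phi'
    has four. *)
Lemma is_series_lin4 (u1 u2 u3 u4 u : nat -> R) (c1 c2 c3 c4 l1 l2 l3 l4 : R) :
  is_series u1 l1 -> is_series u2 l2 -> is_series u3 l3 -> is_series u4 l4 ->
  (forall n, u n = c1 * u1 n + c2 * u2 n + c3 * u3 n + c4 * u4 n)%R ->
  is_series u (c1 * l1 + c2 * l2 + c3 * l3 + c4 * l4)%R.
Proof.
  intros H1 H2 H3 H4 E.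
  eapply is_series_ext; [intros n; symmetry; apply E|].
  exact (is_series_plus _ _ _ _ (is_series_plus _ _ _ _ (is_series_plus _ _ _ _
    (is_series_scal_l c1 _ _ H1) (is_series_scal_l c2 _ _ H2))
    (is_series_scal_l c3 _ _ H3)) (is_series_scal_l c4 _ _ H4)).
Qed.

(** * Hypergeometric-type coefficients *)

(** The factor from one term to the next tends to [beta], so a [k] strictly between [Cmod beta] and
    1, here the midpoint, works from some index on; [K] absorbs the earlier terms. *)
Lemma recurrence_bound (b : nat -> C) (alpha beta : C) :
  (Cmod beta < 1)%R ->
  (forall n, RtoC (INR (S n)) * b (S n) = (alpha + beta * RtoC (INR n)) * b n) ->
  exists K k, (0 < k < 1)%R /\ forall n, (Cmod (b n) <= K * k ^ n)%R.
Proof.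
  intros Hb Hrec. set (k := ((Cmod beta + 1) / 2)%R).
  pose proof (Cmod_ge_0 beta) as Hb0.
  assert (Hk : (0 < k < 1)%R) by (unfold k; lra).
  (* [n0] is so large that |alpha| <= n0 (k - |beta|), hence |alpha| + |beta| n <= k (n + 1) for n
     >= n0. *)
  destruct (archimed_cor1 ((k - Cmod beta) / (Cmod alpha + 1))) as [n0 [Hn0 Hn0']].
  { pose proof (Cmod_ge_0 alpha). apply Rdiv_lt_0_compat; unfold k; lra. }
  assert (Hn1 : (0 < INR n0)%R) by now apply lt_0_INR.
  assert (Hstep : forall n, (n0 <= n)%nat -> (Cmod (b (S n)) <= k * Cmod (b n))%R).
  { intros n Hn. pose proof (INR_S_pos n) as HS.
    apply (Rmult_le_reg_l _ _ _ HS). rewrite <- (Rabs_pos_eq (INR (S n))) at 1 by lra.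
    rewrite <- Cmod_R, <- Cmod_mult, Hrec, Cmod_mult, <- Rmult_assoc.
    apply Rmult_le_compat_r; [apply Cmod_ge_0|].
    eapply Rle_trans; [apply Cmod_triangle|]. rewrite Cmod_mult, Cmod_R, Rabs_pos_eq by apply pos_INR.
    rewrite S_INR. apply le_INR in Hn. pose proof (Cmod_ge_0 alpha).
    assert (Ha : (Cmod alpha <= INR n0 * (k - Cmod beta))%R).
    { apply (Rmult_lt_compat_r (INR n0 * (Cmod alpha + 1))) in Hn0; [|nra].
      replace (/ INR n0 * (INR n0 * (Cmod alpha + 1)))%R with (Cmod alpha + 1)%R in Hn0 by (field; lra).
      replace ((k - Cmod beta) / (Cmod alpha + 1) * (INR n0 * (Cmod alpha + 1)))%R
        with (INR n0 * (k - Cmod beta))%R in Hn0 by (field; lra). lra. }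
    assert (INR n0 * (k - Cmod beta) <= INR n * (k - Cmod beta))%R
      by (apply Rmult_le_compat_r; unfold k; lra).
    nra. }
  assert (HK : exists K, forall n, (n <= n0)%nat -> (Cmod (b n) <= K * k ^ n)%R).
  { clear - Hk. induction n0 as [|n0 [K IH]].
    - exists (Cmod (b O)). intros n Hn. replace n with O by lia. simpl. lra.
    - exists (Rmax K (Cmod (b (S n0)) / k ^ (S n0))). intros n Hn.
      assert (Hp : forall m, (0 < k ^ m)%R) by (intros; apply pow_lt; lra).
      destruct (Nat.eq_dec n (S n0)) as [->|].
      + apply Rle_trans with (Cmod (b (S n0)) / k ^ S n0 * k ^ S n0)%R.
        * right. field. apply pow_nonzero. lra.
        * apply Rmult_le_compat_r; [apply Rlt_le, Hp|apply Rmax_r].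
      + eapply Rle_trans; [apply IH; lia|].
        apply Rmult_le_compat_r; [apply Rlt_le, Hp|apply Rmax_l]. }
  destruct HK as [K HK]. exists K, k. split; [easy|].
  assert (HD : forall d, (Cmod (b (n0 + d)%nat) <= K * k ^ (n0 + d))%R).
  { induction d as [|d IH]; [rewrite Nat.add_0_r; apply HK; lia|].
    rewrite Nat.add_succ_r. eapply Rle_trans; [apply Hstep; lia|]. simpl.
    replace (K * (k * k ^ (n0 + d)))%R with (k * (K * k ^ (n0 + d)))%R by ring.
    apply Rmult_le_compat_l; lra. }
  intros n. destruct (Nat.le_gt_cases n n0); [now apply HK|].
  replace n with (n0 + (n - n0))%nat by lia. apply HD.
Qed.

(* With phi(x) = sum b_n x^n, the recurrence says (1 - beta x) phi' = alpha phi,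
   so phi * exp (- G) is constant on [0, 1]. *)
Lemma recurrence_usum (b : nat -> C) (alpha beta : C) (G : R -> C) :
  (Cmod beta < 1)%R -> b O = 1 ->
  (forall n, RtoC (INR (S n)) * b (S n) = (alpha + beta * RtoC (INR n)) * b n) ->
  G 0%R = 0 ->
  (forall x, 0 <= x <= 1 -> Cderiv G x (alpha / (1 - beta * RtoC x)))%R ->
  (exists B, abs_bdd allP b B) /\ is_usum allP b (Cexp (G 1%R)).
Proof.
  intros Hb Hb0 Hrec HG0 HG.
  destruct (recurrence_bound b alpha beta Hb Hrec) as [K [k [Hk HK]]].
  assert (HB : abs_bdd allP b (Cmod (RtoC K) * / (1 - Cmod (RtoC k)))%R).
  { refine (abs_bdd_mono _ _ (fun n => RtoC K * RtoC k ^ n) _ _ _).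
    - intros n _. rewrite Cmod_mult, Cmod_pow, !Cmod_R, (Rabs_pos_eq k) by lra.
      eapply Rle_trans; [apply HK|]. apply Rmult_le_compat_r; [apply pow_le; lra|apply Rle_abs].
    - apply abs_bdd_scal, abs_bdd_geom. rewrite Cmod_R, Rabs_pos_eq; lra. }
  split; [eexists; exact HB|].
  set (a := fun n => fst (b n)). set (c := fun n => snd (b n)).
  (* Both real series have radius at least [/ k], which exceeds 1: the endpoint x = 1, where the sum
     is wanted, lies strictly inside. *)
  assert (Hr : forall n, (Rabs (a n * (/ k) ^ n) <= K)%R /\ (Rabs (c n * (/ k) ^ n) <= K)%R).
  { intros n. pose proof (Rmax_Cmod (b n)). pose proof (HK n) as HKn.
    pose proof (Rmax_l (Rabs (a n)) (Rabs (c n))). pose proof (Rmax_r (Rabs (a n)) (Rabs (c n))).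
    change (Rmax (Rabs (a n)) (Rabs (c n)) <= Cmod (b n))%R in H.
    assert (Hkn : (0 < (/ k) ^ n)%R) by (apply pow_lt, Rinv_0_lt_compat; lra).
    assert (E : (K * k ^ n * (/ k) ^ n = K)%R).
    { rewrite Rmult_assoc, <- Rpow_mult_distr, Rinv_r, pow1 by lra. ring. }
    rewrite !Rabs_mult, (Rabs_pos_eq ((/ k) ^ n)) by lra. rewrite <- E.
    split; apply Rmult_le_compat_r; lra. }
  assert (Hcv : forall x, (0 <= x <= 1)%R ->
     Rbar_lt (Rabs x) (CV_radius a) /\ Rbar_lt (Rabs x) (CV_radius c)).
  { intros x Hx.
    assert (Hxk : Rbar_lt (Rabs x) (/ k)%R).
    { simpl. rewrite Rabs_pos_eq by lra. apply Rle_lt_trans with 1%R; [lra|].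
      rewrite <- Rinv_1. apply Rinv_lt_contravar; lra. }
    split; eapply Rbar_lt_le_trans; try exact Hxk; apply (CV_radius_ge _ K); apply Hr. }
  set (phi := fun x : R => (PSeries a x, PSeries c x) : C).
  set (dphi := fun x : R => (PSeries (PS_derive a) x, PSeries (PS_derive c) x) : C).
  assert (Hphi : forall x, (0 <= x <= 1)%R -> Cderiv phi x (dphi x)).
  { intros x Hx. destruct (Hcv x Hx). split; now apply is_derive_PSeries. }
  (* The differential equation is checked coefficient by coefficient, on real and imaginary parts;
     [Hre] and [Him] are the two halves of the recurrence. *)
  assert (Hode : forall x, (0 <= x <= 1)%R -> dphi x = alpha * phi x + beta * RtoC x * dphi x).
  { intros x Hx. destruct (Hcv x Hx) as [Ha Hc].
    pose proof (is_series_PSeries a x Ha) as Sa. pose proof (is_series_PSeries c x Hc) as Sc.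
    pose proof (is_series_PS_shift a x Ha) as Da. pose proof (is_series_PS_shift c x Hc) as Dc.
    rewrite <- CV_radius_derive in Ha. rewrite <- CV_radius_derive in Hc.
    pose proof (is_series_PSeries _ x Ha) as Ea. pose proof (is_series_PSeries _ x Hc) as Ec.
    apply is_series_unique in Ea. apply is_series_unique in Ec.
    assert (Hre : forall n, (INR (S n) * a (S n) = (fst alpha + fst beta * INR n) * a n
                     - (snd alpha + snd beta * INR n) * c n)%R).
    { intros n. pose proof (f_equal fst (Hrec n)) as E.
      change (INR (S n) * a (S n) - 0 * c (S n) =
        (fst alpha + (fst beta * INR n - snd beta * 0)) * a n
        - (snd alpha + (fst beta * 0 + snd beta * INR n)) * c n)%R in E. lra. }
    assert (Him : forall n, (INR (S n) * c (S n) = (fst alpha + fst beta * INR n) * c n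
                     + (snd alpha + snd beta * INR n) * a n)%R).
    { intros n. pose proof (f_equal snd (Hrec n)) as E.
      change (INR (S n) * c (S n) + 0 * a (S n) =
        (fst alpha + (fst beta * INR n - snd beta * 0)) * c n
        + (snd alpha + (fst beta * 0 + snd beta * INR n)) * a n)%R in E. lra. }
    apply injective_projections.
    - transitivity (fst alpha * PSeries a x + - snd alpha * PSeries c x
        + fst beta * (x * PSeries (PS_derive a) x) + - snd beta * (x * PSeries (PS_derive c) x))%R;
        [|simpl; ring].
      simpl fst at 1. rewrite <- Ea. apply is_series_unique.
      apply (is_series_lin4 _ _ _ _ _ _ _ _ _ _ _ _ _ Sa Sc Da Dc).
      intros n. unfold PS_derive. rewrite Hre. ring.
    - transitivity (fst alpha * PSeries c x + snd alpha * PSeries a x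
        + fst beta * (x * PSeries (PS_derive c) x) + snd beta * (x * PSeries (PS_derive a) x))%R;
        [|simpl; ring].
      simpl snd at 1. rewrite <- Ec. apply is_series_unique.
      apply (is_series_lin4 _ _ _ _ _ _ _ _ _ _ _ _ _ Sc Sa Dc Da).
      intros n. unfold PS_derive. rewrite Him. ring. }
  set (psi := fun x => phi x * Cexp (- (1) * G x)).
  assert (Hpsi : psi 0%R = psi 1%R).
  { apply Cderiv_zero_const; [|lra]. intros x Hx.
    eapply Cderiv_val; [|apply (Cderiv_mult _ _ _ _ _ (Hphi x Hx)
      (Cderiv_Cexp _ _ _ (Cderiv_scal (- (1)) _ _ _ (HG x Hx))))].
    assert (Hn : 1 - beta * RtoC x <> 0).
    { apply C1_minus_neq0. rewrite Cmod_mult, Cmod_R, Rabs_pos_eq by lra.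
      pose proof (Cmod_ge_0 beta). nra. }
    set (e := Cexp (- (1) * G x)). specialize (Hode x Hx). set (p := phi x) in *. set (d := dphi x) in *.
    transitivity ((d * (1 - beta * RtoC x) - alpha * p) * e / (1 - beta * RtoC x)); [field; easy|].
    replace (d * (1 - beta * RtoC x)) with (d - beta * RtoC x * d) by ring.
    rewrite Hode at 1. field. easy. }
  assert (E0 : psi 0%R = 1).
  { unfold psi. rewrite HG0, Cmult_0_r, Cexp_0. unfold phi. rewrite !PSeries_0.
    unfold a, c. rewrite Hb0. apply injective_projections; simpl; ring. }
  destruct (abs_bdd_ex _ _ _ HB) as [l Hl].
  replace (Cexp (G 1%R)) with l; [easy|].
  assert (El : phi 1%R = l).
  { pose proof (is_usum_is_series _ _ Hl) as Sl.
    apply injective_projections; unfold phi; simpl; apply is_pseries_unique, is_pseries_R.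
    - eapply is_series_ext; [|exact (is_series_fst _ _ Sl)].
      intros n. unfold a. rewrite pow1. symmetry. apply Rmult_1_r.
    - eapply is_series_ext; [|exact (is_series_snd _ _ Sl)].
      intros n. unfold c. rewrite pow1. symmetry. apply Rmult_1_r. }
  rewrite <- El. transitivity (psi 1%R * Cexp (G 1%R)); [|rewrite <- Hpsi, E0; ring].
  unfold psi. rewrite <- Cmult_assoc, <- Cexp_plus.
  replace (- (1) * G 1%R + G 1%R) with (RtoC 0) by ring. rewrite Cexp_0. ring.
Qed.

(** w^n / n!, in the recursive form that fits the recurrence above with alpha = w and beta = 0. *)
Fixpoint expcoef (w : C) (n : nat) : C :=
  match n with O => 1 | S m => w / RtoC (INR (S m)) * expcoef w m end.

Lemma INR_S_neq0 (n : nat) : RtoC (INR (S n)) <> 0.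
Proof. intros E. apply RtoC_inj in E. pose proof (INR_S_pos n). lra. Qed.

Lemma expcoef_usum (w : C) : (exists B, abs_bdd allP (expcoef w) B) /\ is_usum allP (expcoef w) (Cexp w).
Proof.
  pose proof (recurrence_usum (expcoef w) w 0 (fun x => RtoC x * w)) as H.
  cbv beta in H. rewrite (Cmult_1_l w) in H. apply H.
  - rewrite Cmod_0. lra.
  - easy.
  - intros n. cbn [expcoef]. pose proof (INR_S_neq0 n). field. easy.
  - apply Cmult_0_l.
  - intros x _. split; simpl; auto_derive; auto; field.
Qed.

Lemma expcoef_mult (c w : C) (n : nat) : expcoef (c * w) n = expcoef c n * w ^ n.
Proof.
  induction n as [|n IH]; [simpl; ring|]. cbn [expcoef]. rewrite IH, Cpow_S.
  pose proof (INR_S_neq0 n). field. easy.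
Qed.

Lemma expcoef_Cmod (c : C) (n : nat) : RtoC (Cmod (expcoef c n)) = expcoef (RtoC (Cmod c)) n.
Proof.
  induction n as [|n IH]; [simpl; now rewrite Cmod_1|]. cbn [expcoef].
  rewrite <- IH. pose proof (INR_S_pos n).
  rewrite Cmod_mult, Cmod_div, Cmod_R, Rabs_pos_eq, RtoC_mult by (try apply INR_S_neq0; lra).
  rewrite RtoC_div; [easy|lra].
Qed.

(** (s)_n / n!, the coefficient of q^n in (1 - q)^(-s). *)
Fixpoint bincoef (s : C) (n : nat) : C :=
  match n with O => 1 | S m => (s + RtoC (INR m)) / RtoC (INR (S m)) * bincoef s m end.

(** On the right half-plane this is the principal logarithm. With the arctangent it can be
    differentiated in closed form, and a positive factor visibly leaves the argument unchanged;
    [Carg_Im_pos] links it with [Carg]. *)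
Definition clog (w : C) : C := (ln (Cmod w), atan (Im w / Re w)).

Lemma Re_le_Cmod (w : C) : (Re w <= Cmod w)%R.
Proof. eapply Rle_trans; [apply Rle_abs|apply re_le_Cmod]. Qed.

Lemma Cderiv_clog (q : C) (x : R) : (0 < Re (1 - RtoC x * q))%R ->
  Cderiv (fun t => clog (1 - RtoC t * q)) x (- q / (1 - RtoC x * q)).
Proof.
  intros Hre. destruct q as [a b].
  replace (Re (1 - RtoC x * (a, b))) with (1 - x * a)%R in Hre by (simpl; ring).
  set (Y := ((1 - x * a) ^ 2 + (x * b) ^ 2)%R).
  assert (HY : (0 < Y)%R) by (unfold Y; nra).
  split.
  - apply (is_derive_ext_val (fun t => ln (sqrt ((1 - t * a) ^ 2 + (t * b) ^ 2)))
             _ _ ((- a * (1 - x * a) + b * (x * b)) / Y)%R).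
    + intros t. unfold clog, Cmod; simpl. do 2 f_equal. ring.
    + unfold Y in *. simpl. field. repeat split; nra.
    + auto_derive; fold Y.
      * replace ((1 - x * a) * ((1 - x * a) * 1) + x * b * (x * b * 1))%R with Y by (unfold Y; ring).
        split; [easy|split; [now apply sqrt_lt_R0|easy]].
      * replace ((1 + - (x * a)) * ((1 + - (x * a)) * 1) + x * b * (x * b * 1))%R with Y by (unfold Y; ring).
        pose proof (sqrt_sqrt Y (Rlt_le _ _ HY)) as HS. pose proof (sqrt_lt_R0 Y HY).
        set (r := sqrt Y) in *. rewrite <- HS. field. lra.
  - apply (is_derive_ext_val (fun t => atan (- (t * b) / (1 - t * a)))
             _ _ ((- b * (1 - x * a) - a * (x * b)) / Y)%R).
    + intros t. unfold clog; simpl. do 2 f_equal; ring.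
    + unfold Y in *. simpl. field. repeat split; nra.
    + auto_derive; [lra|]. unfold Y, Rsqr in *. simpl. field. split; [|lra]. nra.
Qed.

(** The terms satisfy the recurrence with alpha = s q and beta = q, solved by G(x) = - s log (1 - x
    q). The segment from 1 to 1 - q stays in the right half-plane, where [clog] is
    differentiable. *)
Lemma is_usum_binomial (s q : C) : (Cmod q < 1)%R ->
  (exists B, abs_bdd allP (fun n => bincoef s n * q ^ n) B) /\
  is_usum allP (fun n => bincoef s n * q ^ n) (Cexp (- s * clog (1 - q))).
Proof.
  intros Hq.
  pose proof (recurrence_usum (fun n => bincoef s n * q ^ n) (s * q) q
    (fun x => - s * clog (1 - RtoC x * q)) Hq) as H.
  cbv beta in H. rewrite (Cmult_1_l q) in H. apply H.
  - simpl. ring.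
  - intros n. cbn [bincoef]. rewrite Cpow_S. pose proof (INR_S_neq0 n). field. easy.
  - replace (1 - RtoC 0 * q) with (RtoC 1) by ring. unfold clog. rewrite Cmod_1, ln_1.
    simpl. rewrite Rdiv_0_l, atan_0. change (0%R, 0%R) with (RtoC 0). ring.
  - intros x Hx. eapply Cderiv_val; [|apply Cderiv_scal, Cderiv_clog].
    + assert (1 - RtoC x * q <> 0).
      { apply C1_minus_neq0. rewrite Cmod_mult, Cmod_R, Rabs_pos_eq by lra.
        pose proof (Cmod_ge_0 q). nra. }
      rewrite (Cmult_comm q). field. easy.
    + pose proof (Re_le_Cmod (RtoC x * q)) as Hl. rewrite Cmod_mult, Cmod_R, Rabs_pos_eq in Hl by lra.
      replace (Re (1 - RtoC x * q)) with (1 - Re (RtoC x * q))%R by (simpl; ring).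
      pose proof (Cmod_ge_0 q). nra.
Qed.

(** * Entire functions *)

(* [M rho] bounds the sum of the |a_k| rho^k: a submultiplicative norm, which makes
   infinite sums and products of entire functions a matter of real estimates. *)
Definition entire_bd (f : C -> C) (M : R -> R) : Prop :=
  exists a : nat -> C,
    (forall rho : R, (0 <= rho)%R -> abs_bdd allP (fun k => a k * RtoC rho ^ k) (M rho)) /\
    (forall s, is_usum allP (fun k => a k * s ^ k) (f s)).

Lemma abs_bdd_sub {I : Type} (P P' : I -> Prop) (f : I -> C) (B : R) :
  (forall i, P' i -> P i) -> abs_bdd P f B -> abs_bdd P' f B.
Proof. intros H HB. exact (abs_bdd_comp P P' (fun i => i) (fun _ _ _ _ E => E) f B H HB). Qed.

(** The coefficients arise by collecting the monomials [c i * s ^ d i] of equal degree, and passing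
    to fibre sums preserves the bound. Cauchy products and infinite sums of series are both of this
    shape. *)
Lemma entire_bd_gather {I : Type} (P : I -> Prop) (c : I -> C) (d : I -> nat) (f : C -> C)
    (M : R -> R) :
  (forall rho : R, (0 <= rho)%R -> abs_bdd P (fun i => c i * RtoC rho ^ d i) (M rho)) ->
  (forall s, is_usum P (fun i => c i * s ^ d i) (f s)) -> entire_bd f M.
Proof.
  intros HB Hf.
  assert (Ha : forall k, exists a, is_usum (fun i => P i /\ d i = k) c a).
  (* At radius 1 the bound controls the coefficients alone. *)
  { intros k. apply (abs_bdd_ex _ _ (M 1%R)). apply (abs_bdd_sub P); [tauto|].
    refine (abs_bdd_mono _ _ _ _ _ (HB 1%R Rle_0_1)). intros i _. rewrite Cpow_1_l, Cmult_1_r. lra. }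
  pose (a := fun k => proj1_sig (constructive_indefinite_description _ (Ha k))).
  assert (Ea : forall k, is_usum (fun i => P i /\ d i = k) c (a k))
    by (intros k; exact (proj2_sig (constructive_indefinite_description _ (Ha k)))).
  assert (Es : forall k s, is_usum (fun i => P i /\ d i = k) (fun i => c i * s ^ d i) (a k * s ^ k)).
  { intros k s. apply (is_usum_ext _ (fun i => s ^ k * c i)).
    - intros i [_ <-]. ring.
    - rewrite Cmult_comm. apply is_usum_scal, Ea. }
  exists a. split.
  - intros rho Hrho. refine (abs_bdd_fiber P allP d _ _ _ _ (HB rho Hrho)). intros k _. apply Es.
  - intros s. refine (is_usum_fiber P allP d _ _ _ _ _ (Hf s)); [easy|]. intros k _. apply Es.
Qed.

Lemma entire_bd_abs (a : nat -> C) (M : R -> R) :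
  (forall rho : R, (0 <= rho)%R -> abs_bdd allP (fun k => a k * RtoC rho ^ k) (M rho)) ->
  forall s, abs_bdd allP (fun k => a k * s ^ k) (M (Cmod s)).
Proof.
  intros Ha s. refine (abs_bdd_mono _ _ _ _ _ (Ha (Cmod s) (Cmod_ge_0 s))). intros k _.
  rewrite !Cmod_mult, !Cmod_pow, Cmod_R, Rabs_pos_eq by apply Cmod_ge_0. lra.
Qed.

Lemma entire_bd_mult (f g : C -> C) (M N : R -> R) :
  entire_bd f M -> entire_bd g N -> entire_bd (fun s => f s * g s) (fun rho => M rho * N rho)%R.
Proof.
  intros [a [Ha Fa]] [b [Hb Gb]].
  apply (entire_bd_gather (prodP allP allP) (fun x => a (fst x) * b (snd x))
    (fun x => (fst x + snd x)%nat)).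
  - intros rho Hrho. refine (abs_bdd_mono _ _ _ _ _ (abs_bdd_prod _ _ _ _ _ _ (Ha rho Hrho) (Hb rho Hrho))).
    intros [k l] _. simpl. rewrite Cpow_add_r. right. f_equal. ring.
  - intros s. refine (is_usum_ext _ _ _ _ _ (is_usum_prod allP allP _ _ _ _ _ _
      (entire_bd_abs a M Ha s) (entire_bd_abs b N Hb s) (Fa s) (Gb s))).
    intros [k l] _. simpl. rewrite Cpow_add_r. ring.
Qed.

Lemma entire_bd_sum (f : nat -> C -> C) (Mn : nat -> R -> R) (F : C -> C) (M : R -> R) :
  (forall n, entire_bd (f n) (Mn n)) ->
  (forall rho m, (0 <= rho)%R -> (rsum (fun n => Mn n rho) (seq 0 m) <= M rho)%R) ->
  (forall s, is_usum allP (fun n => f n s) (F s)) -> entire_bd F M.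
Proof.
  intros Hf HM HF.
  pose (a := fun n => proj1_sig (constructive_indefinite_description _ (Hf n))).
  assert (Ha : forall n, (forall rho : R, (0 <= rho)%R ->
        abs_bdd allP (fun k => a n k * RtoC rho ^ k) (Mn n rho)) /\
    (forall s, is_usum allP (fun k => a n k * s ^ k) (f n s)))
    by (intros n; exact (proj2_sig (constructive_indefinite_description _ (Hf n)))).
  assert (HB : forall rho : R, (0 <= rho)%R ->
     abs_bdd (prodP allP allP) (fun x => a (fst x) (snd x) * RtoC rho ^ snd x) (M rho)).
  { intros rho Hrho. apply (abs_bdd_tonelli_fst _ _ _ (fun n => Mn n rho)).
    - intros n _. simpl. now apply Ha.
    - intros T NT _. eapply Rle_trans; [|apply (HM rho (S (list_max T)) Hrho)].
      apply rsum_incl; auto; [apply seq_NoDup| |].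
      + intros i Hi. apply in_seq.
        pose proof (proj1 (list_max_le T (list_max T)) (le_n _)) as HFa.
        rewrite Forall_forall in HFa. specialize (HFa i Hi). lia.
      + intros i _. eapply abs_bdd_ge0. now apply Ha. }
  apply (entire_bd_gather (prodP allP allP) (fun x => a (fst x) (snd x)) snd); [exact HB|].
  intros s.
  assert (HB' : abs_bdd (prodP allP allP) (fun x => a (fst x) (snd x) * s ^ snd x) (M (Cmod s))).
  { refine (abs_bdd_mono _ _ _ _ _ (HB (Cmod s) (Cmod_ge_0 s))). intros [n k] _. simpl.
    rewrite !Cmod_mult, !Cmod_pow, Cmod_R, Rabs_pos_eq by apply Cmod_ge_0. lra. }
  destruct (abs_bdd_ex _ _ _ HB') as [l Hl]. replace (F s) with l; [easy|].
  apply (is_usum_unique allP (fun n => f n s)); [|apply HF].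
  refine (fubini_fst _ _ _ _ _ _ Hl). intros n _. simpl. apply Ha.
Qed.

Lemma entire_bd_le (f : C -> C) (M N : R -> R) :
  (forall rho, 0 <= rho -> M rho <= N rho)%R -> entire_bd f M -> entire_bd f N.
Proof.
  intros H [a [Ha Fa]]. exists a. split; [|easy]. intros rho Hrho S NS PS.
  eapply Rle_trans; [now apply Ha|auto].
Qed.

Lemma entire_bd_ext (f g : C -> C) (M : R -> R) :
  (forall s, f s = g s) -> entire_bd f M -> entire_bd g M.
Proof. intros H [a [Ha Fa]]. exists a. split; [easy|]. intros s. now rewrite <- H. Qed.

Lemma entire_bd_plus (f g : C -> C) (M N : R -> R) :
  entire_bd f M -> entire_bd g N -> entire_bd (fun s => f s + g s) (fun rho => M rho + N rho)%R.
Proof.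
  intros [a [Ha Fa]] [b [Hb Gb]]. exists (fun k => a k + b k). split.
  - intros rho Hrho.
    refine (abs_bdd_mono _ _ _ _ _ (abs_bdd_plus _ _ _ _ _ (Ha rho Hrho) (Hb rho Hrho))).
    intros k _. right. f_equal. ring.
  - intros s. refine (is_usum_ext _ _ _ _ _ (is_usum_plus _ _ _ _ _ (Fa s) (Gb s))).
    intros k _. ring.
Qed.

Lemma abs_bdd_single {I : Type} (P : I -> Prop) (f : I -> C) (i0 : I) :
  (forall i, P i -> i <> i0 -> f i = 0) -> abs_bdd P f (Cmod (f i0)).
Proof.
  intros H S NS PS. rewrite Forall_forall in PS.
  destruct (classic (In i0 S)) as [Hin|Hn].
  - destruct (split_incl (i0 :: nil) S) as [T [HT [_ [HTS HT']]]]; auto.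
    + repeat constructor; easy.
    + intros i [<-|[]]; auto.
    + rewrite (rsum_perm _ _ _ HT), rsum_app.
      assert (E : (rsum (mods f) T <= rsum (fun _ => 0) T)%R).
      { apply rsum_le. intros i Hi. unfold mods. rewrite H, Cmod_0; auto; [lra|].
        intros ->. apply (HT' i0 Hi). now left. }
      assert (E0 : (rsum (fun _ : I => 0) T = 0)%R).
      { clear. induction T as [|i T IH]; [easy|]. rewrite rsum_cons, IH. ring. }
      change (rsum (mods f) (i0 :: nil)) with (Cmod (f i0) + 0)%R. lra.
  - assert (E : (rsum (mods f) S <= rsum (fun _ => 0) S)%R).
    { apply rsum_le. intros i Hi. unfold mods. rewrite H, Cmod_0; auto; [lra|]. now intros ->. }
    assert (E0 : (rsum (fun _ : I => 0) S = 0)%R).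
    { clear. induction S as [|i T IH]; [easy|]. rewrite rsum_cons, IH. ring. }
    pose proof (Cmod_ge_0 (f i0)). lra.
Qed.

Lemma entire_bd_monomial (c : C) (n : nat) :
  entire_bd (fun s => c * s ^ n) (fun rho => Cmod c * rho ^ n)%R.
Proof.
  apply (entire_bd_gather (fun i : unit => True) (fun _ => c) (fun _ => n)).
  - intros rho Hrho. replace (Cmod c * rho ^ n)%R with (Cmod (c * RtoC rho ^ n)).
    + apply (abs_bdd_single _ (fun _ : unit => c * RtoC rho ^ n) tt). now intros [] _ [].
    + rewrite Cmod_mult, Cmod_pow, Cmod_R, Rabs_pos_eq; easy.
  - intros s.
    pose proof (is_usum_finite (fun _ => True) (fun _ : unit => c * s ^ n) (tt :: nil)) as H.
    replace (csum _ _) with (c * s ^ n) in H by (unfold csum; simpl; ring).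
    apply H; [repeat constructor; easy|now repeat constructor|].
    intros [] _ Hn. destruct Hn. now left.
Qed.

Lemma entire_bd_const (c : C) : entire_bd (fun _ => c) (fun _ => Cmod c).
Proof.
  apply (entire_bd_ext (fun s => c * s ^ 0)); [intros; simpl; ring|].
  apply (entire_bd_le _ (fun rho => Cmod c * rho ^ 0)%R); [intros; simpl; lra|].
  apply entire_bd_monomial.
Qed.

Lemma entire_bd_id : entire_bd (fun s => s) (fun rho => rho).
Proof.
  apply (entire_bd_ext (fun s => 1 * s ^ 1)); [intros; ring|].
  apply (entire_bd_le _ (fun rho => Cmod 1 * rho ^ 1)%R); [intros; rewrite Cmod_1; lra|].
  apply entire_bd_monomial.
Qed.

(** (s0 + h)^k has norm at most (|s0| + rho)^k, so expanding every term at [s0] costs no more than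
    the norm of [f] at radius |s0| + rho. Analyticity at every point follows from this. *)
Lemma entire_bd_translate (f : C -> C) (M : R -> R) (s0 : C) :
  entire_bd f M -> entire_bd (fun h => f (s0 + h)) (fun rho => M (Cmod s0 + rho))%R.
Proof.
  intros [a [Ha Fa]].
  assert (Hp : forall k, entire_bd (fun h => (s0 + h) ^ k) (fun rho => (Cmod s0 + rho) ^ k)%R).
  { induction k as [|k IH].
    - refine (entire_bd_le _ _ _ _ (entire_bd_const 1)). intros; simpl. rewrite Cmod_1. lra.
    - exact (entire_bd_mult _ _ _ _ (entire_bd_plus _ _ _ _ (entire_bd_const s0) entire_bd_id) IH). }
  apply (entire_bd_sum (fun k h => a k * (s0 + h) ^ k)
    (fun k rho => Cmod (a k) * (Cmod s0 + rho) ^ k)%R).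
  - intros k. exact (entire_bd_mult _ _ _ _ (entire_bd_const (a k)) (Hp k)).
  - intros rho m Hrho. pose proof (Cmod_ge_0 s0) as H0.
    eapply Rle_trans; [|exact (Ha (Cmod s0 + rho)%R ltac:(lra) (seq 0 m) (seq_NoDup _ _) (Forall_allP _))].
    apply rsum_le. intros k _. unfold mods. rewrite Cmod_mult, Cmod_pow, Cmod_R, Rabs_pos_eq by lra. lra.
  - intros h. apply Fa.
Qed.

(** The moduli are the terms of the real exponential series at rho |c|, and finite sums of these
    nonnegative terms cannot exceed its value. *)
Lemma expcoef_abs_bdd (c : C) (rho : R) : (0 <= rho)%R ->
  abs_bdd allP (fun k => expcoef c k * RtoC rho ^ k) (exp (rho * Cmod c)).
Proof.
  intros Hrho S NS PS.
  destruct (expcoef_usum (RtoC rho * RtoC (Cmod c))) as [_ HU].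
  apply Rnot_lt_le. intros Hlt.
  destruct (is_usum_elim _ _ _ HU (rsum (mods (fun k => (expcoef c k * RtoC rho ^ k)%C)) S
     - exp (rho * Cmod c))%R) as [S0 [_ [P0 K]]]; [lra|].
  specialize (K (lunion S S0) (lunion_NoDup _ _) (lunion_Forall _ _ _ PS P0) (lunion_r _ _)).
  assert (E : csum (expcoef (RtoC rho * RtoC (Cmod c))) (lunion S S0) =
     RtoC (rsum (mods (fun k => expcoef c k * RtoC rho ^ k)) (lunion S S0))).
  { rewrite <- csum_RtoC. apply csum_ext. intros k _. unfold mods.
    rewrite Cmod_mult, Cmod_pow, Cmod_R, Rabs_pos_eq, RtoC_mult, RtoC_pow, expcoef_Cmod by easy.
    now rewrite Cmult_comm, expcoef_mult. }
  assert (E2 : Cexp (RtoC rho * RtoC (Cmod c)) = RtoC (exp (rho * Cmod c))).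
  { rewrite <- RtoC_mult, Cexp_pair. simpl. rewrite cos_0, sin_0.
    apply injective_projections; simpl; ring. }
  rewrite E, E2, <- RtoC_minus, Cmod_R in K.
  assert (Hi : (rsum (mods (fun k => (expcoef c k * RtoC rho ^ k)%C)) S <=
    rsum (mods (fun k => (expcoef c k * RtoC rho ^ k)%C)) (lunion S S0))%R).
  { apply rsum_incl; auto; [apply lunion_NoDup|apply lunion_l|intros; apply mods_ge0]. }
  rewrite Rabs_pos_eq in K; lra.
Qed.

Lemma expcoef_usum_s (c s : C) : is_usum allP (fun k => expcoef c k * s ^ k) (Cexp (s * c)).
Proof.
  refine (is_usum_ext _ _ _ _ _ (proj2 (expcoef_usum (s * c)))).
  intros k _. now rewrite Cmult_comm, expcoef_mult.
Qed.

Lemma entire_bd_Cexp (c : C) : entire_bd (fun s => Cexp (s * c)) (fun rho => exp (rho * Cmod c)).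
Proof.
  exists (expcoef c). split.
  - intros rho Hrho. now apply expcoef_abs_bdd.
  - intros s. apply expcoef_usum_s.
Qed.

(** For k >= j the factor x^k is at most x^j, so x^j comes out of the norm of the remainder. The
    cases j = 1 and j = 2 are the first and second order estimates for small [x]. *)
Lemma entire_bd_Cexp_tail (l : C) (x : R) (j : nat) : (0 <= x <= 1)%R ->
  entire_bd (fun s => Cexp (s * (RtoC x * l)) - csum (fun k => expcoef (RtoC x * l) k * s ^ k) (seq 0 j))
    (fun rho => x ^ j * exp (rho * Cmod l))%R.
Proof.
  intros Hx. exists (fun k => if (k <? j)%nat then RtoC 0 else expcoef (RtoC x * l) k). split.
  - intros rho Hrho.
    replace (x ^ j)%R with (Cmod (RtoC (x ^ j))) by (rewrite Cmod_R; apply Rabs_pos_eq, pow_le; lra).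
    refine (abs_bdd_mono _ _ _ _ _ (abs_bdd_scal _ (RtoC (x ^ j)) _ _ (expcoef_abs_bdd l rho Hrho))).
    intros k _. destruct (Nat.ltb_spec k j) as [Hk|Hk].
    + rewrite Cmult_0_l, Cmod_0. apply Cmod_ge_0.
    + rewrite (Cmult_comm (RtoC x)), expcoef_mult, !Cmod_mult, !Cmod_pow, !Cmod_R.
      rewrite (Rabs_pos_eq x), (Rabs_pos_eq (x ^ j)), (Rabs_pos_eq rho) by (try apply pow_le; lra).
      replace k with (j + (k - j))%nat at 2 by lia. rewrite pow_add.
      assert (Hp : (x ^ (k - j) <= 1)%R).
      { rewrite <- (pow1 (k - j)). apply pow_incr. lra. }
      pose proof (pow_le x j (proj1 Hx)). pose proof (pow_le x (k - j) (proj1 Hx)).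
      assert (H1 : (0 <= Cmod (expcoef l k) * rho ^ k)%R)
        by (apply Rmult_le_pos; [apply Cmod_ge_0|now apply pow_le]).
      replace (Cmod (expcoef l k) * (x ^ j * x ^ (k - j)) * rho ^ k)%R
        with (x ^ j * (Cmod (expcoef l k) * rho ^ k) * x ^ (k - j))%R by ring.
      rewrite <- Rmult_1_r. apply Rmult_le_compat_l; [|easy]. now apply Rmult_le_pos.
  - intros s.
    set (g := fun k => if (k <? j)%nat then expcoef (RtoC x * l) k * s ^ k else RtoC 0).
    assert (Hg : is_usum allP g (csum (fun k => expcoef (RtoC x * l) k * s ^ k) (seq 0 j))).
    { rewrite (csum_ext _ g).
      - apply is_usum_finite; [apply seq_NoDup|apply Forall_allP|].
        intros k _ Hk. unfold g. destruct (Nat.ltb_spec k j); [|easy]. destruct Hk. apply in_seq. lia.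
      - intros k Hk. apply in_seq in Hk. unfold g. destruct (Nat.ltb_spec k j); [easy|lia]. }
    replace (_ - _) with (Cexp (s * (RtoC x * l))
      + - (1) * csum (fun k => expcoef (RtoC x * l) k * s ^ k) (seq 0 j)) by ring.
    refine (is_usum_ext _ _ _ _ _ (is_usum_plus _ _ _ _ _ (expcoef_usum_s (RtoC x * l) s)
      (is_usum_scal _ (- (1)) _ _ Hg))).
    intros k _. unfold g. destruct (Nat.ltb_spec k j); ring.
Qed.

(** * Powers *)

Lemma Cpower_RtoC (x : R) (s : C) : (0 < x)%R -> Cpower (RtoC x) s = Cexp (s * RtoC (ln x)).
Proof.
  intros Hx. unfold Cpower. do 2 f_equal. unfold Carg. rewrite Cmod_R, Rabs_pos_eq by lra.
  simpl. destruct (Rle_dec 0 0); [|lra]. replace (x / x)%R with 1%R by (field; lra).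
  now rewrite acos_1.
Qed.

(** This is arg w = pi / 2 + arg (-i w), where -i w has real part Im w > 0. With u = Re w / |w| it
    comes down to acos u = pi / 2 - asin u and asin u = atan (u / sqrt (1 - u^2)), the square root
    being Im w / |w|. *)
Lemma Carg_Im_pos (w : C) : (0 < Im w)%R -> Carg w = (PI / 2 + atan (- Re w / Im w))%R.
Proof.
  intros Him. unfold Carg. destruct (Rle_dec 0 (Im w)); [|lra].
  pose proof (Cmod2_alt w) as E.
  assert (Hm : (0 < Cmod w)%R).
  { apply Cmod_gt_0. intros E0. rewrite E0 in Him. simpl in Him. lra. }
  assert (Hlt : (Rabs (Re w) < Cmod w)%R).
  { apply Rabs_def1; nra. }
  assert (Hr : (-1 < Re w / Cmod w < 1)%R).
  { apply Rabs_def2 in Hlt. split.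
    - apply Rmult_lt_reg_r with (Cmod w); [easy|]. unfold Rdiv. rewrite Rmult_assoc, Rinv_l; lra.
    - apply Rmult_lt_reg_r with (Cmod w); [easy|]. unfold Rdiv. rewrite Rmult_assoc, Rinv_l; lra. }
  rewrite acos_asin, asin_atan by lra.
  unfold Rminus at 1. f_equal. rewrite <- atan_opp. f_equal.
  replace (1 - (Re w / Cmod w)²)%R with ((Im w / Cmod w)²)%R.
  - rewrite sqrt_Rsqr; [field; lra|]. apply Rdiv_le_0_compat; lra.
  - unfold Rsqr.
    replace (Im w / Cmod w * (Im w / Cmod w))%R with (Im w * Im w / (Cmod w * Cmod w))%R by (field; lra).
    replace (Im w * Im w)%R with (Cmod w * Cmod w - Re w * Re w)%R by (simpl in *; lra).
    field. lra.
Qed.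

Lemma Cpower_Im_pos (w s : C) : (0 < Im w)%R ->
  Cpower w s = Cexp (s * clog (- Ci * w)) * Cexp (RtoC PI / 2 * Ci * s).
Proof.
  intros H. unfold Cpower. rewrite <- Cexp_plus. f_equal.
  replace (ln (Cmod w), Carg w) with (clog (- Ci * w) + RtoC PI / 2 * Ci); [ring|].
  unfold clog. rewrite Cmod_mult, Cmod_opp, Cmod_Ci, Rmult_1_l, Carg_Im_pos by easy.
  apply injective_projections; simpl; [field|].
  replace (- 0 * snd w + - (1) * fst w)%R with (- Re w)%R by (unfold Re; ring).
  replace (- 0 * fst w - - (1) * snd w)%R with (Im w)%R by (unfold Im; ring). field.
Qed.

Lemma clog_scale (a : R) (w : C) : (0 < a)%R -> (0 < Re w)%R ->
  clog (RtoC a * w) = RtoC (ln a) + clog w.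
Proof.
  intros Ha Hw. pose proof (Re_le_Cmod w). unfold clog.
  rewrite Cmod_mult, Cmod_R, Rabs_pos_eq, ln_mult by lra.
  apply injective_projections; simpl; [easy|]. rewrite Rplus_0_l. f_equal.
  unfold Re, Im in *. field. nra.
Qed.

(** The modulus is |w|^(Re s) times e^{- Im s theta}, where theta is an arctangent and so at most pi
    / 2 <= 2 in absolute value. *)
Lemma Cmod_Cexp_clog (w s : C) :
  (Cmod (Cexp (s * clog w)) <= Rpower (Cmod w) (Re s) * exp (2 * Cmod s))%R.
Proof.
  rewrite Cmod_Cexp. unfold Rpower. rewrite <- exp_plus. apply exp_le.
  unfold clog; simpl. set (t := atan _).
  assert (Ht : (Rabs t <= 2)%R).
  { unfold t. pose proof (atan_bound (Im w / Re w)). pose proof PI_4. apply Rabs_le. lra. }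
  assert (Hs : (Rabs (Im s) <= Cmod s)%R).
  { eapply Rle_trans; [|apply Rmax_Cmod]. apply Rmax_r. }
  assert (Hp : (- (Im s * t) <= Cmod s * 2)%R).
  { eapply Rle_trans; [apply Rle_abs|]. rewrite Rabs_Ropp, Rabs_mult.
    apply Rmult_le_compat; auto using Rabs_pos. }
  unfold Re, Im in *. lra.
Qed.

(** * The reciprocal Gamma function *)

Lemma Cprod_app (l m : list C) : Cprod (l ++ m) = Cprod l * Cprod m.
Proof. induction l as [|a l IH]; simpl; [ring|]. rewrite IH. ring. Qed.

Lemma RtoC_fact_neq0 (n : nat) : RtoC (INR (fact n)) <> 0.
Proof. intros E. apply RtoC_inj in E. now apply (INR_fact_neq_0 n). Qed.

Lemma Cprod_shifted (s : C) (n : nat) :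
  Cprod (map (fun k => s + RtoC (INR k)) (seq 0 n)) = bincoef s n * RtoC (INR (fact n)).
Proof.
  induction n as [|n IH]; [simpl; ring|].
  rewrite seq_S, map_app, Cprod_app, IH. cbn [map Cprod fold_right bincoef].
  change (0 + n)%nat with n. rewrite fact_simpl, mult_INR, RtoC_mult.
  pose proof (INR_S_neq0 n). unfold Cprod; simpl fold_right. field. easy.
Qed.

(** (s)_{n+2} / (n+1)! is n + 2 times the binomial coefficient of order n + 2. Indices start at 1,
    where the logarithm of the index is genuine. *)
Lemma rGamma_approx_S (s : C) (n : nat) : rGamma_approx s (S n) =
  bincoef s (S (S n)) * RtoC (INR (S (S n))) * Cexp (- s * RtoC (ln (INR (S n)))).
Proof.
  unfold rGamma_approx. rewrite Cprod_shifted, Cpower_RtoC by apply INR_S_pos.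
  rewrite (fact_simpl (S n)), mult_INR, RtoC_mult.
  replace (- s * RtoC (ln (INR (S n)))) with (- (s * RtoC (ln (INR (S n))))) by ring.
  rewrite Cexp_opp. pose proof (RtoC_fact_neq0 (S n)). pose proof (Cexp_neq0 (s * RtoC (ln (INR (S n))))).
  field. easy.
Qed.

Definition gstep (n : nat) : R := (/ INR (S (S n)))%R.
Definition glog (n : nat) : R := ln (1 - gstep n).
(** [1 + gfac n s] is the quotient (1 + s / (n+2)) ((n+1) / (n+2))^s of two consecutive Gauss
    approximants, that is, one factor of the infinite product for 1 / Gamma. *)
Definition gfac (n : nat) (s : C) : C :=
  (1 + s * RtoC (gstep n)) * Cexp (s * RtoC (glog n)) - 1.

Lemma gstep_bounds (n : nat) : (0 < gstep n <= / 2)%R.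
Proof.
  unfold gstep. pose proof (INR_S_pos (S n)). split; [now apply Rinv_0_lt_compat|].
  apply Rinv_le_contravar; [lra|]. rewrite !S_INR. pose proof (pos_INR n). lra.
Qed.

Lemma rGamma_approx_SS (s : C) (n : nat) :
  rGamma_approx s (S (S n)) = rGamma_approx s (S n) * (1 + gfac n s).
Proof.
  rewrite !rGamma_approx_S. cbn [bincoef].
  assert (E : ln (INR (S (S n))) = (ln (INR (S n)) - glog n)%R).
  { unfold glog, gstep. pose proof (INR_S_pos n). pose proof (INR_S_pos (S n)).
    replace (1 - / INR (S (S n)))%R with (INR (S n) / INR (S (S n)))%R.
    - rewrite ln_div by easy. ring.
    - rewrite (S_INR (S n)) in *. field. lra. }
  rewrite E, RtoC_minus.
  replace (- s * (RtoC (ln (INR (S n))) - RtoC (glog n)))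
    with (- s * RtoC (ln (INR (S n))) + s * RtoC (glog n)) by ring.
  rewrite Cexp_plus. unfold gfac.
  pose proof (INR_S_neq0 n) as H1. pose proof (INR_S_neq0 (S n)) as H2. pose proof (INR_S_neq0 (S (S n))) as H3.
  unfold gstep. rewrite RtoC_inv by (intros E0; apply H2; now rewrite E0).
  set (e := Cexp _). set (e' := Cexp _). clearbody e e'. field. easy.
Qed.

Definition gbound (rho : R) : R := (exp (2 * rho) * (1 + rho) + 2 * rho)%R.

Lemma gbound_ge0 (rho : R) : (0 <= rho -> 0 <= gbound rho)%R.
Proof. intros H. unfold gbound. pose proof (exp_pos (2 * rho)). nra. Qed.

(** With x = [gstep n] and L = ln (1 - x), [gfac] is (e^{sL} - 1 - sL) + s x (e^{sL} - 1) + s (L +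
    x). All three parts are O(x^2), since |L| <= 2x and |L + x| <= 2x^2 for x <= 1/2; hence the
    product converges. *)
Lemma entire_bd_gfac (n : nat) :
  entire_bd (gfac n) (fun rho => (gstep n) ^ 2 * gbound rho)%R.
Proof.
  pose proof (gstep_bounds n) as Hx. set (x := gstep n) in *.
  assert (HL : (- (2 * x) <= glog n <= - x /\ - (2 * x ^ 2) <= glog n + x)%R).
  { unfold glog. fold x. pose proof (ln_le_sub1 (1 - x) ltac:(lra)).
    pose proof (ln_ge_inv (1 - x) ltac:(lra)) as Hl.
    assert (Hi : (/ (1 - x) <= 1 + x + 2 * x ^ 2)%R).
    { apply (Rmult_le_reg_l (1 - x)); [lra|]. rewrite Rinv_r by lra. nra. }
    split; [|lra]. split; [|lra]. nra. }
  (* L is written as x l with |l| <= 2, the form in which the tail estimate extracts powers of x. *)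
  set (L := glog n) in *. set (l := RtoC (L / x)).
  assert (El : RtoC x * l = RtoC L).
  { unfold l. rewrite <- RtoC_mult. f_equal. field. lra. }
  assert (Hl : (Cmod l <= 2)%R).
  { unfold l. rewrite Cmod_R, Rabs_left1.
    - apply (Rmult_le_reg_r x); [lra|]. replace (- (L / x) * x)%R with (- L)%R by (field; lra). lra.
    - apply (Rmult_le_reg_r x); [lra|]. replace (L / x * x)%R with L by (field; lra). lra. }
  assert (H2 := entire_bd_Cexp_tail l x 2 ltac:(lra)).
  assert (H1 := entire_bd_Cexp_tail l x 1 ltac:(lra)).
  pose proof (entire_bd_plus _ _ _ _ (entire_bd_plus _ _ _ _ H2
     (entire_bd_mult _ _ _ _ (entire_bd_monomial (RtoC x) 1) H1))
     (entire_bd_monomial (RtoC (L + x)) 1)) as H. cbv beta in H.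
  refine (entire_bd_ext _ _ _ _ (entire_bd_le _ _ _ _ H)).
  - intros s. rewrite El. unfold csum. cbn [seq map Csum fold_right expcoef].
    unfold gfac. fold x L. rewrite RtoC_plus. simpl INR. field.
  - intros rho Hrho. cbv beta. rewrite !Cmod_R, (Rabs_pos_eq x), Rabs_left1 by nra.
    assert (He : (exp (rho * Cmod l) <= exp (2 * rho))%R) by (apply exp_le; nra).
    pose proof (exp_pos (rho * Cmod l)). unfold gbound.
    set (a := exp (rho * Cmod l)) in *. set (b := exp (2 * rho)) in *.
    assert (x ^ 2 * a <= x ^ 2 * b)%R by (apply Rmult_le_compat_l; nra).
    assert (x * rho ^ 1 * (x ^ 1 * a) <= x ^ 2 * b * rho)%R.
    { replace (x * rho ^ 1 * (x ^ 1 * a))%R with (x ^ 2 * a * rho)%R by ring.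
      apply Rmult_le_compat_r; lra. }
    assert (- (L + x) * rho ^ 1 <= 2 * x ^ 2 * rho)%R.
    { rewrite pow_1. apply Rmult_le_compat_r; lra. }
    lra.
Qed.

Lemma entire_bd_Cmod (f : C -> C) (M : R -> R) (s : C) :
  entire_bd f M -> (Cmod (f s) <= M (Cmod s))%R.
Proof.
  intros [a [Ha Fa]]. exact (is_usum_Cmod_le _ _ _ _ (entire_bd_abs a M Ha s) (Fa s)).
Qed.

(** Telescoping, by 1 / (k+2)^2 <= 1 / (k+1) - 1 / (k+2). *)
Lemma gstep_sq_sum (n : nat) : (rsum (fun k => gstep k ^ 2) (seq 0 n) <= 1 - / INR (S n))%R.
Proof.
  induction n as [|n IH]; [unfold rsum; simpl; lra|].
  rewrite seq_S, rsum_app. change (0 + n)%nat with n. rewrite rsum_cons. unfold rsum at 2.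
  simpl fold_right. unfold gstep at 2.
  pose proof (INR_S_pos n) as Hn. rewrite (S_INR (S n)). set (a := INR (S n)) in *.
  assert ((/ (a + 1)) ^ 2 <= / a - / (a + 1))%R; [|lra].
  replace (/ a - / (a + 1))%R with (/ a * / (a + 1))%R by (field; lra).
  simpl. rewrite Rmult_1_r. apply Rmult_le_compat_r; [apply Rlt_le, Rinv_0_lt_compat; lra|].
  apply Rinv_le_contravar; lra.
Qed.

(** rho (rho + 1) bounds the norm of s (s + 1), the approximant of index 1. The exponential bounds
    the product of the factors [1 + gstep k ^ 2 * gbound rho], as the squares sum to at most 1. *)
Definition gnorm (rho : R) : R := (rho * (rho + 1) * exp (gbound rho))%R.

Lemma entire_bd_approx (n : nat) :
  entire_bd (fun s => rGamma_approx s (S n)) gnorm.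
Proof.
  assert (H : entire_bd (fun s => rGamma_approx s (S n))
    (fun rho => rho * (rho + 1) * exp (gbound rho * rsum (fun k => gstep k ^ 2) (seq 0 n)))%R).
  { induction n as [|n IH].
    - refine (entire_bd_ext _ _ _ _ (entire_bd_le _ _ _ _
        (entire_bd_mult _ _ _ _ entire_bd_id (entire_bd_plus _ _ _ _ entire_bd_id (entire_bd_const 1))))).
      + intros s. rewrite rGamma_approx_S. cbn [bincoef]. simpl INR. rewrite ln_1, Cmult_0_r, Cexp_0.
        rewrite RtoC_plus. field.
      + intros rho Hrho. unfold rsum. simpl. rewrite Rmult_0_r, exp_0, Cmod_1. lra.
    - refine (entire_bd_ext _ _ _ _ (entire_bd_le _ _ _ _
        (entire_bd_mult _ _ _ _ IH (entire_bd_plus _ _ _ _ (entire_bd_const 1) (entire_bd_gfac n))))).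
      + intros s. now rewrite rGamma_approx_SS.
      + intros rho Hrho. rewrite Cmod_1, seq_S, rsum_app. change (0 + n)%nat with n.
        rewrite rsum_cons. unfold rsum at 3. simpl fold_right.
        set (T := rsum (fun k => gstep k ^ 2)%R (seq 0 n)).
        replace (gbound rho * (T + (gstep n ^ 2 + 0)))%R
          with (gbound rho * T + gstep n ^ 2 * gbound rho)%R by ring.
        rewrite exp_plus, <- Rmult_assoc.
        apply Rmult_le_compat_l; [|apply exp_ineq1_le].
        pose proof (exp_pos (gbound rho * T)). apply Rmult_le_pos; nra. }
  refine (entire_bd_le _ _ _ _ H). intros rho Hrho. unfold gnorm.
  apply Rmult_le_compat_l; [nra|]. apply exp_le. rewrite <- (Rmult_1_r (gbound rho)) at 2.
  apply Rmult_le_compat_l; [now apply gbound_ge0|].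
  eapply Rle_trans; [apply gstep_sq_sum|]. pose proof (Rinv_0_lt_compat _ (INR_S_pos n)). lra.
Qed.

(** The approximants are the partial sums of a telescoping series with terms
    [rGamma_approx s (S m) * gfac m s], whose norms are summable. So the limit exists for every [s],
    the [epsilon] in [rGamma] selects it, and it is entire. *)
Lemma rGamma_entire : (exists M, entire_bd rGamma M) /\ forall s, tends (rGamma_approx s) (rGamma s).
Proof.
  set (d := fun n s => match n with O => rGamma_approx s 1
    | S m => rGamma_approx s (S m) * gfac m s end).
  set (Md := fun n rho => match n with O => gnorm rho
    | S m => (gnorm rho * (gstep m ^ 2 * gbound rho))%R end).
  set (M := fun rho => (gnorm rho * (1 + gbound rho))%R).
  assert (Hd : forall n, entire_bd (d n) (Md n)).
  { intros [|n]; [apply (entire_bd_approx 0)|].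
    exact (entire_bd_mult _ _ _ _ (entire_bd_approx n) (entire_bd_gfac n)). }
  assert (Hg : forall rho, (0 <= rho -> 0 <= gnorm rho)%R).
  { intros rho Hrho. unfold gnorm. pose proof (exp_pos (gbound rho)).
    apply Rmult_le_pos; nra. }
  assert (HM : forall rho m, (0 <= rho)%R -> (rsum (fun n => Md n rho) (seq 0 m) <= M rho)%R).
  { intros rho m Hrho. pose proof (gbound_ge0 rho Hrho). specialize (Hg rho Hrho). unfold M.
    destruct m as [|m]; [unfold rsum; simpl; nra|].
    simpl seq. rewrite rsum_cons, <- seq_shift.
    replace (rsum (fun n => Md n rho) (map S (seq 0 m)))
      with (gnorm rho * gbound rho * rsum (fun k => gstep k ^ 2) (seq 0 m))%R.
    2:{ rewrite <- rsum_scal. unfold rsum. rewrite map_map. f_equal. apply map_ext.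
        intros k. simpl. ring. }
    pose proof (gstep_sq_sum m). pose proof (Rinv_0_lt_compat _ (INR_S_pos m)).
    unfold Md. assert (0 <= gnorm rho * gbound rho)%R by now apply Rmult_le_pos. nra. }
  assert (Hex : forall s, exists l, is_usum allP (fun n => d n s) l).
  { intros s. apply (abs_bdd_ex _ _ (M (Cmod s))). apply abs_bdd_nat. intros m.
    eapply Rle_trans; [|exact (HM (Cmod s) m (Cmod_ge_0 s))].
    apply rsum_le. intros n _. now apply entire_bd_Cmod. }
  pose (F := fun s => proj1_sig (constructive_indefinite_description _ (Hex s))).
  assert (HF : forall s, is_usum allP (fun n => d n s) (F s))
    by (intros s; exact (proj2_sig (constructive_indefinite_description _ (Hex s)))).
  assert (HT : forall s, tends (rGamma_approx s) (F s)).
  { intros s eps He. destruct (is_usum_tends _ _ (HF s) eps He) as [N0 K].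
    exists (S N0). intros [|N] HN; [lia|]. specialize (K N ltac:(lia)). cbv beta in K.
    replace (csum (fun n => d n s) (seq 0 (S N))) with (rGamma_approx s (S N)) in K; [easy|].
    clear. induction N as [|N IH].
    - unfold csum. simpl. ring.
    - rewrite seq_S, csum_app, <- IH, rGamma_approx_SS. unfold csum. simpl. ring. }
  assert (HE : forall s, rGamma s = F s).
  { intros s. apply (tends_unique (rGamma_approx s)); [|apply HT].
    apply tends_filterlim. unfold rGamma. apply epsilon_spec. exists (F s). now apply tends_filterlim. }
  split.
  - exists M. apply (entire_bd_ext F); [intros; now rewrite HE|].
    exact (entire_bd_sum d Md F M Hd HM HF).
  - intros s. now rewrite HE.
Qed.

(** * Limits through exponential and logarithm *)

Lemma tends_is_lim_seq (u : nat -> C) (l : C) :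
  tends u l <-> is_lim_seq (fun n => fst (u n)) (fst l) /\ is_lim_seq (fun n => snd (u n)) (snd l).
Proof.
  split.
  - intros H. split; apply is_lim_seq_spec; intros eps;
      destruct (H eps (cond_pos eps)) as [N0 K]; exists N0; intros n Hn; specialize (K n Hn);
      (eapply Rle_lt_trans; [|exact K]); pose proof (Rmax_Cmod (u n - l)) as Hm;
      (eapply Rle_trans; [|exact Hm]); [apply Rmax_l|apply Rmax_r].
  - intros [H1 H2] eps He. apply is_lim_seq_spec in H1. apply is_lim_seq_spec in H2.
    assert (He2 : (0 < eps / 2)%R) by lra.
    destruct (H1 (mkposreal _ He2)) as [N1 K1]. destruct (H2 (mkposreal _ He2)) as [N2 K2].
    exists (max N1 N2). intros n Hn. specialize (K1 n ltac:(lia)). specialize (K2 n ltac:(lia)).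
    simpl in K1, K2.
    replace (u n - l) with (RtoC (fst (u n) - fst l) + Ci * RtoC (snd (u n) - snd l))
      by (apply injective_projections; simpl; ring).
    eapply Rle_lt_trans; [apply Cmod_triangle|]. rewrite Cmod_mult, Cmod_Ci, !Cmod_R. lra.
Qed.

Lemma tends_Cexp (u : nat -> C) (l : C) : tends u l -> tends (fun n => Cexp (u n)) (Cexp l).
Proof.
  intros H. apply tends_is_lim_seq in H. destruct H as [H1 H2].
  pose proof (is_lim_seq_continuous exp _ _ (derivable_continuous_pt _ _ (derivable_pt_exp _)) H1) as E.
  pose proof (is_lim_seq_continuous cos _ _ (continuity_cos _) H2) as Ec.
  pose proof (is_lim_seq_continuous sin _ _ (continuity_sin _) H2) as Es.
  apply tends_is_lim_seq. rewrite Cexp_pair. split; cbn [fst snd].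
  - apply (is_lim_seq_ext (fun n => exp (fst (u n)) * cos (snd (u n)))%R).
    + intros n. now rewrite Cexp_pair.
    + now apply is_lim_seq_mult'.
  - apply (is_lim_seq_ext (fun n => exp (fst (u n)) * sin (snd (u n)))%R).
    + intros n. now rewrite Cexp_pair.
    + now apply is_lim_seq_mult'.
Qed.

Lemma tends_clog (u : nat -> C) (l : C) : (0 < Re l)%R -> tends u l ->
  tends (fun n => clog (u n)) (clog l).
Proof.
  intros Hl H. apply tends_is_lim_seq. apply tends_is_lim_seq in H as H'. destruct H' as [H1 H2].
  unfold clog. simpl. split.
  - assert (Hm : (0 < Cmod l)%R) by (pose proof (Re_le_Cmod l); lra).
    apply is_lim_seq_continuous; [apply derivable_continuous_pt; exists (/ Cmod l)%R; now apply derivable_pt_lim_ln|].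
    apply is_lim_seq_spec. intros eps. destruct (H eps (cond_pos eps)) as [N0 K].
    exists N0. intros n Hn. specialize (K n Hn). eapply Rle_lt_trans; [|exact K].
    apply Rabs_le. split.
    + pose proof (Cmod_triangle (u n) (- (u n - l))) as Ht. rewrite Cmod_opp in Ht.
      replace (u n + - (u n - l)) with l in Ht by ring. lra.
    + pose proof (Cmod_triangle l (u n - l)) as Ht.
      replace (l + (u n - l)) with (u n) in Ht by ring. lra.
  - apply is_lim_seq_continuous; [apply derivable_continuous_pt, derivable_pt_atan|].
    apply is_lim_seq_div'; [easy|easy|]. unfold Re in *. lra.
Qed.

Lemma Cexp_second_order (c : C) (x : R) : (0 <= x <= 1)%R ->
  (Cmod (Cexp (RtoC x * c) - 1 - RtoC x * c) <= x ^ 2 * exp (Cmod c))%R.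
Proof.
  intros Hx. pose proof (entire_bd_Cmod _ _ 1 (entire_bd_Cexp_tail c x 2 Hx)) as H.
  cbv beta in H. rewrite Cmod_1, !Rmult_1_l in H. rewrite Cmult_1_l in H.
  replace (Cexp (RtoC x * c) - 1 - RtoC x * c) with
    (Cexp (RtoC x * c) - csum (fun k : nat => expcoef (RtoC x * c) k * 1 ^ k) (seq 0 2)); [easy|].
  unfold csum. cbn [seq map Csum fold_right expcoef]. simpl INR. field.
Qed.

Lemma inv_INR_small (A eps : R) : (0 <= A)%R -> (0 < eps)%R ->
  exists N0, (0 < N0)%nat /\ forall N, (N0 <= N)%nat -> (A * / INR N < eps)%R.
Proof.
  intros HA He. destruct (archimed_cor1 (eps / (A + 1))) as [N0 [H0 H1]].
  { apply Rdiv_lt_0_compat; lra. }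
  exists N0. split; [easy|]. intros N HN.
  assert (0 < INR N0)%R by now apply lt_0_INR.
  assert (Hi : (/ INR N <= / INR N0)%R) by (apply Rinv_le_contravar; [easy|now apply le_INR]).
  assert (0 < / INR N)%R by (apply Rinv_0_lt_compat, lt_0_INR; lia).
  apply Rle_lt_trans with ((A + 1) * / INR N)%R; [nra|].
  apply Rle_lt_trans with ((A + 1) * / INR N0)%R; [apply Rmult_le_compat_l; lra|].
  apply (Rmult_lt_compat_l (A + 1)) in H0; [|lra].
  replace ((A + 1) * (eps / (A + 1)))%R with eps in H0 by (field; lra). easy.
Qed.

(** The second order estimate at x = 1 / N leaves an error of at most e^{|c|} / N. *)
Lemma tends_scaled_exp (c : C) :
  tends (fun N => RtoC (INR N) * (1 - Cexp (c / RtoC (INR N)))) (- c).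
Proof.
  intros eps He. destruct (inv_INR_small (exp (Cmod c)) eps) as [N0 [H0 K]]; [apply Rlt_le, exp_pos|easy|].
  exists N0. intros N HN. specialize (K N HN).
  assert (HN0 : (0 < INR N)%R) by (apply lt_0_INR; lia).
  assert (HN1 : RtoC (INR N) <> 0) by (intros E; apply RtoC_inj in E; lra).
  assert (Hx : (0 <= / INR N <= 1)%R).
  { split; [apply Rlt_le, Rinv_0_lt_compat; easy|]. rewrite <- Rinv_1. apply Rinv_le_contravar; [lra|].
    replace 1%R with (INR 1) by easy. apply le_INR. lia. }
  replace (c / RtoC (INR N)) with (RtoC (/ INR N) * c) by (rewrite RtoC_inv by lra; field; easy).
  pose proof (Cexp_second_order c _ Hx) as H. set (e := Cexp _) in *.
  replace (RtoC (INR N) * (1 - e) - - c) with (- (RtoC (INR N) * (e - 1 - RtoC (/ INR N) * c)))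
    by (rewrite RtoC_inv by lra; field; easy).
  rewrite Cmod_opp, Cmod_mult, Cmod_R, Rabs_pos_eq by lra.
  apply Rle_lt_trans with (INR N * ((/ INR N) ^ 2 * exp (Cmod c)))%R.
  - apply Rmult_le_compat_l; lra.
  - replace (INR N * ((/ INR N) ^ 2 * exp (Cmod c)))%R with (exp (Cmod c) * / INR N)%R by (field; lra). easy.
Qed.

(** * Uniform lower bounds for N |1 - e^{2 pi i w / N}| *)

Lemma sin_lower_bound : exists c, (0 < c)%R /\
  forall u, (Rabs u <= 3 * (PI / 4))%R -> (c * Rabs u <= Rabs (sin u))%R.
Proof.
  (* In sin u = 2 sin (u/2) cos (u/2) the cosine is at least cos (3 pi / 8) > 0, and sin (u/2) >=
     u/4 by the cubic Taylor bound, valid as u/2 <= 3/2 because pi <= 4. *)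
  assert (Hc : (0 < cos (3 * (PI / 8)))%R) by (pose proof PI_RGT_0; apply cos_gt_0; lra).
  set (c0 := cos (3 * (PI / 8))) in *. exists (c0 / 2)%R. split; [lra|].
  assert (K : forall u, (0 <= u <= 3 * (PI / 4))%R -> (c0 / 2 * u <= sin u)%R).
  { intros u Hu. pose proof PI_4. pose proof PI_RGT_0.
    assert (Hs : (u / 4 <= sin (u / 2))%R).
    { pose proof (proj1 (pre_sin_bound (u / 2) 0 ltac:(lra) ltac:(lra))) as Hlb.
      unfold sin_approx, sin_term in Hlb. simpl in Hlb.
      set (v := (u / 2)%R) in *. assert (Hv : (0 <= v <= 3 / 2)%R) by (unfold v; lra).
      replace (u / 4)%R with (v / 2)%R by (unfold v; field).
      assert (0 <= v * (9 / 4 - v * v))%R by (apply Rmult_le_pos; nra). nra. }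
    assert (Hcu : (c0 <= cos (u / 2))%R) by (apply cos_decr_1; lra).
    replace u with (2 * (u / 2))%R at 2 by field. rewrite sin_2a. nra. }
  intros u Hu. destruct (Rle_dec 0 u).
  - rewrite Rabs_pos_eq in * by easy. eapply Rle_trans; [apply K; lra|apply Rle_abs].
  - rewrite Rabs_left in * by lra. rewrite <- Rabs_Ropp, <- sin_neg.
    eapply Rle_trans; [apply K; lra|apply Rle_abs].
Qed.

(** The distance from r e^{i theta} to 1 splits into a radial and an angular part; for r >= 0 each
    of them bounds it from below on its own. *)
Lemma Cmod_sq_1_minus (r th : R) : (Cmod (1 - (r * cos th, r * sin th)%R) ^ 2 =
  (1 - r) ^ 2 + 4 * r * sin (th / 2) ^ 2)%R.
Proof.
  rewrite Cmod2_alt. simpl Re. simpl Im.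
  assert (Hc : (cos th = 1 - 2 * sin (th / 2) ^ 2)%R).
  { replace th with (2 * (th / 2))%R at 1 by field. rewrite cos_2a_sin. ring. }
  pose proof (sin2_cos2 th) as Hsc. unfold Rsqr in Hsc.
  replace (sin (th / 2) ^ 2)%R with ((1 - cos th) / 2)%R by lra. nra.
Qed.

Lemma one_minus_exp_lower (v : R) : (0 <= v -> v * exp (- v) <= 1 - exp (- v))%R.
Proof.
  intros Hv. pose proof (exp_ineq1_le v). pose proof (exp_pos (- v)).
  assert (E : (exp v * exp (- v) = 1)%R) by (rewrite <- exp_plus, Rplus_opp_r; apply exp_0).
  nra.
Qed.

Definition tpi : C := 2 * RtoC PI * Ci.

(* With N = 2M the points (tau + j) / N, -M <= j < M, stay away from the nonzero integers. *)
Lemma scaled_lower_bound (y : R) : (0 < y)%R -> exists c, (0 < c)%R /\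
  forall (M : nat) (x : R), (1 <= M)%nat -> (Rabs x <= 3 / 2 * INR M)%R ->
   (c * (1 + Rabs x) <= Cmod (RtoC (INR (2 * M)) * (1 - Cexp (tpi * (x, y) / RtoC (INR (2 * M))))))%R.
Proof.
  intros Hy. destruct sin_lower_bound as [c0 [Hc0 Hsin]]. pose proof PI_RGT_0 as Hpi.
  set (a := (2 * PI * y * exp (- (2 * PI * y)))%R).
  set (b := (2 * c0 * PI * exp (- (2 * PI * y)))%R).
  pose proof (exp_pos (- (2 * PI * y))) as He.
  assert (Hpy : (0 < PI * y)%R) by now apply Rmult_lt_0_compat.
  assert (Hpc : (0 < c0 * PI)%R) by now apply Rmult_lt_0_compat.
  assert (Ha : (0 < a)%R) by (unfold a; nra).
  assert (Hb : (0 < b)%R) by (unfold b; nra).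
  (* The radial part gives the constant bound [a], the angular part the bound [b * Rabs x]; the
     halves allow the two to be added. *)
  exists (Rmin (a / 2) (b / 2)). split; [apply Rmin_case; lra|].
  intros M x HM Hx.
  assert (HM1 : (1 <= INR M)%R) by (replace 1%R with (INR 1) by easy; now apply le_INR).
  set (N := INR (2 * M)).
  assert (EN : N = (2 * INR M)%R) by (unfold N; now rewrite mult_INR).
  set (v := (2 * PI * y / N)%R). set (th := (2 * PI * x / N)%R).
  assert (Hv : (0 <= v <= 2 * PI * y)%R).
  { unfold v. split; [apply Rdiv_le_0_compat; lra|].
    apply Rmult_le_reg_r with N; [lra|]. unfold Rdiv. rewrite Rmult_assoc, Rinv_l by lra. nra. }
  replace (Cexp (tpi * (x, y) / RtoC N)) with ((exp (- v) * cos th, exp (- v) * sin th)%R : C).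
  2:{ replace (tpi * (x, y) / RtoC N) with ((- v, th)%R : C); [now rewrite Cexp_pair|].
      unfold tpi, Cdiv. rewrite <- RtoC_inv by lra.
      apply injective_projections; simpl; unfold v, th; field; lra. }
  rewrite Cmod_mult, Cmod_R, (Rabs_pos_eq N) by lra.
  pose proof (Cmod_sq_1_minus (exp (- v)) th) as Hsq.
  set (m := Cmod (1 - _)) in *. assert (Hm : (0 <= m)%R) by apply Cmod_ge_0.
  pose proof (exp_pos (- v)) as Hev. pose proof (pow2_ge_0 (sin (th / 2))) as Hs2.
  assert (Hevle : (exp (- (2 * PI * y)) <= exp (- v))%R) by (apply exp_le; lra).
  assert (Hev1 : (exp (- v) <= 1)%R) by (rewrite <- exp_0; apply exp_le; lra).
  assert (H1 : (a <= N * m)%R).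
  { pose proof (one_minus_exp_lower v (proj1 Hv)) as Hv1.
    assert (Hm1 : (1 - exp (- v) <= m)%R) by (apply Rsqr_incr_0_var; [unfold Rsqr; nra|easy]).
    apply Rle_trans with (N * (v * exp (- v)))%R; [|apply Rmult_le_compat_l; lra].
    replace (N * (v * exp (- v)))%R with (2 * PI * y * exp (- v))%R by (unfold v; field; lra).
    unfold a. apply Rmult_le_compat_l; lra. }
  assert (H2 : (b * Rabs x <= N * m)%R).
  { assert (Hth : (Rabs (th / 2) = PI * Rabs x / N)%R).
    { unfold th. replace (2 * PI * x / N / 2)%R with (PI * x / N)%R by (field; lra).
      unfold Rdiv. rewrite !Rabs_mult, (Rabs_pos_eq PI), (Rabs_pos_eq (/ N)); try lra.
      apply Rlt_le, Rinv_0_lt_compat; lra. }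
    (* |x| <= 3M / 2 and N = 2M give a half-angle of at most 3 pi / 4. *)
    assert (Hs : (c0 * (PI * Rabs x / N) <= Rabs (sin (th / 2)))%R).
    { rewrite <- Hth. apply Hsin. rewrite Hth.
      apply Rmult_le_reg_r with N; [lra|]. unfold Rdiv at 1. rewrite Rmult_assoc, Rinv_l by lra.
      rewrite EN. nra. }
    (* With r = e^{-v} <= 1, the angular part 4 r sin^2 is at least (2 r |sin|)^2. *)
    assert (Hm2 : (2 * exp (- v) * Rabs (sin (th / 2)) <= m)%R).
    { apply Rsqr_incr_0_var; [|easy]. unfold Rsqr.
      replace (sin (th / 2) ^ 2)%R with (Rabs (sin (th / 2)) * Rabs (sin (th / 2)))%R in Hsq
        by (rewrite <- Rabs_mult, Rabs_pos_eq; [ring|nra]).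
      set (S := Rabs (sin (th / 2))) in *.
      assert (0 <= S * S)%R by nra.
      assert (exp (- v) * exp (- v) * (S * S) <= exp (- v) * (S * S))%R by nra. nra. }
    apply Rle_trans with (N * (2 * exp (- v) * Rabs (sin (th / 2))))%R; [|apply Rmult_le_compat_l; lra].
    apply Rle_trans with (N * (2 * exp (- v) * (c0 * (PI * Rabs x / N))))%R.
    - replace (N * (2 * exp (- v) * (c0 * (PI * Rabs x / N))))%R
        with (2 * c0 * PI * Rabs x * exp (- v))%R by (field; lra).
      unfold b. pose proof (Rabs_pos x).
      replace (2 * c0 * PI * exp (- (2 * PI * y)) * Rabs x)%R with
        (2 * c0 * PI * Rabs x * exp (- (2 * PI * y)))%R by ring.
      apply Rmult_le_compat_l; [nra|easy].
    - apply Rmult_le_compat_l; [lra|]. apply Rmult_le_compat_l; [lra|easy]. }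
  pose proof (Rmin_l (a / 2) (b / 2)). pose proof (Rmin_r (a / 2) (b / 2)).
  set (c := Rmin (a / 2) (b / 2)) in *. pose proof (Rabs_pos x).
  assert (c * Rabs x <= b / 2 * Rabs x)%R by (apply Rmult_le_compat_r; lra). lra.
Qed.

(** * Averaging over roots of unity *)

Lemma is_usum_csum {I J : Type} (P : I -> Prop) (f : J -> I -> C) (l : J -> C) (S : list J) :
  (forall j, In j S -> is_usum P (f j) (l j)) ->
  is_usum P (fun i => csum (fun j => f j i) S) (csum l S).
Proof.
  induction S as [|j S IH]; intros H.
  - exact (is_usum_finite P (fun i => csum (fun j => f j i) nil) nil (NoDup_nil _)
      (Forall_nil _) (fun _ _ _ => eq_refl)).
  - rewrite csum_cons. apply (is_usum_ext _ (fun i => f j i + csum (fun j => f j i) S)); [easy|].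
    apply is_usum_plus; [apply H; now left|]. apply IH. intros; apply H; now right.
Qed.

Lemma geom_csum (x : C) (n : nat) : (x - 1) * csum (fun i => x ^ i) (seq 0 n) = x ^ n - 1.
Proof.
  induction n as [|n IH]; [unfold csum; simpl; ring|].
  rewrite seq_S, csum_app, Cmult_plus_distr_l, IH. change (0 + n)%nat with n.
  unfold csum. simpl. ring.
Qed.

Lemma Cexp_tpi_nat (k : nat) : Cexp (RtoC (INR k) * tpi) = 1.
Proof. rewrite Cexp_mult_nat. unfold tpi. rewrite Cexp_2PI. apply Cpow_1_l. Qed.

Lemma INR_neq0 (N : nat) : (0 < N)%nat -> RtoC (INR N) <> 0.
Proof. destruct N; [lia|]. intros _. apply INR_S_neq0. Qed.

(** Reducing [m] modulo [N] leaves e^{2 i u} with 0 < u < pi, whose real part 1 - 2 sin^2 u is less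
    than 1. *)
Lemma root_of_unity_neq1 (N m : nat) : (0 < N)%nat -> (forall k, m <> N * k)%nat ->
  Cexp (RtoC (INR m) * tpi / RtoC (INR N)) <> 1.
Proof.
  intros HN Hm E. set (r := (m mod N)%nat). set (d := (m / N)%nat).
  assert (Em : (m = N * d + r)%nat) by (apply Nat.div_mod; lia).
  assert (Hr : (0 < r < N)%nat).
  { split; [|apply Nat.mod_upper_bound; lia]. destruct (Nat.eq_dec r 0); [|lia]. exfalso. apply (Hm d). lia. }
  pose proof (INR_neq0 N HN) as HN0.
  assert (HNR : (0 < INR N)%R) by now apply lt_0_INR.
  replace (RtoC (INR m) * tpi / RtoC (INR N)) with
    (RtoC (INR d) * tpi + RtoC (2 * (PI * INR r / INR N)) * Ci) in E.
  2:{ rewrite Em, plus_INR, mult_INR, RtoC_plus, !RtoC_mult, RtoC_div by lra.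
      rewrite RtoC_mult. unfold tpi. field. easy. }
  rewrite Cexp_plus, Cexp_tpi_nat, Cmult_1_l, Cexp_pair in E.
  apply (f_equal fst) in E.
  set (u := (PI * INR r / INR N)%R) in *.
  cbn [fst] in E.
  replace (fst (RtoC (2 * u) * Ci)) with 0%R in E by (simpl; ring).
  replace (snd (RtoC (2 * u) * Ci)) with (2 * u)%R in E by (simpl; ring).
  rewrite exp_0, cos_2a_sin in E. simpl in E.
  assert (Hs : (0 < sin u)%R).
  { pose proof PI_RGT_0. assert (0 < INR r)%R by (apply lt_0_INR; lia).
    assert (INR r < INR N)%R by (apply lt_INR; lia).
    apply sin_gt_0; unfold u.
    - apply Rdiv_lt_0_compat; [nra|easy].
    - apply Rmult_lt_reg_r with (INR N); [easy|]. unfold Rdiv. rewrite Rmult_assoc, Rinv_l by lra. nra. }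
  nra.
Qed.

Definition rpow (x : R) (s : C) : C := Cexp (s * RtoC (ln x)).

(* Sum over the 2M-th roots of unity, indexed by -M <= j < M. *)
Definition root_sum (M m : nat) : C :=
  csum (fun n => Cexp (RtoC (INR m) * tpi / RtoC (INR (2 * M))) ^ n) (seq 0 M)
  + csum (fun n => / Cexp (RtoC (INR m) * tpi / RtoC (INR (2 * M))) ^ S n) (seq 0 M).

Lemma root_sum_multiple (M k : nat) : (1 <= M)%nat ->
  root_sum M (2 * M * k) = RtoC (INR (2 * M)).
Proof.
  intros HM. unfold root_sum. pose proof (INR_neq0 (2 * M) ltac:(lia)) as H0.
  replace (RtoC (INR (2 * M * k)) * tpi / RtoC (INR (2 * M))) with (RtoC (INR k) * tpi).
  2:{ rewrite (mult_INR (2 * M)), RtoC_mult. field. easy. }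
  rewrite Cexp_tpi_nat.
  assert (E : forall l : list nat, csum (fun _ => 1) l = RtoC (INR (length l))).
  { induction l as [|i l IH]; [easy|]. rewrite csum_cons, IH. cbn [length].
    rewrite S_INR, RtoC_plus. ring. }
  rewrite (csum_ext (fun n => 1 ^ n) (fun _ => 1)) by (intros; apply Cpow_1_l).
  rewrite (csum_ext (fun n => / 1 ^ S n) (fun _ => 1)).
  - rewrite E, length_seq, mult_INR, RtoC_mult. simpl (INR 2). rewrite RtoC_plus. ring.
  - intros n _. rewrite Cpow_1_l. field.
Qed.

(** Multiplied by x - 1, the sum of x^j over -M <= j < M telescopes to x^M - x^(-M), which is zero
    since x^(2M) = 1. *)
Lemma root_sum_other (M m : nat) : (1 <= M)%nat -> (forall k, m <> 2 * M * k)%nat ->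
  root_sum M m = 0.
Proof.
  intros HM Hm. unfold root_sum. set (x := Cexp _).
  assert (Hx1 : x <> 1) by (apply root_of_unity_neq1; [lia|easy]).
  assert (Hx0 : x <> 0) by apply Cexp_neq0.
  pose proof (INR_neq0 (2 * M) ltac:(lia)) as H0.
  assert (H2 : x ^ M * x ^ M = 1).
  { rewrite <- Cpow_add_r. unfold x. rewrite <- Cexp_mult_nat.
    replace (M + M)%nat with (2 * M)%nat by lia.
    replace (RtoC (INR (2 * M)) * (RtoC (INR m) * tpi / RtoC (INR (2 * M))))
      with (RtoC (INR m) * tpi) by (field; easy). apply Cexp_tpi_nat. }
  pose proof (geom_csum x M) as G1. pose proof (geom_csum (/ x) M) as G2.
  rewrite (csum_ext (fun n => / x ^ S n) (fun n => / x * (/ x) ^ n) (seq 0 M)).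
  2:{ intros n _. rewrite <- Cpow_S. symmetry. now apply Cpow_inv. }
  rewrite csum_scal. set (A := csum (fun n => x ^ n) _) in *. set (B := csum (fun n => (/ x) ^ n) _) in *.
  rewrite Cpow_inv in G2 by easy.
  assert (HM0 : x ^ M <> 0) by now apply Cpow_nz.
  assert (E : (x - 1) * (A + / x * B) = 0).
  { replace ((x - 1) * (A + / x * B)) with ((x - 1) * A - (/ x - 1) * B) by (field; easy).
    rewrite G1, G2. replace (/ x ^ M) with (x ^ M); [ring|].
    transitivity (x ^ M * x ^ M * / x ^ M); [field; easy|]. rewrite H2. ring. }
  assert (Hd : x - 1 <> 0).
  { intros Hd. apply Hx1. replace x with (x - 1 + 1) by ring. rewrite Hd. ring. }
  rewrite <- (Cmult_1_l (A + / x * B)), <- (Cinv_l (x - 1)) by exact Hd.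
  rewrite <- Cmult_assoc, E. apply Cmult_0_r.
Qed.

(** The points z + j, with j = n here and j = -(n + 1) in [rpoint]: the summation points of the two
    Barnes zeta functions for omega_0 = -1. *)
Definition lpoint (z : C) (n : nat) : C := z + RtoC (INR n).
Definition rpoint (z : C) (n : nat) : C := z - 1 - RtoC (INR n).

Lemma Cmod_q_lt1 (w : C) (N : nat) : (0 < Im w)%R -> (0 < N)%nat ->
  (Cmod (Cexp (tpi * w / RtoC (INR N))) < 1)%R.
Proof.
  intros Hw HN. rewrite Cmod_Cexp, <- exp_0. apply exp_increasing.
  assert (HNR : (0 < INR N)%R) by now apply lt_0_INR.
  replace (Re (tpi * w / RtoC (INR N))) with (- (2 * PI * Im w / INR N))%R.
  - pose proof PI_RGT_0. assert (0 < 2 * PI * Im w / INR N)%R; [|lra].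
    apply Rdiv_lt_0_compat; nra.
  - unfold tpi, Cdiv. rewrite <- RtoC_inv by lra. unfold Re, Im. simpl. field. lra.
Qed.

(* Averaging the binomial series over the 2M-th roots of unity keeps only the
   exponents divisible by 2M. *)
Lemma discrete_lipschitz (s z : C) (M : nat) : (0 < Im z)%R -> (1 <= M)%nat ->
  let N := RtoC (INR (2 * M)) in
  let E := fun w => Cexp (- s * clog (1 - Cexp (tpi * w / N))) in
  is_usum allP (fun k => N * (bincoef s (2 * M * k) * Cexp (tpi * z / N) ^ (2 * M * k)))
    (csum (fun n => E (lpoint z n)) (seq 0 M) + csum (fun n => E (rpoint z n)) (seq 0 M)).
Proof.
  intros Hz HM N E.
  set (q := Cexp (tpi * z / N)).
  set (l := csum (fun n => E (lpoint z n)) (seq 0 M) + csum (fun n => E (rpoint z n)) (seq 0 M)).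
  pose proof (INR_neq0 (2 * M) ltac:(lia)) as HN0. fold N in HN0.
  assert (Hl : is_usum allP (fun m => bincoef s m * q ^ m * root_sum M m) l).
  { set (fl := fun n m => bincoef s m * Cexp (tpi * lpoint z n / N) ^ m).
    set (fr := fun n m => bincoef s m * Cexp (tpi * rpoint z n / N) ^ m).
    apply (is_usum_ext _ (fun m => csum (fun n => fl n m) (seq 0 M) + csum (fun n => fr n m) (seq 0 M))).
    - intros m _. unfold root_sum. rewrite Cmult_plus_distr_l, <- !csum_scal.
      fold N. f_equal; apply csum_ext; intros n _; unfold fl, fr, q, lpoint, rpoint.
      + rewrite <- Cmult_assoc. f_equal. rewrite <- !Cexp_mult_nat, <- Cexp_plus. f_equal. field. easy.
      + rewrite <- Cmult_assoc. f_equal. rewrite <- !Cexp_mult_nat, <- Cexp_opp, <- Cexp_plus. f_equal.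
        rewrite S_INR, RtoC_plus. field. easy.
    - apply is_usum_plus; apply is_usum_csum; intros n _; apply is_usum_binomial; apply Cmod_q_lt1; try lia.
      + unfold lpoint. simpl. unfold Im in *. lra.
      + unfold rpoint. simpl. unfold Im in *. lra. }
  assert (Hq : (Cmod q < 1)%R) by (apply Cmod_q_lt1; [easy|lia]).
  destruct (is_usum_binomial s q Hq) as [[B HB] _].
  assert (HB' : abs_bdd allP (fun k => N * (bincoef s (2 * M * k) * q ^ (2 * M * k))) (Cmod N * B)%R).
  { apply abs_bdd_scal. refine (abs_bdd_comp allP allP (fun k => (2 * M * k)%nat) _ _ _ _ HB); [|easy].
    intros; nia. }
  destruct (abs_bdd_ex _ _ _ HB') as [l' Hl']. replace l with l'; [easy|].
  (* Both values are sums of the same family over all exponents m, whose root sums vanish unless 2M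
     divides m. *)
  apply (is_usum_unique allP (fun m => bincoef s m * q ^ m * root_sum M m)); [|easy].
  apply (is_usum_reindex allP allP (fun k => (2 * M * k)%nat)); [intros; nia|easy| |].
  - intros m _. destruct (classic (exists k, m = (2 * M * k)%nat)) as [[k ->]|Hn].
    + left. now exists k.
    + right. rewrite root_sum_other; [ring|easy|]. intros k Hk. apply Hn. now exists k.
  - refine (is_usum_ext _ _ _ _ _ Hl'). intros k _. rewrite root_sum_multiple by easy. fold N. ring.
Qed.

(** * Passage to the limit: Lipschitz's formula *)

Lemma Cmod_rpow (x : R) (s : C) : Cmod (rpow x s) = Rpower x (Re s).
Proof. unfold rpow. rewrite Cmod_Cexp. unfold Rpower. f_equal. unfold Re. simpl. ring. Qed.

Lemma rpow_plus (x : R) (s t : C) : rpow x (s + t) = rpow x s * rpow x t.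
Proof. unfold rpow. rewrite <- Cexp_plus. f_equal. ring. Qed.

Lemma rpow_1 (x : R) : (0 < x)%R -> rpow x 1 = RtoC x.
Proof.
  intros Hx. unfold rpow. rewrite Cexp_pair. simpl.
  rewrite Rmult_1_l, !Rmult_0_l, Rmult_0_r, Rminus_0_r, Rplus_0_r, exp_ln, cos_0, sin_0 by easy.
  apply injective_projections; simpl; ring.
Qed.

Lemma rpow_mult (x y : R) (s : C) : (0 < x)%R -> (0 < y)%R -> rpow (x * y) s = rpow x s * rpow y s.
Proof.
  intros Hx Hy. unfold rpow. rewrite ln_mult, RtoC_plus by easy. rewrite <- Cexp_plus. f_equal. ring.
Qed.

Lemma rpow_0 (x : R) : rpow x 0 = 1.
Proof. unfold rpow. rewrite Cmult_0_l. apply Cexp_0. Qed.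

Lemma Rpower_neg_decr (a b p : R) : (0 < a <= b)%R -> (p <= 0)%R -> (Rpower b p <= Rpower a p)%R.
Proof.
  intros Hab Hp. unfold Rpower. apply exp_le. assert (ln a <= ln b)%R by (apply ln_le; lra). nra.
Qed.

Lemma nat_above (A : R) : exists N0, (1 <= N0)%nat /\ forall N, (N0 <= N)%nat -> (A < INR N)%R.
Proof.
  destruct (INR_unbounded A) as [n Hn]. exists (S n). split; [lia|]. intros N HN.
  apply Rlt_le_trans with (INR n); [lra|]. apply le_INR. lia.
Qed.

(** For m >= 1 the left side is the Gauss approximant of index m times m / (s + m) = 1 - s / (s +
    m), a factor tending to 1. The hypothesis Re s > 0 gives |s + m| >= m. *)
Lemma bincoef_asymptotics (s : C) : (0 < Re s)%R ->
  tends (fun m => rpow (INR m) (1 - s) * bincoef s m) (rGamma s).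
Proof.
  intros Hs.
  assert (H0 : tends (fun m => 1 - s / (s + RtoC (INR m))) (1 - 0)).
  { apply tends_plus; [apply tends_const|]. intros eps He.
    destruct (inv_INR_small (Cmod s) eps (Cmod_ge_0 s) He) as [N0 [HN0 K]]. exists N0.
    intros N HN. specialize (K N HN). assert (HNp : (0 < INR N)%R) by (apply lt_0_INR; lia).
    assert (Hre : (INR N <= Cmod (s + RtoC (INR N)))%R).
    { eapply Rle_trans; [|apply Re_le_Cmod]. unfold Re in *. simpl. lra. }
    replace (- (s / (s + RtoC (INR N))) - - 0) with (- (s / (s + RtoC (INR N)))) by ring.
    rewrite Cmod_opp, Cmod_div.
    - eapply Rle_lt_trans; [|exact K]. apply Rmult_le_compat_l; [apply Cmod_ge_0|].
      apply Rinv_le_contravar; easy.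
    - intros E. rewrite E, Cmod_0 in Hre. lra. }
  destruct rGamma_entire as [_ HG].
  pose proof (tends_mult _ _ _ _ (HG s) H0) as H.
  replace (rGamma s * (1 - 0)) with (rGamma s) in H by ring.
  refine (tends_ext_ev _ _ _ 1 _ H). intros [|n] Hn; [lia|].
  rewrite rGamma_approx_S. cbn [bincoef].
  replace (1 - s) with (1 + - s) by ring. rewrite rpow_plus, rpow_1 by apply INR_S_pos.
  fold (rpow (INR (S n)) (- s)). pose proof (INR_S_neq0 (S n)). pose proof (INR_S_neq0 n).
  assert (Hn0 : s + RtoC (INR (S n)) <> 0).
  { intros E. apply (f_equal Re) in E. unfold Re in *. cbn [fst Cplus RtoC] in E.
    pose proof (INR_S_pos n). lra. }
  field. easy.
Qed.

Lemma tends_rpow_neg (s : C) (k : nat -> nat) : (Re s < 0)%R -> (forall M, (M <= k M)%nat) ->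
  tends (fun M => rpow (INR (k M)) s) 0.
Proof.
  intros Hs Hk. apply (tends_subseq (fun N => rpow (INR N) s)); [easy|]. intros eps He.
  destruct (nat_above (exp (ln eps / Re s))) as [N0 [HN0 K]]. exists N0. intros N HN. specialize (K N HN).
  replace (rpow (INR N) s - 0) with (rpow (INR N) s) by ring. rewrite Cmod_rpow. unfold Rpower.
  rewrite <- (exp_ln eps) by easy. apply exp_increasing.
  assert (HNp : (0 < INR N)%R) by (apply lt_0_INR; lia).
  assert (Hl : (ln eps / Re s < ln (INR N))%R).
  { rewrite <- (ln_exp (ln eps / Re s)). apply ln_increasing; [apply exp_pos|easy]. }
  apply (Rmult_lt_compat_l (- Re s)) in Hl; [|lra].
  replace (- Re s * (ln eps / Re s))%R with (- ln eps)%R in Hl by (field; lra). lra.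
Qed.

Lemma pair_eta (w : C) : w = (Re w, Im w).
Proof. now destruct w. Qed.

(** One half of the window, [p] standing for either sequence of points. The last two hypotheses make
    |Re (p n)| comparable with n + 1, so the uniform lower bound dominates the terms by a multiple
    of (n + 1)^(-Re s). *)
Lemma side_limit (s : C) (p : nat -> C) (y X : R) : (1 < Re s)%R -> (0 < y)%R -> (0 <= X)%R ->
  (forall n, Im (p n) = y) ->
  (forall n, Rabs (Re (p n)) <= X + INR (S n))%R ->
  (forall n, INR (S n) <= (1 + X) * (1 + Rabs (Re (p n))))%R ->
  exists l, is_usum allP (fun n => Cexp (- s * clog (- (tpi * p n)))) l /\
    tends (fun M => csum (fun n => Cexp (- s * clog (RtoC (INR (2 * M)) *
       (1 - Cexp (tpi * p n / RtoC (INR (2 * M))))))) (seq 0 M)) l.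
Proof.
  intros Hs Hy HX Him Hup Hlow.
  set (w := fun M n => RtoC (INR (2 * M)) * (1 - Cexp (tpi * p n / RtoC (INR (2 * M))))).
  destruct (scaled_lower_bound y Hy) as [c [Hc Hlb]].
  (* M > 2X turns |Re (p n)| <= X + M into at most 3M / 2, the range of the lower bound. *)
  destruct (nat_above (2 * X)) as [M0 [HM0 HM]].
  set (c1 := (c / (1 + X))%R). assert (Hc1 : (0 < c1)%R) by (apply Rdiv_lt_0_compat; lra).
  set (K := (Rpower c1 (Re (- s)) * exp (2 * Cmod (- s)))%R).
  set (h := fun n => RtoC K * RtoC (Rpower (INR (S n)) (- Re s))).
  assert (Hh : abs_bdd allP h (Cmod (RtoC K) * (1 + / (Re s - 1)))%R)
    by (apply abs_bdd_scal, abs_bdd_pseries; easy).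
  (* Extension by zero beyond the window turns the finite sums into sums over one fixed index set,
     as dominated convergence requires. *)
  set (f := fun M n => if (n <? M)%nat then Cexp (- s * clog (w M n)) else RtoC 0).
  assert (HK : (0 < K)%R) by (apply Rmult_lt_0_compat; apply exp_pos).
  assert (Hdom : forall M n, (M0 <= M)%nat -> allP n -> (Cmod (f M n) <= Cmod (h n))%R).
  { intros M n HMM _. unfold f, h. destruct (Nat.ltb_spec n M) as [Hn|Hn];
      [|rewrite Cmod_0; apply Cmod_ge_0].
    specialize (HM M HMM).
    assert (HnM : (INR (S n) <= INR M)%R) by (apply le_INR; lia).
    assert (Hw : (c1 * INR (S n) <= Cmod (w M n))%R).
    { unfold w. rewrite (pair_eta (p n)), Him. eapply Rle_trans; [|apply (Hlb M)].
      - unfold c1. specialize (Hlow n). apply (Rmult_le_compat_l c1) in Hlow; [|lra].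
        replace (c1 * ((1 + X) * (1 + Rabs (Re (p n)))))%R with (c * (1 + Rabs (Re (p n))))%R in Hlow
          by (unfold c1; field; lra). exact Hlow.
      - lia.
      - specialize (Hup n). lra. }
    pose proof (INR_S_pos n) as HSn.
    assert (Hp : (0 < c1 * INR (S n))%R) by now apply Rmult_lt_0_compat.
    eapply Rle_trans; [apply Cmod_Cexp_clog|].
    rewrite Cmod_mult, !Cmod_R, !Rabs_pos_eq by (try (apply Rlt_le, exp_pos); lra).
    unfold K. replace (Re (- s)) with (- Re s)%R by easy.
    rewrite (Rmult_comm (Rpower c1 _)), Rmult_assoc, (Rmult_comm _ (exp _)).
    apply Rmult_le_compat_l; [apply Rlt_le, exp_pos|].
    rewrite Rpower_mult_distr by easy. apply Rpower_neg_decr; lra. }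
  assert (Hlim : forall n, allP n -> tends (fun M => f M n) (Cexp (- s * clog (- (tpi * p n))))).
  { intros n _.
    apply (tends_ext_ev (fun M => Cexp (- s * clog (w M n))) _ _ (S n)).
    - intros M HMn. unfold f. destruct (Nat.ltb_spec n M); [easy|lia].
    - apply tends_Cexp, tends_scal, tends_clog.
      + rewrite (pair_eta (p n)), Him. unfold tpi. simpl. pose proof PI_RGT_0. nra.
      + apply (tends_subseq (fun N => RtoC (INR N) * (1 - Cexp (tpi * p n / RtoC (INR N)))) _ (fun M => (2 * M)%nat)).
        * intros; lia.
        * apply tends_scaled_exp. }
  assert (H0 : abs_bdd allP (fun n => Cexp (- s * clog (- (tpi * p n)))) (Cmod (RtoC K) * (1 + / (Re s - 1)))%R).
  { refine (abs_bdd_mono _ _ _ _ _ Hh). intros n _.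
    apply (tends_Cmod_le _ _ _ M0 (Hlim n I)). intros M HMM. now apply Hdom. }
  destruct (abs_bdd_ex _ _ _ H0) as [l Hl]. exists l. split; [easy|].
  apply (tannery allP f _ h _ M0 _ _ Hh Hdom Hlim); [|exact Hl].
  intros M _. rewrite (csum_ext _ (f M)).
  - apply is_usum_finite; [apply seq_NoDup|apply Forall_allP|].
    intros n _ Hn. unfold f. destruct (Nat.ltb_spec n M); [|easy]. destruct Hn. apply in_seq. lia.
  - intros n Hn. apply in_seq in Hn. unfold f, w. destruct (Nat.ltb_spec n M); [easy|lia].
Qed.

(** The discrete identity is multiplied by (2M)^(-s) and both sides pass to the limit. The two
    halves keep separate sums [lA] and [lB], because each of them feeds its own Barnes zeta
    function. *)
Lemma lipschitz (s z : C) : (1 < Re s)%R -> (0 < Im z)%R ->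
  exists lA lB lR,
   is_usum allP (fun n => Cexp (- s * clog (- (tpi * lpoint z n)))) lA /\
   is_usum allP (fun n => Cexp (- s * clog (- (tpi * rpoint z n)))) lB /\
   is_usum allP (fun k => rpow (INR (S k)) (s - 1) * Cexp (tpi * RtoC (INR (S k)) * z)) lR /\
   lA + lB = rGamma s * lR.
Proof.
  intros Hs Hz.
  destruct (side_limit s (lpoint z) (Im z) (Rabs (Re z)) Hs Hz (Rabs_pos _)) as [lA [HA TA]].
  { intros n. unfold lpoint, Im. simpl. ring. }
  { intros n. rewrite S_INR. replace (Re (lpoint z n)) with (Re z + INR n)%R by easy.
    eapply Rle_trans; [apply Rabs_triang|]. rewrite (Rabs_pos_eq (INR n)) by apply pos_INR. lra. }
  { intros n. rewrite S_INR. replace (Re (lpoint z n)) with (Re z + INR n)%R by easy.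
    pose proof (Rabs_pos (Re z)). pose proof (Rabs_pos (Re z + INR n)).
    assert (INR n <= Rabs (Re z) + Rabs (Re z + INR n))%R; [|nra].
    pose proof (Rabs_triang (Re z + INR n) (- Re z)) as Ht. rewrite Rabs_Ropp in Ht.
    replace (Re z + INR n + - Re z)%R with (INR n) in Ht by ring.
    rewrite (Rabs_pos_eq (INR n)) in Ht by apply pos_INR. lra. }
  destruct (side_limit s (rpoint z) (Im z) (Rabs (Re z)) Hs Hz (Rabs_pos _)) as [lB [HB TB]].
  { intros n. unfold rpoint, Im. simpl. ring. }
  { intros n. replace (Re (rpoint z n)) with (Re z + - INR (S n))%R
      by (rewrite S_INR; unfold rpoint, Re; simpl; ring).
    eapply Rle_trans; [apply Rabs_triang|]. rewrite Rabs_Ropp, (Rabs_pos_eq (INR (S n))) by apply pos_INR. lra. }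
  { intros n. replace (Re (rpoint z n)) with (Re z - INR (S n))%R
      by (rewrite S_INR; unfold rpoint, Re; simpl; ring).
    pose proof (Rabs_pos (Re z)). pose proof (Rabs_pos (Re z - INR (S n))).
    assert (INR (S n) <= Rabs (Re z) + Rabs (Re z - INR (S n)))%R; [|nra].
    pose proof (Rabs_triang (Re z) (- (Re z - INR (S n)))) as Ht. rewrite Rabs_Ropp in Ht.
    replace (Re z + - (Re z - INR (S n)))%R with (INR (S n)) in Ht by ring.
    rewrite (Rabs_pos_eq (INR (S n))) in Ht by apply pos_INR. lra. }
  set (g := fun k => rpow (INR (S k)) (s - 1) * Cexp (tpi * RtoC (INR (S k)) * z)).
  assert (Hg : forall k, Cmod (g k) = (Rpower (INR (S k)) (Re s - 1) * exp (- (2 * PI * Im z) * INR (S k)))%R).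
  { intros k. unfold g. rewrite Cmod_mult, Cmod_rpow, Cmod_Cexp.
    f_equal. f_equal. generalize (INR (S k)). intros a.
    unfold tpi, Re, Im. simpl. ring. }
  pose proof PI_RGT_0 as Hpi.
  destruct (abs_bdd_pow_exp (Re s - 1) (2 * PI * Im z)) as [B HB0]; [nra|].
  assert (Hgb : abs_bdd allP g B).
  { refine (abs_bdd_mono _ _ _ _ _ HB0). intros k _. rewrite Hg, Cmod_R. apply Rle_abs. }
  destruct (abs_bdd_ex _ _ _ Hgb) as [lR HR].
  exists lA, lB, lR. repeat split; try easy.
  (* For n = N k, N^(1-s) = n^(1-s) k^(s-1): the k-th term on the right is [v] at n times the target
     term, and [v] tends to 1 / Gamma(s). *)
  set (v := fun m => rpow (INR m) (1 - s) * bincoef s m).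
  assert (Tv : tends v (rGamma s)) by (apply bincoef_asymptotics; lra).
  destruct (tends_bounded _ _ Tv) as [Bv HBv].
  set (f := fun M k => rpow (INR (2 * M)) (- s) * (RtoC (INR (2 * M)) *
     (bincoef s (2 * M * k) * Cexp (tpi * z / RtoC (INR (2 * M))) ^ (2 * M * k)))).
  assert (Hf0 : forall M, (1 <= M)%nat -> f M O = rpow (INR (2 * M)) (1 - s)).
  { intros M HM. unfold f. rewrite Nat.mul_0_r. simpl bincoef. simpl Cpow.
    replace (1 - s) with (1 + - s) by ring. rewrite rpow_plus, rpow_1 by (apply lt_0_INR; lia). ring. }
  assert (HfS : forall M k, (1 <= M)%nat -> f M (S k) = v (2 * M * S k)%nat * g k).
  { intros M k HM. unfold f, v, g. rewrite <- Cexp_mult_nat, (mult_INR (2 * M)), RtoC_mult.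
    assert (H2M : (0 < INR (2 * M))%R) by (apply lt_0_INR; lia).
    pose proof (INR_neq0 (2 * M) ltac:(lia)). pose proof (INR_S_pos k) as HSk.
    rewrite rpow_mult by easy. replace (1 - s) with (1 + - s) at 1 by ring.
    rewrite rpow_plus, rpow_1 by easy.
    replace (RtoC (INR (2 * M)) * RtoC (INR (S k)) * (tpi * z / RtoC (INR (2 * M))))
      with (tpi * RtoC (INR (S k)) * z) by (field; easy).
    assert (E : rpow (INR (S k)) (1 - s) * rpow (INR (S k)) (s - 1) = 1).
    { rewrite <- rpow_plus. replace (1 - s + (s - 1)) with (RtoC 0) by ring. apply rpow_0. }
    set (r1 := rpow (INR (S k)) (1 - s)) in *. set (r2 := rpow (INR (S k)) (s - 1)) in *.
    transitivity (r1 * r2 * (rpow (INR (2 * M)) (- s) * (RtoC (INR (2 * M)) *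
     (bincoef s (2 * M * S k) * Cexp (tpi * RtoC (INR (S k)) * z))))); [rewrite E; ring|ring]. }
  (* The term k = 0 is N^(1-s), bounded by 1 as Re s > 1; the others are dominated because the
     convergent sequence [v] is bounded. *)
  set (h := fun k => match k with O => RtoC 1 | S k => RtoC Bv * g k end).
  set (f0 := fun k => match k with O => RtoC 0 | S k => rGamma s * g k end).
  assert (Hh : abs_bdd allP h (Cmod 1 + Cmod (RtoC Bv) * B)%R).
  { apply (abs_bdd_S h). unfold h. now apply abs_bdd_scal. }
  apply (tends_unique (fun M =>
     csum (fun n => Cexp (- s * clog (RtoC (INR (2 * M)) *
       (1 - Cexp (tpi * lpoint z n / RtoC (INR (2 * M))))))) (seq 0 M)
     + csum (fun n => Cexp (- s * clog (RtoC (INR (2 * M)) *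
       (1 - Cexp (tpi * rpoint z n / RtoC (INR (2 * M))))))) (seq 0 M))).
  { now apply tends_plus. }
  apply (tannery allP f f0 h _ 1 _ _ Hh).
  - intros M k HM _. destruct k as [|k].
    + rewrite Hf0 by easy. unfold h. rewrite Cmod_1, Cmod_rpow. unfold Rpower.
      change (Re (1 - s)) with (1 - Re s)%R.
      apply Rle_trans with (exp 0); [apply exp_le|rewrite exp_0; lra].
      assert (0 <= ln (INR (2 * M)))%R; [|nra].
      rewrite <- ln_1. apply ln_le; [lra|]. replace 1%R with (INR 1) by easy. apply le_INR. lia.
    + rewrite HfS by easy. unfold h. rewrite !Cmod_mult, Cmod_R.
      apply Rmult_le_compat_r; [apply Cmod_ge_0|]. eapply Rle_trans; [apply HBv|apply Rle_abs].
  - intros [|k] _.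
    + refine (tends_ext_ev _ _ _ 1 (fun M HM => eq_sym (Hf0 M HM)) _).
      apply (tends_rpow_neg _ (fun M => (2 * M)%nat)); [|intros; lia].
      change (Re (1 - s)) with (1 - Re s)%R. lra.
    + refine (tends_ext_ev _ _ _ 1 (fun M HM => eq_sym (HfS M k HM)) _).
      apply tends_mult; [|apply tends_const].
      apply (tends_subseq v _ (fun M => (2 * M * S k)%nat)); [intros; nia|easy].
  - intros M HM.
    pose proof (is_usum_scal _ (rpow (INR (2 * M)) (- s)) _ _ (discrete_lipschitz s z M Hz HM)) as H.
    cbv zeta in H. rewrite Cmult_plus_distr_l, <- !csum_scal in H.
    (* N^(-s) can enter the logarithm because 1 - q has positive real part. *)
    assert (Hsc : forall w, (0 < Im w)%R ->
      rpow (INR (2 * M)) (- s) * Cexp (- s * clog (1 - Cexp (tpi * w / RtoC (INR (2 * M)))))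
      = Cexp (- s * clog (RtoC (INR (2 * M)) * (1 - Cexp (tpi * w / RtoC (INR (2 * M))))))).
    { intros w Hw. assert (H2M : (0 < INR (2 * M))%R) by (apply lt_0_INR; lia).
      rewrite clog_scale; [|easy|].
      - unfold rpow. rewrite <- Cexp_plus. f_equal. ring.
      - pose proof (Cmod_q_lt1 w (2 * M) Hw ltac:(lia)) as Hq. set (q := Cexp (tpi * w / _)) in *.
        pose proof (Re_le_Cmod q). change (Re (1 - q)) with (1 - Re q)%R. lra. }
    refine (eq_rect _ (is_usum allP (f M)) H _ _).
    f_equal; apply csum_ext; intros n _; apply Hsc; unfold lpoint, rpoint, Im in *; simpl; lra.
  - replace (rGamma s * lR) with (f0 O + rGamma s * lR) by (unfold f0; ring).
    apply is_usum_S. unfold f0. now apply is_usum_scal.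
Qed.

(** * Sums over lattice cones *)

Lemma lattice_point_cons (n : nat) (m : list nat) (w : C) (omega : list C) :
  lattice_point (n :: m) (w :: omega) = RtoC (INR n) * w + lattice_point m omega.
Proof. reflexivity. Qed.

(** Positive imaginary parts add up without cancellation, so the imaginary part of the lattice point
    alone controls the size of [m]. *)
Lemma lattice_bounds (omega : list C) : Forall (fun w : C => (0 < Im w)%R) omega ->
  exists d X, (0 < d)%R /\ (0 <= X)%R /\ forall m, length m = length omega ->
   (d * INR (list_sum m) <= Im (lattice_point m omega))%R /\
   (Rabs (Re (lattice_point m omega)) <= X * INR (list_sum m))%R.
Proof.
  induction 1 as [|w omega Hw _ [d [X [Hd [HX IH]]]]].
  - exists 1%R, 0%R. repeat split; try lra; destruct m; try easy; simpl; rewrite ?Rabs_R0; lra.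
  - exists (Rmin d (Im w)), (X + Rabs (Re w))%R. pose proof (Rabs_pos (Re w)).
    split; [now apply Rmin_case|]. split; [lra|]. intros [|n m] Hm; [easy|].
    destruct (IH m ltac:(simpl in Hm; congruence)) as [I1 I2].
    rewrite lattice_point_cons.
    replace (Im (RtoC (INR n) * w + _)) with (INR n * Im w + Im (lattice_point m omega))%R by (unfold Im; simpl; ring).
    replace (Re (RtoC (INR n) * w + _)) with (INR n * Re w + Re (lattice_point m omega))%R by (unfold Re; simpl; ring).
    change (list_sum (n :: m)) with (n + list_sum m)%nat. rewrite plus_INR.
    pose proof (pos_INR n). pose proof (pos_INR (list_sum m)).
    pose proof (Rmin_l d (Im w)). pose proof (Rmin_r d (Im w)). split; [nra|].
    eapply Rle_trans; [apply Rabs_triang|]. rewrite Rabs_mult, (Rabs_pos_eq (INR n)) by easy. nra.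
Qed.

(** Real parts of n and m . omega may cancel, so the imaginary part first bounds 1 + |m| by |w| /
    d'; then the real part bounds n by |w| plus a multiple of 1 + |m|. Adding the two gives n + |m|
    + 1 <= A |w|. *)
Lemma cone_lower_bound (z : C) (omega : list C) : (0 < Im z)%R ->
  Forall (fun w : C => (0 < Im w)%R) omega ->
  exists c, (0 < c)%R /\ forall n m, length m = length omega ->
    (c * INR (S (list_sum (n :: m))) <= Cmod (lpoint (z + lattice_point m omega) n))%R /\
    (c * INR (S (list_sum (n :: m))) <= Cmod (rpoint (z + lattice_point m omega) n))%R.
Proof.
  intros Hz Hom. destruct (lattice_bounds omega Hom) as [d [X [Hd [HX H]]]].
  set (d' := Rmin d (Im z)). set (X' := (X + Rabs (Re z) + 1)%R).
  assert (Hd' : (0 < d')%R) by now apply Rmin_case.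
  pose proof (Rabs_pos (Re z)) as Hrz.
  set (A := (1 + (1 + X') / d')%R).
  assert (HA : (0 < A)%R).
  { assert (0 < (1 + X') / d')%R by (apply Rdiv_lt_0_compat; unfold X'; lra). unfold A; lra. }
  exists (/ A)%R. split; [now apply Rinv_0_lt_compat|].
  assert (K : forall n m (w : C), length m = length omega ->
     Im w = (Im z + Im (lattice_point m omega))%R ->
     (INR n <= Rabs (Re w) + Rabs (Re z) + 1 + Rabs (Re (lattice_point m omega)))%R ->
     (/ A * INR (S (list_sum (n :: m))) <= Cmod w)%R).
  { intros n m w Hm Him Hre. destruct (H m Hm) as [I1 I2].
    change (list_sum (n :: m)) with (n + list_sum m)%nat. rewrite S_INR, plus_INR.
    pose proof (pos_INR n). pose proof (pos_INR (list_sum m)) as Hs.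
    set (mu := (1 + INR (list_sum m))%R).
    pose proof (Rmin_l d (Im z)). pose proof (Rmin_r d (Im z)). fold d' in H1, H2.
    assert (Hw1 : (d' * mu <= Cmod w)%R).
    { apply Rle_trans with (Im w).
      - rewrite Him. unfold mu. nra.
      - eapply Rle_trans; [apply Rle_abs|]. eapply Rle_trans; [|apply Rmax_Cmod]. apply Rmax_r. }
    pose proof (re_le_Cmod w) as Hw2.
    assert (Hmu : (mu <= Cmod w / d')%R).
    { apply Rmult_le_reg_l with d'; [easy|]. replace (d' * (Cmod w / d'))%R with (Cmod w) by (field; lra). easy. }
    assert (Hn : (INR n <= Cmod w + X' * mu)%R) by (unfold X', mu; nra).
    apply Rmult_le_reg_l with A; [easy|]. rewrite <- Rmult_assoc, Rinv_r, Rmult_1_l by lra.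
    replace (A * Cmod w)%R with (Cmod w + (1 + X') * (Cmod w / d'))%R by (unfold A; field; lra).
    assert ((1 + X') * mu <= (1 + X') * (Cmod w / d'))%R by (apply Rmult_le_compat_l; unfold X'; lra).
    unfold mu in *. lra. }
  intros n m Hm. set (L := lattice_point m omega) in *.
  split; apply K; auto; fold L.
  - unfold lpoint, Im. simpl. ring.
  - replace (Re (lpoint (z + L) n)) with (Re z + Re L + INR n)%R by easy.
    pose proof (Rabs_triang (Re z + Re L + INR n) (- (Re z + Re L))) as H1.
    rewrite Rabs_Ropp in H1. pose proof (Rabs_triang (Re z) (Re L)).
    replace (Re z + Re L + INR n + - (Re z + Re L))%R with (INR n) in H1 by ring.
    rewrite (Rabs_pos_eq (INR n)) in H1 by apply pos_INR. fold L. lra.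
  - unfold rpoint, Im. simpl. ring.
  - replace (Re (rpoint (z + L) n)) with (Re z + Re L - 1 - INR n)%R by (unfold rpoint, Re; simpl; ring).
    pose proof (Rabs_triang (Re z + Re L - 1 - INR n) (- (Re z + Re L - 1))) as H1.
    rewrite Rabs_Ropp in H1. pose proof (Rabs_triang (Re z) (Re L)).
    pose proof (Rabs_triang (Re z + Re L) (- (1))) as H3. rewrite Rabs_Ropp, Rabs_R1 in H3.
    replace (Re z + Re L - 1 - INR n + - (Re z + Re L - 1))%R with (- INR n)%R in H1 by ring.
    rewrite Rabs_Ropp, (Rabs_pos_eq (INR n)) in H1 by apply pos_INR. unfold Rminus in *. fold L. lra.
Qed.

(** A majorant that is a product of one-dimensional series. Every coordinate is at most the total T,
    so in dimension d it is at least (T + 1)^(-p d): decay in the total size thus gives summability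
    when p > 1. *)
Definition prodpow (p : R) (m : list nat) : R :=
  fold_right Rmult 1%R (map (fun k => Rpower (INR (S k)) (- p)) m).

Lemma prodpow_pos (p : R) (m : list nat) : (0 < prodpow p m)%R.
Proof.
  induction m as [|k m IH]; [unfold prodpow; simpl; lra|].
  apply Rmult_lt_0_compat; [apply exp_pos|exact IH].
Qed.

Lemma prodpow_lower (p : R) (T : nat) (m : list nat) : (0 <= p)%R ->
  (list_sum m <= T)%nat -> (Rpower (INR (S T)) (- (p * INR (length m))) <= prodpow p m)%R.
Proof.
  intros Hp. induction m as [|k m IH]; intros Hm.
  - unfold prodpow, Rpower. simpl map. simpl fold_right. simpl length. rewrite Rmult_0_r, Ropp_0, Rmult_0_l, exp_0. lra.
  - change (list_sum (k :: m)) with (k + list_sum m)%nat in Hm.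
    change (prodpow p (k :: m)) with (Rpower (INR (S k)) (- p) * prodpow p m)%R.
    cbn [length]. rewrite (S_INR (length m)).
    replace (- (p * (INR (length m) + 1)))%R with (- p + - (p * INR (length m)))%R by ring.
    rewrite Rpower_plus. apply Rmult_le_compat; try (apply Rlt_le, exp_pos).
    + apply Rpower_neg_decr; [|lra]. split; [apply INR_S_pos|]. apply le_INR. lia.
    + apply IH. lia.
Qed.

Lemma abs_bdd_prodpow (p : R) (d : nat) : (1 < p)%R ->
  exists B, abs_bdd (fun m => length m = d) (fun m => RtoC (prodpow p m)) B.
Proof.
  intros Hp. induction d as [|d [B IH]].
  - eexists. apply abs_bdd_list0.
  - eexists. apply length_cons_abs_bdd.
    refine (abs_bdd_mono _ _ _ _ _ (abs_bdd_prod _ _ _ _ _ _ (abs_bdd_pseries p Hp) IH)).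
    intros [n m] _. cbn [fst snd]. rewrite <- RtoC_mult. apply Rle_refl.
Qed.

(** The origin of the prefactor: -2 pi i w is 2 pi times -i w, and passing from w to -i w turns the
    argument by - pi / 2. *)
Lemma Cpower_upper (w t : C) : (0 < Im w)%R ->
  Cpower w (- t) = Cexp (- (RtoC PI / 2) * Ci * t) * Cpower (2 * RtoC PI) t
                   * Cexp (- t * clog (- (tpi * w))).
Proof.
  intros Hw. pose proof PI_RGT_0 as Hpi.
  rewrite Cpower_Im_pos by easy. rewrite <- RtoC_mult, Cpower_RtoC by lra.
  replace (- (tpi * w)) with (RtoC (2 * PI) * (- Ci * w)) by (unfold tpi; rewrite RtoC_mult; ring).
  rewrite clog_scale; [|lra|].
  - rewrite <- !Cexp_plus. f_equal. field.
  - unfold Re, Im in *. simpl. lra.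
Qed.

Lemma cone_abs_bdd (z t : C) (omega : list C) (pt : C -> nat -> C) : (0 < Im z)%R ->
  Forall (fun w : C => (0 < Im w)%R) omega ->
  (INR (length omega) + 1 < Re t)%R -> (pt = lpoint \/ pt = rpoint) ->
  exists B, abs_bdd (prodP allP (fun m => length m = length omega))
    (fun x => Cexp (- t * clog (- (tpi * pt (z + lattice_point (snd x) omega) (fst x))))) B.
Proof.
  intros Hz Hom Ht Hpt. destruct (cone_lower_bound z omega Hz Hom) as [c [Hc Hlow]].
  (* The exponent Re t is shared equally among r + 1 coordinates; p > 1 says exactly Re t > r +
     1. *)
  set (r := length omega) in *. set (p := (Re t / (INR r + 1))%R).
  pose proof (pos_INR r) as Hr. pose proof PI_RGT_0 as Hpi.
  assert (Hp : (1 < p)%R).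
  { apply Rmult_lt_reg_r with (INR r + 1)%R; [lra|]. unfold p, Rdiv. rewrite Rmult_assoc, Rinv_l; lra. }
  destruct (abs_bdd_prodpow p (S r) Hp) as [B HB].
  set (c1 := (2 * PI * c)%R). assert (Hc1 : (0 < c1)%R) by (unfold c1; nra).
  set (K := (exp (2 * Cmod (- t)) * Rpower c1 (Re (- t)))%R).
  assert (HK : (0 < K)%R) by (apply Rmult_lt_0_compat; apply exp_pos).
  exists (Cmod (RtoC K) * B)%R.
  refine (abs_bdd_mono _ _ (fun x => RtoC K * RtoC (prodpow p (fst x :: snd x))) _ _ _).
  2:{ apply abs_bdd_scal.
      refine (abs_bdd_comp (fun m => length m = S r) _ (fun x : nat * list nat => fst x :: snd x) _
         (fun m => RtoC (prodpow p m)) _ _ HB).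
      - intros [a b] [a' b'] _ _ E. simpl in E. congruence.
      - intros [a b] [_ E]. simpl in *. congruence. }
  intros [n m] [_ Hm]. cbn [fst snd] in *.
  rewrite Cmod_mult, !Cmod_R, !Rabs_pos_eq by (first [lra | apply Rlt_le, prodpow_pos]).
  set (w := pt (z + lattice_point m omega) n).
  assert (Hw : (c * INR (S (list_sum (n :: m))) <= Cmod w)%R)
    by (unfold w; destruct Hpt as [-> | ->]; apply Hlow; easy).
  set (T := list_sum (n :: m)) in *. pose proof (INR_S_pos T) as HT.
  assert (Hw' : (c1 * INR (S T) <= Cmod (- (tpi * w)))%R).
  { rewrite Cmod_opp, Cmod_mult. replace (Cmod tpi) with (2 * PI)%R.
    - unfold c1. rewrite Rmult_assoc. apply Rmult_le_compat_l; lra.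
    - unfold tpi. rewrite !Cmod_mult, Cmod_Ci, !Cmod_R, !Rabs_pos_eq by lra. ring. }
  assert (Hp0 : (0 < c1 * INR (S T))%R) by now apply Rmult_lt_0_compat.
  eapply Rle_trans; [apply Cmod_Cexp_clog|].
  unfold K. rewrite (Rmult_comm (Rpower _ _)), Rmult_assoc.
  apply Rmult_le_compat_l; [apply Rlt_le, exp_pos|].
  apply Rle_trans with (Rpower c1 (Re (- t)) * Rpower (INR (S T)) (Re (- t)))%R.
  - rewrite Rpower_mult_distr by easy. apply Rpower_neg_decr; [lra|].
    change (Re (- t)) with (- Re t)%R. lra.
  - apply Rmult_le_compat_l; [apply Rlt_le, exp_pos|].
    eapply Rle_trans; [|apply (prodpow_lower p T (n :: m)); [lra|apply le_n]].
    right. f_equal. change (Re (- t)) with (- Re t)%R. cbn [length]. rewrite Hm, S_INR.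
    unfold p. field. lra.
Qed.

Definition phase (t : C) : C := Cexp (- (RtoC PI / 2) * Ci * t) * Cpower (2 * RtoC PI) t.

(** For Re t > r + 1 the continuation is the sum itself, and a list of length r + 1 is a pair of n
    and m. The parameter [pt] covers both Barnes zeta functions. *)
Lemma barnes_zeta_cone (z t z0 w0 : C) (omega : list C) (pt : C -> nat -> C) : (0 < Im z)%R ->
  Forall (fun w : C => (0 < Im w)%R) omega ->
  (INR (length omega) + 1 < Re t)%R -> (pt = lpoint \/ pt = rpoint) ->
  (forall n L, z0 + (RtoC (INR n) * w0 + L) = pt (z + L) n) ->
  exists l, barnes_zeta t z0 (w0 :: omega) = phase t * l /\
   is_usum (prodP allP (fun m => length m = length omega))
    (fun x => Cexp (- t * clog (- (tpi * pt (z + lattice_point (snd x) omega) (fst x))))) l.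
Proof.
  intros Hz Hom Ht Hpt Hpoint.
  destruct (cone_abs_bdd z t omega pt Hz Hom Ht Hpt) as [B HB].
  destruct (abs_bdd_ex _ _ _ HB) as [l Hl]. exists l. split; [|easy].
  unfold barnes_zeta, continuation. cbn [length]. rewrite S_INR.
  destruct (Rlt_dec (INR (length omega) + 1) (Re t)); [|easy].
  apply usum_eq. apply length_cons_reindex.
  refine (is_usum_ext _ _ _ _ _ (is_usum_scal _ (phase t) _ _ Hl)).
  intros [n m] [_ Hm]. cbn [fst snd] in *. rewrite lattice_point_cons, Hpoint.
  rewrite Cpower_upper; [easy|].
  destruct (lattice_bounds omega Hom) as [d [X [Hd [_ H]]]]. destruct (H m Hm) as [H1 _].
  pose proof (pos_INR (list_sum m)).
  assert (0 <= Im (lattice_point m omega))%R by nra.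
  destruct Hpt as [-> | ->]; unfold lpoint, rpoint, Im in *; simpl; lra.
Qed.

(** * Geometric series over the cone *)

Lemma lattice_Im_ge0 (omega : list C) (m : list nat) :
  Forall (fun w : C => (0 < Im w)%R) omega -> length m = length omega ->
  (0 <= Im (lattice_point m omega))%R.
Proof.
  intros Hom Hm. destruct (lattice_bounds omega Hom) as [d [X [Hd [_ H]]]].
  destruct (H m Hm) as [H1 _]. pose proof (pos_INR (list_sum m)). nra.
Qed.

Lemma Cmod_Cexp_tpi (a : R) (w : C) : Cmod (Cexp (tpi * RtoC a * w)) = exp (- (2 * PI * a * Im w)).
Proof. rewrite Cmod_Cexp. f_equal. unfold tpi, Re, Im. simpl. ring. Qed.

Definition cprodq (a : R) (omega : list C) : C :=
  Cprod (map (fun w : C => 1 - Cexp (tpi * RtoC a * w)) omega).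

(** Each generator contributes one geometric series, with ratio e^{2 pi i a w} of modulus less than
    1. *)
Lemma geometric_cone (a : R) (omega : list C) : (0 < a)%R ->
  Forall (fun w : C => (0 < Im w)%R) omega ->
  (exists B, abs_bdd (fun m => length m = length omega)
      (fun m => Cexp (tpi * RtoC a * lattice_point m omega)) B) /\
  is_usum (fun m => length m = length omega)
    (fun m => Cexp (tpi * RtoC a * lattice_point m omega)) (/ cprodq a omega) /\
  cprodq a omega <> 0.
Proof.
  intros Ha. induction 1 as [|w omega Hw _ [[B HB] [HU Hnz]]].
  - split; [|split].
    + eexists. apply abs_bdd_list0.
    + replace (/ cprodq a nil) with (Cexp (tpi * RtoC a * lattice_point nil nil)).
      * apply (is_usum_list0 (fun m => Cexp (tpi * RtoC a * lattice_point m nil))).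
      * unfold cprodq, lattice_point. simpl. rewrite Cmult_0_r, Cexp_0. field.
    + unfold cprodq. simpl. apply C1_nz.
  - set (q := Cexp (tpi * RtoC a * w)).
    assert (Hq : (Cmod q < 1)%R).
    { unfold q. rewrite Cmod_Cexp_tpi, <- exp_0. apply exp_increasing. pose proof PI_RGT_0.
      assert (0 < PI * a)%R by nra. nra. }
    assert (E : forall n m, Cexp (tpi * RtoC a * lattice_point (n :: m) (w :: omega))
       = q ^ n * Cexp (tpi * RtoC a * lattice_point m omega)).
    { intros n m. rewrite lattice_point_cons. unfold q. rewrite <- Cexp_mult_nat, <- Cexp_plus.
      f_equal. ring. }
    pose proof (C1_minus_neq0 q Hq) as Hq1.
    change (cprodq a (w :: omega)) with ((1 - q) * cprodq a omega). split; [|split].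
    + eexists. apply length_cons_abs_bdd.
      refine (abs_bdd_mono _ _ _ _ _ (abs_bdd_prod _ _ _ _ _ _ (abs_bdd_geom q Hq) HB)).
      intros [n m] _. cbn [fst snd]. rewrite E. apply Rle_refl.
    + apply length_cons_reindex.
      replace (/ ((1 - q) * cprodq a omega)) with (/ (1 - q) * / cprodq a omega) by (field; easy).
      refine (is_usum_ext _ _ _ _ _ (is_usum_prod _ _ _ _ _ _ _ _ (abs_bdd_geom q Hq) HB
        (is_usum_geom q Hq) HU)).
      intros [n m] _. cbn [fst snd]. now rewrite E.
    + now apply Cmult_neq_0.
Qed.

Definition qterm (z : C) (omega : list C) (s : C) (k : nat) : C :=
  rpow (INR (S k)) (s - 1) * Cexp (tpi * RtoC (INR (S k)) * z) / cprodq (INR (S k)) omega.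

Lemma Cexp_tpi_decr (a : R) (w : C) : (1 <= a)%R -> (0 <= Im w)%R ->
  (Cmod (Cexp (tpi * RtoC a * w)) <= Cmod (Cexp (tpi * RtoC 1 * w)))%R.
Proof.
  intros Ha Hw. rewrite !Cmod_Cexp_tpi. apply exp_le. pose proof PI_RGT_0.
  assert (0 <= PI * Im w)%R by nra. nra.
Qed.

(** The inverse product is a sum of exponentials whose moduli decrease in [a], so the absolute bound
    at a = 1 serves for all a >= 1. *)
Lemma cprodq_inv_bound (omega : list C) : Forall (fun w : C => (0 < Im w)%R) omega ->
  exists D, forall a, (1 <= a)%R -> (Cmod (/ cprodq a omega) <= D)%R.
Proof.
  intros Hom. destruct (geometric_cone 1 omega Rlt_0_1 Hom) as [[B HB] _].
  exists B. intros a Ha. destruct (geometric_cone a omega ltac:(lra) Hom) as [_ [HU _]].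
  refine (is_usum_Cmod_le _ _ _ _ _ HU). refine (abs_bdd_mono _ _ _ _ _ HB).
  intros m Hm. apply Cexp_tpi_decr; [easy|]. now apply lattice_Im_ge0.
Qed.

Lemma qpart_abs_bdd (z s : C) : (0 < Im z)%R -> exists B,
  abs_bdd allP (fun k => rpow (INR (S k)) (s - 1) * Cexp (tpi * RtoC (INR (S k)) * z)) B.
Proof.
  intros Hz. destruct (abs_bdd_pow_exp (Re s - 1) (2 * PI * Im z)) as [B HB].
  { pose proof PI_RGT_0. nra. }
  exists B. refine (abs_bdd_mono _ _ _ _ _ HB). intros k _.
  rewrite Cmod_mult, Cmod_rpow, Cmod_Cexp_tpi, Cmod_R.
  replace (- (2 * PI * INR (S k) * Im z))%R with (- (2 * PI * Im z) * INR (S k))%R by ring.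
  apply Rle_abs.
Qed.

Lemma qterm_ex (z s : C) (omega : list C) : (0 < Im z)%R ->
  Forall (fun w : C => (0 < Im w)%R) omega -> exists L, is_usum allP (qterm z omega s) L.
Proof.
  intros Hz Hom. destruct (qpart_abs_bdd z s Hz) as [B HB].
  destruct (cprodq_inv_bound omega Hom) as [D HD].
  apply (abs_bdd_ex _ _ (Cmod (RtoC D) * B)%R).
  refine (abs_bdd_mono _ _ _ _ _ (abs_bdd_scal _ (RtoC D) _ _ HB)). intros k _.
  unfold qterm, Cdiv. rewrite (Cmult_comm _ (/ _)), !(Cmod_mult _ (_ * _)), Cmod_R.
  apply Rmult_le_compat_r; [apply Cmod_ge_0|]. eapply Rle_trans; [|apply Rle_abs].
  apply HD, INR_S_ge1.
Qed.

Lemma RtoC_m1 : RtoC (-1) = - (1).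
Proof. apply injective_projections; simpl; ring. Qed.

(** Lipschitz's formula is applied at z + m . omega for every m. On the left the sum over n is taken
    first, for fixed m; on the right absolute convergence allows the sum over m to be taken first,
    which produces the inverse products in [qterm]. *)
Lemma cone_sum_formula (z t : C) (omega : list C) (L : C) : (0 < Im z)%R ->
  Forall (fun w : C => (0 < Im w)%R) omega ->
  (INR (length omega) + 1 < Re t)%R -> is_usum allP (qterm z omega t) L ->
  barnes_zeta t (z + -1) (RtoC (-1) :: omega) + barnes_zeta t z (- RtoC (-1) :: omega)
  = phase t * rGamma t * L.
Proof.
  intros Hz Hom Ht HL. pose proof (pos_INR (length omega)) as Hr.
  destruct (barnes_zeta_cone z t z (- RtoC (-1)) omega lpoint Hz Hom Ht (or_introl eq_refl))
    as [l1 [E1 U1]].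
  { intros n w. unfold lpoint. rewrite RtoC_m1. ring. }
  destruct (barnes_zeta_cone z t (z + -1) (RtoC (-1)) omega rpoint Hz Hom Ht (or_intror eq_refl))
    as [l2 [E2 U2]].
  { intros n w. unfold rpoint. rewrite RtoC_m1. ring. }
  rewrite E1, E2.
  (* The three sums of Lipschitz's formula are to become functions of [m]; lists of the wrong length
     receive dummy values. *)
  assert (Hm : forall m, exists v : C * C * C, length m = length omega ->
    is_usum allP (fun n => Cexp (- t * clog (- (tpi * lpoint (z + lattice_point m omega) n)))) (fst (fst v)) /\
    is_usum allP (fun n => Cexp (- t * clog (- (tpi * rpoint (z + lattice_point m omega) n)))) (snd (fst v)) /\
    is_usum allP (fun k => rpow (INR (S k)) (t - 1) * Cexp (tpi * RtoC (INR (S k)) * (z + lattice_point m omega))) (snd v) /\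
    fst (fst v) + snd (fst v) = rGamma t * snd v).
  { intros m. destruct (Nat.eq_dec (length m) (length omega)) as [Em|Em];
      [|exists (RtoC 0, RtoC 0, RtoC 0); easy].
    destruct (lipschitz t (z + lattice_point m omega)) as [a [b [c H]]]; [lra| |].
    - pose proof (lattice_Im_ge0 omega m Hom Em). unfold Im in *. simpl. lra.
    - exists (a, b, c). intros _. exact H. }
  pose (v := fun m => proj1_sig (constructive_indefinite_description _ (Hm m))).
  assert (Hv := fun m => proj2_sig (constructive_indefinite_description _ (Hm m))).
  change (forall m, length m = length omega ->
    is_usum allP (fun n => Cexp (- t * clog (- (tpi * lpoint (z + lattice_point m omega) n)))) (fst (fst (v m))) /\
    is_usum allP (fun n => Cexp (- t * clog (- (tpi * rpoint (z + lattice_point m omega) n)))) (snd (fst (v m))) /\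
    is_usum allP (fun k => rpow (INR (S k)) (t - 1) * Cexp (tpi * RtoC (INR (S k)) * (z + lattice_point m omega))) (snd (v m)) /\
    fst (fst (v m)) + snd (fst (v m)) = rGamma t * snd (v m)) in Hv.
  pose proof (fubini_snd _ _ _ (fun m => fst (fst (v m))) _ (fun m Em => proj1 (Hv m Em)) U1) as V1.
  pose proof (fubini_snd _ _ _ (fun m => snd (fst (v m))) _ (fun m Em => proj1 (proj2 (Hv m Em))) U2) as V2.
  destruct (qpart_abs_bdd z t Hz) as [B1 HB1].
  destruct (geometric_cone 1 omega Rlt_0_1 Hom) as [[B2 HB2] _].
  pose proof (abs_bdd_prod _ _ _ _ _ _ HB1 HB2) as HB.
  set (H := fun x : nat * list nat => rpow (INR (S (fst x))) (t - 1) *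
     Cexp (tpi * RtoC (INR (S (fst x))) * (z + lattice_point (snd x) omega))).
  assert (EH : forall k m, H (k, m) = rpow (INR (S k)) (t - 1) * Cexp (tpi * RtoC (INR (S k)) * z)
     * Cexp (tpi * RtoC (INR (S k)) * lattice_point m omega)).
  { intros k m. unfold H. cbn [fst snd].
    rewrite (Cmult_plus_distr_l _ z), Cexp_plus. ring. }
  (* The lattice factor is replaced by its value for exponent 1, which is larger in modulus; the
     majorant then factors into a k-part and an m-part. *)
  assert (HH : abs_bdd (prodP allP (fun m => length m = length omega)) H (B1 * B2)%R).
  { refine (abs_bdd_mono _ _ _ _ _ HB). intros [k m] [_ Em]. rewrite EH. cbn [fst snd] in *.
    rewrite !(Cmod_mult (_ * _)). apply Rmult_le_compat_l; [apply Cmod_ge_0|].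
    apply Cexp_tpi_decr; [apply INR_S_ge1|now apply lattice_Im_ge0]. }
  destruct (abs_bdd_ex _ _ _ HH) as [l HHl].
  pose proof (fubini_snd _ _ _ (fun m => snd (v m)) _ (fun m Em => proj1 (proj2 (proj2 (Hv m Em)))) HHl) as V3.
  assert (El : l = L).
  { apply (is_usum_unique allP (qterm z omega t)); [|easy].
    refine (fubini_fst _ _ H _ _ _ HHl). intros k _.
    refine (is_usum_ext _ _ _ _ (fun m _ => eq_sym (EH k m)) _).
    unfold qterm, Cdiv. apply is_usum_scal. apply geometric_cone; [apply INR_S_pos|easy]. }
  assert (E : l2 + l1 = rGamma t * L).
  { rewrite <- El, Cplus_comm. apply (is_usum_unique (fun m => length m = length omega) (fun m => fst (fst (v m)) + snd (fst (v m)))).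
    - now apply is_usum_plus.
    - refine (is_usum_ext _ _ _ _ _ (is_usum_scal _ (rGamma t) _ _ V3)).
      intros m Em. symmetry. now apply Hv. }
  rewrite <- Cmult_plus_distr_l, E. ring.
Qed.

Lemma entire_bd_rpow (x : R) : (1 <= x)%R -> entire_bd (rpow x) (fun rho => Rpower x rho).
Proof.
  intros Hx. refine (entire_bd_le _ _ _ _ (entire_bd_Cexp (RtoC (ln x)))).
  intros rho _. rewrite Cmod_R, Rabs_pos_eq; [apply Rle_refl|].
  rewrite <- ln_1. apply ln_le; lra.
Qed.

(** In the norm, k^s costs k^rho, which the decay e^{-2 pi k Im z} outweighs for every rho, and [D]
    bounds the inverse products uniformly in k. *)
Lemma entire_qsum (z : C) (omega : list C) (L : C -> C) : (0 < Im z)%R ->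
  Forall (fun w : C => (0 < Im w)%R) omega -> (forall s, is_usum allP (qterm z omega s) (L s)) ->
  exists M, entire_bd L M.
Proof.
  intros Hz Hom HL. destruct (cprodq_inv_bound omega Hom) as [D HD].
  assert (Hpi : (0 < 2 * PI * Im z)%R) by (pose proof PI_RGT_0; nra).
  pose (B := fun rho => proj1_sig (constructive_indefinite_description _ (abs_bdd_pow_exp rho _ Hpi))).
  assert (HB : forall rho, abs_bdd allP (fun n => RtoC (Rpower (INR (S n)) rho * exp (- (2 * PI * Im z) * INR (S n)))) (B rho))
    by (intros rho; exact (proj2_sig (constructive_indefinite_description _ (abs_bdd_pow_exp rho _ Hpi)))).
  set (cf := fun k => rpow (INR (S k)) (- (1)) * Cexp (tpi * RtoC (INR (S k)) * z) / cprodq (INR (S k)) omega).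
  exists (fun rho => D * B rho)%R.
  apply (entire_bd_sum (fun k s => qterm z omega s k)
    (fun k rho => Rpower (INR (S k)) rho * (D * exp (- (2 * PI * Im z) * INR (S k))))%R); [| |exact HL].
  - intros k. pose proof (INR_S_ge1 k) as Hk. specialize (HD (INR (S k)) Hk).
    refine (entire_bd_ext _ _ _ _ (entire_bd_le _ _ _ _ (entire_bd_mult _ _ _ _
       (entire_bd_rpow (INR (S k)) Hk) (entire_bd_const (cf k))))).
    + intros s. unfold qterm, cf. replace (s - 1) with (s + - (1)) by ring. rewrite rpow_plus.
      unfold Cdiv. ring.
    + intros rho _. apply Rmult_le_compat_l; [apply Rlt_le, exp_pos|].
      unfold cf, Cdiv. rewrite !Cmod_mult, Cmod_rpow, Cmod_Cexp_tpi.
      replace (- (2 * PI * INR (S k) * Im z))%R with (- (2 * PI * Im z) * INR (S k))%R by ring.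
      rewrite Rmult_comm. apply Rmult_le_compat; [apply Cmod_ge_0| |easy|].
      * apply Rmult_le_pos; apply Rlt_le, exp_pos.
      * rewrite <- (Rmult_1_l (exp _)) at 2. apply Rmult_le_compat_r; [apply Rlt_le, exp_pos|].
        unfold Rpower. apply Rle_trans with (exp 0); [apply exp_le|rewrite exp_0; lra].
        change (Re (- (1))) with (- (1))%R.
        assert (0 <= ln (INR (S k)))%R by (rewrite <- ln_1; apply ln_le; lra). lra.
  - intros rho m _. assert (HD0 : (0 <= D)%R).
    { eapply Rle_trans; [apply Cmod_ge_0|apply (HD 1%R); lra]. }
    specialize (HB rho (seq 0 m) (seq_NoDup _ _) (Forall_allP _)).
    eapply Rle_trans; [|apply Rmult_le_compat_l; [exact HD0|exact HB]].
    rewrite <- rsum_scal. apply rsum_le. intros k _. unfold mods.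
    rewrite Cmod_R, Rabs_pos_eq; [right; ring|]. apply Rmult_le_pos; apply Rlt_le, exp_pos.
Qed.

(** * Identity theorem *)

Lemma is_pseries_C (a : nat -> C) (x l : C) :
  is_pseries a x l <-> is_series (fun k => a k * x ^ k) l.
Proof.
  assert (E : forall k, scal (pow_n x k) (a k) = a k * x ^ k).
  { intros k. replace (pow_n x k) with (x ^ k); [apply Cmult_comm|].
    induction k as [|k IH]; [easy|]. rewrite Cpow_S, IH. reflexivity. }
  split; intros H; (eapply is_series_ext; [|exact H]); intros k; [apply E|symmetry; apply E].
Qed.

Lemma entire_bd_analytic (f : C -> C) (M : R -> R) (s0 : C) : entire_bd f M -> analytic_at f s0.
Proof.
  intros H. destruct (entire_bd_translate f M s0 H) as [a [_ Ha]].
  exists a, (mkposreal 1 Rlt_0_1). intros s _. apply is_pseries_C.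
  replace (f s) with (f (s0 + (s - s0))) by (f_equal; ring).
  apply is_usum_is_series, Ha.
Qed.

Lemma is_series_C_unique (f : nat -> C) (l l' : C) : is_series f l -> is_series f l' -> l = l'.
Proof.
  intros H H'. apply (tends_unique (sum_n f)); apply tends_filterlim; [exact H|exact H'].
Qed.

(** Convergence at rho / 2 forces a positive radius, because outside the disc the terms would not
    tend to 0; the sum is then continuous at 0. Only h > 0 occurs, since equality will be known only
    to the right of a point. *)
Lemma series_right_cont_R (a : nat -> R) (A : R -> R) (rho : R) : (0 < rho)%R ->
  (forall h, (0 < h < rho)%R -> is_series (fun k => a k * h ^ k)%R (A h)) ->
  forall eps, (0 < eps)%R -> exists d, (0 < d)%R /\ forall h, (0 < h < d)%R -> (Rabs (A h - a O) < eps)%R.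
Proof.
  intros Hr HA eps He.
  assert (Hcv : Rbar_le (Rabs (rho / 2)) (CV_radius a)).
  { apply Rbar_not_lt_le. intros Hlt. apply (CV_disk_outside _ _ Hlt).
    apply ex_series_lim_0. exists (A (rho / 2)%R). apply HA. lra. }
  assert (H0 : Rbar_lt (Rabs 0) (CV_radius a)).
  { eapply Rbar_lt_le_trans; [|exact Hcv]. simpl. rewrite Rabs_R0, Rabs_pos_eq; lra. }
  destruct (PSeries_continuity a 0 H0 eps He) as [d [Hd K]].
  exists (Rmin d rho). split; [now apply Rmin_case|]. intros h Hh.
  pose proof (Rmin_l d rho). pose proof (Rmin_r d rho).
  assert (E : PSeries a h = A h) by (apply is_pseries_unique, is_pseries_R, HA; lra).
  rewrite <- E, <- (PSeries_0 a). apply (K h). split; [split; [easy|]; lra|].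
  unfold R_met; simpl. unfold Rdist. rewrite Rminus_0_r, Rabs_pos_eq; lra.
Qed.

Lemma series_right_cont (d : nat -> C) (D : R -> C) (rho : R) : (0 < rho)%R ->
  (forall h, (0 < h < rho)%R -> is_series (fun k => d k * RtoC h ^ k) (D h)) ->
  forall eps, (0 < eps)%R ->
  exists e, (0 < e)%R /\ forall h, (0 < h < e)%R -> (Cmod (D h - d O) < eps)%R.
Proof.
  intros Hr HD eps He. assert (He2 : (0 < eps / 2)%R) by lra.
  destruct (series_right_cont_R (fun k => fst (d k)) (fun h => fst (D h)) rho Hr) with (eps := (eps / 2)%R)
    as [e1 [He1 K1]]; [|easy|].
  { intros h Hh. eapply is_series_ext; [|exact (is_series_fst _ _ (HD h Hh))].
    intros k. cbv beta. rewrite <- RtoC_pow. simpl. ring. }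
  destruct (series_right_cont_R (fun k => snd (d k)) (fun h => snd (D h)) rho Hr) with (eps := (eps / 2)%R)
    as [e2 [He3 K2]]; [|easy|].
  { intros h Hh. eapply is_series_ext; [|exact (is_series_snd _ _ (HD h Hh))].
    intros k. cbv beta. rewrite <- RtoC_pow. simpl. ring. }
  exists (Rmin e1 e2). split; [now apply Rmin_case|]. intros h Hh.
  pose proof (Rmin_l e1 e2). pose proof (Rmin_r e1 e2).
  specialize (K1 h ltac:(lra)). specialize (K2 h ltac:(lra)). cbv beta in K1, K2.
  replace (D h - d O) with (RtoC (fst (D h) - fst (d O)) + Ci * RtoC (snd (D h) - snd (d O)))
    by (apply injective_projections; simpl; ring).
  eapply Rle_lt_trans; [apply Cmod_triangle|]. rewrite Cmod_mult, Cmod_Ci, !Cmod_R. lra.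
Qed.

(** The constant coefficient is the limit at 0 from the right, hence zero. Division by h then shifts
    the series, which is why the induction quantifies over [d]. *)
Lemma series_zero_coef (rho : R) : (0 < rho)%R -> forall (k : nat) (d : nat -> C),
  (forall h, (0 < h < rho)%R -> is_series (fun k => d k * RtoC h ^ k) (RtoC 0)) -> d k = 0.
Proof.
  intros Hr.
  assert (H0 : forall d, (forall h, (0 < h < rho)%R -> is_series (fun k => d k * RtoC h ^ k) (RtoC 0)) -> d O = 0).
  { intros d Hd. apply NNPP. intros Hn. apply Cmod_gt_0 in Hn.
    destruct (series_right_cont d (fun _ => RtoC 0) rho Hr Hd _ Hn) as [e [He K]].
    specialize (K (e / 2)%R ltac:(lra)).
    replace (0 - d O) with (- d O) in K by ring. rewrite Cmod_opp in K. lra. }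
  induction k as [|k IH]; intros d Hd; [now apply H0|].
  apply (IH (fun k => d (S k))). intros h Hh. pose proof (H0 d Hd) as Hd0. specialize (Hd h Hh).
  assert (Hh0 : RtoC h <> 0) by (intros E; apply RtoC_inj in E; lra).
  assert (H1 : is_series (fun k => d (S k) * RtoC h ^ S k) (RtoC 0)).
  { apply (is_series_incr_1 (fun k => d k * RtoC h ^ k)).
    rewrite Hd0.
    match goal with |- is_series _ ?l => replace l with (RtoC 0) end; [exact Hd|].
    change (RtoC 0 = Cplus 0 (0 * RtoC h ^ 0)). simpl. ring. }
  replace (RtoC 0) with (/ RtoC h * 0) by ring.
  eapply is_series_ext; [|apply (is_series_scal (/ RtoC h) _ _ H1)].
  intros n. change (/ RtoC h * (d (S n) * RtoC h ^ S n) = d (S n) * RtoC h ^ n).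
  rewrite Cpow_S. field. easy.
Qed.

Lemma analytic_right_cont (G : C -> C) (s0 : C) : analytic_at G s0 ->
  forall eps, (0 < eps)%R ->
  exists e, (0 < e)%R /\ forall h, (0 < h < e)%R -> (Cmod (G (s0 + RtoC h)%C - G s0) < eps)%R.
Proof.
  intros [a [rho HG]] eps He.
  assert (E0 : a O = G s0).
  { specialize (HG s0). replace (s0 - s0) with (RtoC 0) in HG by ring.
    rewrite Cmod_0 in HG. specialize (HG (cond_pos rho)). apply is_pseries_C in HG.
    assert (H : is_series (fun k => a k * 0 ^ k) (a O)).
    { pose proof (is_usum_finite allP (fun k => a k * 0 ^ k) (O :: nil)) as H.
      replace (csum _ _) with (a O) in H by (unfold csum; simpl; ring).
      apply is_usum_is_series, H; [repeat constructor; easy|apply Forall_allP|].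
      intros [|k] _ Hk; [destruct Hk; now left|]. simpl. ring. }
    exact (is_series_C_unique _ _ _ H HG). }
  rewrite <- E0.
  apply (series_right_cont a (fun h => G (s0 + RtoC h)) rho (cond_pos rho)); [|easy].
  intros h Hh. apply is_pseries_C.
  replace (RtoC h) with (s0 + RtoC h - s0) at 1 by ring. apply HG.
  replace (s0 + RtoC h - s0) with (RtoC h) by ring. rewrite Cmod_R, Rabs_pos_eq; lra.
Qed.

(** A short segment to the right of [s0] determines all Taylor coefficients, hence a full disc. A
    pole of [F] is impossible: its numerator [H] would satisfy H(s0 + h) = G(s0 + h) h^N, which
    tends to 0, while H(s0) is not 0. *)
Lemma local_identity (F G : C -> C) (s0 : C) (e : R) : (0 < e)%R ->
  analytic_at F s0 \/ pole_at F s0 -> analytic_at G s0 ->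
  (forall h, (0 < h < e)%R -> F (s0 + RtoC h) = G (s0 + RtoC h)) ->
  exists rho, (0 < rho)%R /\ forall s, (Cmod (s - s0) < rho)%R -> F s = G s.
Proof.
  intros He HF HG HFG. destruct HF as [[a [r1 HF]]|[_ [N [H [r1 [HN [HH [HH0 HFH]]]]]]]].
  - destruct HG as [b [r2 HG]].
    set (rho := Rmin (Rmin r1 r2) e).
    assert (Hrho : (0 < rho /\ rho <= r1 /\ rho <= r2 /\ rho <= e)%R).
    { pose proof (cond_pos r1). pose proof (cond_pos r2). unfold rho.
      pose proof (Rmin_l (Rmin r1 r2) e). pose proof (Rmin_r (Rmin r1 r2) e).
      pose proof (Rmin_l r1 r2). pose proof (Rmin_r r1 r2).
      repeat split; try lra. repeat apply Rmin_case; easy. }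
    assert (Hd : forall k, a k - b k = 0).
    { intros k. apply (series_zero_coef rho (proj1 Hrho) k (fun k => a k - b k)). intros h Hh.
      assert (Eh : s0 + RtoC h - s0 = RtoC h) by ring.
      assert (Hc : (Cmod (RtoC h) < rho)%R) by (rewrite Cmod_R, Rabs_pos_eq; lra).
      specialize (HF (s0 + RtoC h)). specialize (HG (s0 + RtoC h)). rewrite Eh in HF, HG.
      specialize (HF ltac:(lra)). specialize (HG ltac:(lra)). rewrite HFG in HF by lra.
      apply is_pseries_C in HF. apply is_pseries_C in HG.
      pose proof (is_series_minus _ _ _ _ HF HG) as HS.
      set (g := G (s0 + RtoC h)) in *.
      replace (RtoC 0) with (g - g) by ring.
      eapply is_series_ext; [|exact HS]. intros n. cbv beta.
      change (a n * RtoC h ^ n - b n * RtoC h ^ n = (a n - b n) * RtoC h ^ n). ring. }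
    exists rho. split; [easy|]. intros s Hs.
    specialize (HF s ltac:(lra)). specialize (HG s ltac:(lra)).
    apply is_pseries_C in HF. apply is_pseries_C in HG.
    apply (is_series_C_unique _ _ _ HF). eapply is_series_ext; [|exact HG].
    intros k. change (b k * (s - s0) ^ k = a k * (s - s0) ^ k).
    replace (a k) with (a k - b k + b k) by ring. rewrite Hd. ring.
  - exfalso. apply Cmod_gt_0 in HH0 as Hpos.
    destruct (analytic_right_cont H s0 HH (Cmod (H s0) / 2)%R) as [e1 [He1 K1]]; [lra|].
    destruct (analytic_right_cont G s0 HG 1%R Rlt_0_1) as [e2 [He2 K2]].
    pose proof (Cmod_ge_0 (G s0)) as HG0.
    (* For h <= q and h < 1, |G(s0 + h)| h^N is at most (|G(s0)| + 1) q = |H(s0)| / 2, against |H(s0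
       + h)| > |H(s0)| / 2. *)
    set (q := (Cmod (H s0) / (2 * (Cmod (G s0) + 1)))%R).
    assert (Hq : (0 < q)%R) by (apply Rdiv_lt_0_compat; lra).
    assert (Hh : exists h, (0 < h)%R /\ (h < e)%R /\ (h < e1)%R /\ (h < e2)%R /\ (h < r1)%R /\ (h < 1)%R /\ (h <= q)%R).
    { pose proof (cond_pos r1) as Hr1.
      set (m := Rmin (Rmin (Rmin e e1) (Rmin e2 r1)) (Rmin 1 q)).
      assert (Hm : (0 < m)%R) by (unfold m; repeat apply Rmin_case; lra).
      pose proof (Rmin_l (Rmin (Rmin e e1) (Rmin e2 r1)) (Rmin 1 q)).
      pose proof (Rmin_r (Rmin (Rmin e e1) (Rmin e2 r1)) (Rmin 1 q)).
      pose proof (Rmin_l (Rmin e e1) (Rmin e2 r1)). pose proof (Rmin_r (Rmin e e1) (Rmin e2 r1)).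
      pose proof (Rmin_l e e1). pose proof (Rmin_r e e1). pose proof (Rmin_l e2 r1). pose proof (Rmin_r e2 r1).
      pose proof (Rmin_l 1 q). pose proof (Rmin_r 1 q). fold m in H0, H1.
      exists (m / 2)%R. repeat split; lra. }
    destruct Hh as [h [H1 [H2 [H3 [H4 [H5 [H6 H7]]]]]]].
    specialize (K1 h ltac:(lra)). specialize (K2 h ltac:(lra)).
    assert (Hn0 : RtoC h <> 0) by (intros E; apply RtoC_inj in E; lra).
    assert (Eh : s0 + RtoC h - s0 = RtoC h) by ring.
    specialize (HFH (s0 + RtoC h)). rewrite Eh in HFH.
    rewrite HFG in HFH by lra.
    assert (E : H (s0 + RtoC h) = G (s0 + RtoC h) * RtoC h ^ N).
    { rewrite HFH.
      - field. now apply Cpow_nz.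
      - intros E. apply Hn0. rewrite <- Eh, E. ring.
      - rewrite Cmod_R, Rabs_pos_eq; lra. }
    assert (A1 : (Cmod (G (s0 + RtoC h)%C) < Cmod (G s0) + 1)%R).
    { replace (G (s0 + RtoC h)) with (G s0 + (G (s0 + RtoC h) - G s0)) by ring.
      eapply Rle_lt_trans; [apply Cmod_triangle|]. lra. }
    assert (A2 : (Cmod (H s0) / 2 < Cmod (H (s0 + RtoC h)%C))%R).
    { pose proof (Cmod_triangle (H (s0 + RtoC h)) (- (H (s0 + RtoC h) - H s0))) as Ht.
      rewrite Cmod_opp in Ht.
      replace (H (s0 + RtoC h) + - (H (s0 + RtoC h) - H s0)) with (H s0) in Ht by ring. lra. }
    rewrite E, Cmod_mult, Cmod_pow, Cmod_R, Rabs_pos_eq in A2 by lra.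
    assert (A3 : (h ^ N <= q)%R).
    { destruct N as [|N]; [lia|]. simpl.
      assert (h ^ N <= 1)%R by (rewrite <- (pow1 N); apply pow_incr; lra).
      pose proof (pow_le h N ltac:(lra)). nra. }
    assert (A4 : (Cmod (G (s0 + RtoC h)%C) * h ^ N <= (Cmod (G s0) + 1) * q)%R).
    { apply Rmult_le_compat; [apply Cmod_ge_0|apply pow_le|lra|easy]; lra. }
    replace ((Cmod (G s0) + 1) * q)%R with (Cmod (H s0) / 2)%R in A4 by (unfold q; field; lra). lra.
Qed.

(* The set where F = G on a horizontal line is pushed to the left from the half-plane. *)
Lemma meromorphic_identity (F G : C -> C) (a : R) : meromorphic F ->
  (forall s, analytic_at G s) -> (forall t, (a < Re t)%R -> F t = G t) -> forall s, F s = G s.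
Proof.
  intros HF HG HFG s. apply NNPP. intros Hn.
  set (pt := fun x : R => (x, Im s) : C).
  (* [y] is minus an abscissa, so that the supremum given by [completeness] marks how far to the
     left the agreement reaches. *)
  set (E := fun y => forall u, (- y <= u)%R -> F (pt u) = G (pt u)).
  destruct (completeness E) as [m [Hub Hlub]].
  - exists (- Re s)%R. intros y Hy. apply Rnot_lt_le. intros Hlt. apply Hn.
    specialize (Hy (Re s) ltac:(lra)). unfold pt in Hy. now rewrite <- pair_eta in Hy.
  - exists (- (a + 1))%R. intros u Hu. apply HFG. unfold pt, Re. simpl. lra.
  - assert (Hright : forall u, (- m < u)%R -> F (pt u) = G (pt u)).
    { intros u Hu. apply NNPP. intros Hnu. assert (m <= - u)%R; [|lra]. apply Hlub.
      intros y Hy. apply Rnot_lt_le. intros Hlt. apply Hnu, Hy. lra. }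
    assert (Hsh : forall h, pt (- m)%R + RtoC h = pt (- m + h)%R).
    { intros h. unfold pt. apply injective_projections; simpl; ring. }
    destruct (local_identity F G (pt (- m)%R) 1 Rlt_0_1 (HF _) (HG _)) as [rho [Hrho K]].
    { intros h Hh. rewrite Hsh. apply Hright. lra. }
    (* The disc around the leftmost point extends the agreement by [rho / 2], beyond the
       supremum. *)
    assert (m + rho / 2 <= m)%R; [|lra]. apply Hub. intros u Hu.
    destruct (Rlt_le_dec (- m) u) as [H1|H1]; [now apply Hright|].
    apply K. replace (pt u - pt (- m)%R) with (RtoC (u + m)).
    + rewrite Cmod_R, Rabs_left1; lra.
    + unfold pt. apply injective_projections; simpl; ring.
Qed.

(** * Entirety of the right-hand side and continuation in s *)

Lemma entire_rhs (z : C) (omega : list C) (L : C -> C) : (0 < Im z)%R ->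
  Forall (fun w : C => (0 < Im w)%R) omega -> (forall s, is_usum allP (qterm z omega s) (L s)) ->
  exists M, entire_bd (fun s => phase s * rGamma s * L s) M.
Proof.
  intros Hz Hom HL. destruct (entire_qsum z omega L Hz Hom HL) as [M1 H1].
  destruct rGamma_entire as [[M2 H2] _]. eexists.
  refine (entire_bd_mult _ _ _ _ (entire_bd_mult _ _ _ _ _ H2) H1).
  refine (entire_bd_ext _ _ _ _ (entire_bd_mult _ _ _ _
    (entire_bd_Cexp (- (RtoC PI / 2) * Ci)) (entire_bd_Cexp (RtoC (ln (2 * PI)))))).
  intros s. unfold phase. rewrite <- RtoC_mult, Cpower_RtoC by (pose proof PI_RGT_0; lra).
  f_equal. f_equal. ring.
Qed.

Theorem theorem4p7 (r : nat) (z : C) (omega : list C)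
    (hr : length omega = r)
    (hz : (0 < Im z)%R)
    (homega : List.Forall (fun w : C => (0 < Im w)%R) omega)
    (s : C) :
  exists L : C,
    is_series
      (fun k : nat =>
         let n : C := RtoC (INR (S k)) in
         Cpower n (s - 1) * Cexp (2 * RtoC PI * Ci * n * z)
         / Cprod (map (fun w : C => 1 - Cexp (2 * RtoC PI * Ci * n * w)) omega))
      L
    /\ bilateral_zeta s z (-1) omega
       = Cexp (- (RtoC PI / 2) * Ci * s) * Cpower (2 * RtoC PI) s * rGamma s * L.
Proof.
  (* The sum is chosen for every [s] at once, because the continuation argument needs it as a
     function. *)
  pose (L := fun s => proj1_sig (constructive_indefinite_description _ (qterm_ex z s omega hz homega))).
  assert (HL : forall s, is_usum allP (qterm z omega s) (L s))
    by (intros t; exact (proj2_sig (constructive_indefinite_description _ (qterm_ex z t omega hz homega)))).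
  exists (L s). split.
  - eapply is_series_ext; [|exact (is_usum_is_series _ _ (HL s))].
    intros k. cbv zeta. rewrite Cpower_RtoC by apply INR_S_pos. reflexivity.
  - set (G := fun t => phase t * rGamma t * L t).
    change (bilateral_zeta s z (-1) omega = G s).
    assert (Hhalf : forall t, (INR (length omega) + 1 < Re t)%R ->
       barnes_zeta t (z + -1) (RtoC (-1) :: omega) + barnes_zeta t z (- RtoC (-1) :: omega) = G t).
    { intros t Ht. now apply cone_sum_formula. }
    destruct (entire_rhs z omega L hz homega HL) as [M HM].
    assert (HG : forall t, analytic_at G t) by (intros t; exact (entire_bd_analytic _ _ t HM)).
    unfold bilateral_zeta, continuation at 1.
    destruct (Rlt_dec (INR (length omega) + 1) (Re s)); [now apply Hhalf|].
    (* [G] shows that a meromorphic extension exists, so [epsilon] returns one; the identity theorem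
       then equates it with [G], also at points where a pole was conceivable. *)
    match goal with |- epsilon ?i ?P s = _ => pose proof (epsilon_spec i P) as HF end.
    destruct HF as [HF1 HF2].
    + exists G. split; [intros t; left; apply HG|]. intros t Ht. symmetry. now apply Hhalf.
    + apply (meromorphic_identity _ G (INR (length omega) + 1) HF1 HG).
      intros t Ht. rewrite HF2 by easy. now apply Hhalf.
Qed.
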